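(* It holds that $$\Sigma_h\subset H(\operatorname{div}_{\Gamma_h};\Gamma_h),\qquad\Phi_h\subset H^1(\Gamma_h).$$ Moreover, for every $v_h\in\Sigma_h$, $\phi_h\in\Phi_h$, and $e\in\mathcal E_h$, $$\int_e[\![v_h\cdot t]\!]\,ds=0,\qquad\int_e[\![\partial_n\phi_h]\!]\,ds=0.$$
   Context: Surface and mesh. $\gamma\subset\mathbb R^3$ is a connected, closed, orientable surface of class $C^4$; $d$ is its signed distance on a thin tubular neighbourhood $U_\delta=\{x:\operatorname{dist}(x,\gamma)<\delta\}$; on $U_\delta$, $\nu=\nabla d$ and $\mathbf p(x)=x-d(x)\nu(x)$ (closest-point projection). $\Gamma_h\subset U_\delta$ is a connected, closed, coherently oriented polyhedral surface with a conforming partition $\mathcal T_h$ into planar polygons (faces), edge set $\mathcal E_h$ and vertex set $\mathcal V_h$. $h_K=\operatorname{diam}K$, $h=\max_K h_K$, and $0<h\le h_0\le 1$ with $h_0$ fixed sufficiently small. $\nu_K$ is the unit normal of $K$, $P_K=I-\nu_K\otimes\nu_K$. Mesh assumption: there is $\rho>0$ independent of $h$ such that (M1) $\mathbf p:\Gamma_h\to\gamma$ is bijective and $\|d\|_{L^\infty(K)}\le Ch_K^2$, $\|\nu-\nu_K\|_{L^\infty(K)}\le Ch_K$, $\|1-\mu_h\|_{L^\infty(K)}\le Ch_K^2$ for all $K$, with $C$ independent of $h$ and $K$, where $\mu_h$ is the surface Jacobian, $d\sigma(\mathbf p(x))=\mu_h(x)\,d\sigma_h(x)$; (M2) every $K$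 is star-shaped with respect to a disk of radius at least $\rho h_K$; (M3) distinct vertices $a,b$ of $K$ satisfy $|a-b|\ge\rho h_K$. Face and edge notation. $\nabla_K,\operatorname{div}_K,\Delta_K$ are the planar gradient, divergence and Laplacian on $K$; $\operatorname{curl}_K w=\nu_K\times\nabla_K w$; $\operatorname{curl}_h$ acts facewise. Fields tangential to $K$ are identified with $\mathbb R^2$-valued fields. For each edge $e$ fix an ordered pair $(K,L)$ of faces with $e=\partial K\cap\partial L$ and a unit tangent $t$ used on both sides; $n_K$ is the outward unit conormal of $\partial K$ in the plane of $K$; $\sigma_{K,e}\in\{\pm1\}$ is defined by $\nu_K\times n_K=\sigma_{K,e}t$. $\partial_{n_K}w=n_K\cdot\nabla_Kw$. Jumps: $[\![v\cdot n]\!]=v|_K\cdot n_K+v|_L\cdot n_L$, $[\![v\cdot t]\!]=(v|_K-v|_L)\cdot t$, $[\![\partial_n\phi]\!]=\partial_{n_K}\phi|_K+\partial_{n_L}\phi|_L$. $H(\operatorname{div}_{\Gamma_h};\Gamma_h)$ is the space of facewise tangential $L^2$ fields whose distributional surface divergence on $\Gamma_h$ is in $L^2(\Gamma_h)$; a piecewise $H^1$ tangential field $v$ belongs to it iff $[\![v\cdot n]\!]=0$ on every edge. Local spaces. $\mathbb P_m(D)$: polynomials of degree $\le m$ on $D$. $B_m(\partial K)=\{w\in C^0(\partial K):w|_e\in\mathbb P_m(e)\ \forall e\subset\partial K\}$. $\Sigma(K)=\{v\in[H^1(K)]^2: v|_{\partial K}\in[B_2(\partial K)]^2,\ \operatorname{div}_Kv\in\mathbb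 P_0(K),\ -\Delta_Kv-\nabla_Ks=0\text{ for some }s\in L^2(K)/\mathbb R\}$. $\Phi(K)=\{\phi\in H^2(K):\phi|_{\partial K}\in B_3(\partial K),\ \nabla_K\phi|_{\partial K}\in[B_2(\partial K)]^2,\ \Delta_K^2\phi=0\}$. Global spaces. For each vertex $a$ one reference face $K_a\ni a$ is fixed; for faces $K\ni a$, $M_{a,K}x=(\nu_{K_a}\cdot\nu_K)x-\nu_{K_a}(\nu_K\cdot x)$ ($h_0$ is so small that $\nu_{K_a}\cdot\nu_K$ is uniformly positive). For a piecewise field $v_h$ with $v_K=v_h|_K$, $T_e(v_h)=\frac12\sum_{a\in\partial e}v_{K_a}(a)\cdot t$. $\Sigma_h$ is the set of $v_h$ with $v_K\in\Sigma(K)$ for all $K$ such that: $v_K(a)=M_{a,K}v_{K_a}(a)$ for all $a\in\mathcal V_h$ and $K\ni a$; $\int_e[\![v_h\cdot n]\!]\,ds=0$ for all $e\in\mathcal E_h$; $\frac1{|e|}\int_e v_K\cdot t\,ds=T_e(v_h)$ for all $K$ and $e\subset\partial K$. $\Phi_h$ is the set of $\phi_h$ with $\phi_K=\phi_h|_K\in\Phi(K)$ for all $K$ such that: $\phi_K(a)=\phi_{K_a}(a)$ and $\nabla_K\phi_K(a)=P_K\nabla_{K_a}\phi_{K_a}(a)$ for all $a$ and $K\ni a$; $\frac1{|e|}\int_e\partial_{n_K}\phi_K\,ds=\sigma_{K,e}T_e(\operatorname{curl}_h\phi_h)$ for all $K$ and $e\subset\partial K$. *)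

(* Defs.v *)
From HB Require Import structures.
From mathcomp Require Import all_boot all_order all_algebra.
From mathcomp Require Import all_classical all_reals all_analysis.

Set Implicit Arguments.
Unset Strict Implicit.
Unset Printing Implicit Defensive.

Import Order.TTheory GRing.Theory Num.Theory.
Import numFieldNormedType.Exports.

Local Open Scope classical_set_scope.
Local Open Scope ring_scope.

(* The normed-space structures of ['rV_3] and [R * R] carry the sup norm; only
   their topology and derivatives are used.  Lengths are the Euclidean [enorm]
   and [enorm2]. *)
Notation R3 R := 'rV[R]_3.
Notation R2 R := (R * R)%type.

Definition dot (R : realType) (x y : R3 R) : R := \sum_(i < 3) x 0 i * y 0 i.

(* indices modulo 3 *)
Definition cross (R : realType) (x y : R3 R) : R3 R :=
  \row_(i < 3) (x 0 (i + 1) * y 0 (i + 2%:R) - x 0 (i + 2%:R) * y 0 (i + 1)).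

Definition enorm (R : realType) (x : R3 R) : R := Num.sqrt (dot x x).

Definition dot2 (R : realType) (x y : R2 R) : R := x.1 * y.1 + x.2 * y.2.

Definition enorm2 (R : realType) (x : R2 R) : R := Num.sqrt (dot2 x x).

Definition segment (R : realType) (V : lmodType R) (p q : V) : set V :=
  [set x | exists2 s : R, 0 <= s <= 1 & x = p + s *: (q - p)].

Definition frontier (T : topologicalType) (A : set T) : set T :=
  closure A `\` interior A.

Fixpoint Ck (R : realType) (V : normedModType R) (k : nat) (U : set V)
    (f : V -> R) : Prop :=
  if k is k'.+1 then
    (forall x, U x -> differentiable f x) /\
    (forall v : V, Ck k' U ('D_v f))
  else forall x, U x -> {for x, continuous f}.

Definition smooth (R : realType) (V : normedModType R) (f : V -> R) : Prop :=
  forall k, Ck k setT f.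

Definition dist_to (R : realType) (gamma : set (R3 R)) (x : R3 R) : R :=
  inf [set enorm (x - y) | y in gamma].

Definition grad3 (R : realType) (f : R3 R -> R) (x : R3 R) : R3 R :=
  \row_(i < 3) 'D_(delta_mx 0 i : R3 R) f x.

(* [n] is orthogonal to the tangent plane of [gamma] at [x]. *)
Definition normal_at (R : realType) (gamma : set (R3 R)) (x n : R3 R) : Prop :=
  forall eps : R, 0 < eps -> exists2 eta : R, 0 < eta &
    forall y, gamma y -> enorm (y - x) < eta ->
      `|dot n (y - x)| <= eps * enorm (y - x).

Record closed_C4_surface (R : realType) (gamma : set (R3 R)) : Prop := {
  surf_nonempty : gamma !=set0;
  surf_compact : compact gamma;
  surf_connected : connected gamma;
  surf_C4 : forall x, gamma x -> exists U : set (R3 R), exists F : R3 R -> R,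
    [/\ open U, U x, Ck 4 U F, forall y, U y -> grad3 F y != 0 &
        gamma `&` U = [set y | U y /\ F y = 0]];
  surf_orientable : exists N : R3 R -> R3 R,
    {within gamma, continuous N} /\
    forall x, gamma x -> enorm (N x) = 1 /\ normal_at gamma x (N x)
}.

(* [W] is the side of the surface [gamma] on which the distance is counted
   negatively; either of the two sides is allowed. *)
Definition is_side (R : realType) (gamma W : set (R3 R)) : Prop :=
  [/\ open W, interior (closure W) = W & frontier W = gamma].

Definition sdist (R : realType) (gamma W : set (R3 R)) (x : R3 R) : R :=
  if `[< W x >] then - dist_to gamma x else dist_to gamma x.

Definition tube (R : realType) (gamma : set (R3 R)) (delta : R) : set (R3 R) :=
  [set x | dist_to gamma x < delta].

Definition thin_tube (R : realType) (gamma W : set (R3 R)) (delta : R) : Prop :=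
  [/\ 0 < delta, Ck 4 (tube gamma delta) (sdist gamma W) &
      forall x, tube gamma delta x ->
        exists! y, gamma y /\ enorm (x - y) = dist_to gamma x].

Definition nu (R : realType) (gamma W : set (R3 R)) (x : R3 R) : R3 R :=
  grad3 (sdist gamma W) x.

Definition cproj (R : realType) (gamma W : set (R3 R)) (x : R3 R) : R3 R :=
  x - sdist gamma W x *: nu gamma W x.

(* A polygon is given by its closed region [D] and the cyclic list [z] of its
   vertices; three consecutive vertices may be collinear.  As [D] is the
   compact closure of its interior and its frontier is the simple closed curve
   through [z], [D] is the region enclosed by that curve. *)
Record polygon (R : realType) (D : set (R2 R)) (z : seq (R2 R)) : Prop := {
  polygon_size : (3 <= size z)%N;
  polygon_uniq : uniq z;
  polygon_compact : compact D;
  polygon_regular : closure (interior D) = D;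
  polygon_frontier :
    frontier D = [set x | exists2 p, p \in z & segment p (next z p) x];
  polygon_simple : forall p q x, p \in z -> q \in z -> p != q ->
    segment p (next z p) x -> segment q (next z q) x ->
    (x = q /\ q = next z p) \/ (x = p /\ p = next z q)
}.

Definition mu2 (R : realType) :=
  (@lebesgue_measure R \x @lebesgue_measure R)%E.

Definition e1 (R : realType) : R2 R := (1, 0).
Definition e2 (R : realType) : R2 R := (0, 1).

Definition c1 (R : realType) (v : R2 R -> R2 R) (x : R2 R) : R := (v x).1.
Definition c2 (R : realType) (v : R2 R -> R2 R) (x : R2 R) : R := (v x).2.

Definition int2 (R : realType) (D : set (R2 R)) (f : R2 R -> R) : R :=
  \int[@mu2 R]_(x in D) f x.

Definition intseg (R : realType) (V : lmodType R) (p q : V) (f : V -> R) : R :=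
  \int[@lebesgue_measure R]_(s in `[0, 1]) f (p + s *: (q - p)).

Definition L2 (R : realType) (D : set (R2 R)) (f : R2 R -> R) : Prop :=
  @measurable_fun _ _ (measurableTypeR R * measurableTypeR R)%type R D f /\
  (@mu2 R).-integrable D (fun x => ((f x) ^+ 2)%:E).

Definition L2seg (R : realType) (p q : R2 R) (f : R2 R -> R) : Prop :=
  @measurable_fun _ _ (measurableTypeR R) R `[0, 1]
    (fun s => f (p + s *: (q - p))) /\
  (@lebesgue_measure R).-integrable `[0, 1]
    (fun s => ((f (p + s *: (q - p))) ^+ 2)%:E).

Definition testfun (R : realType) (D : set (R2 R)) (psi : R2 R -> R) : Prop :=
  let S := closure [set x | psi x != 0] in
  [/\ smooth psi, compact S & S `<=` interior D].

Definition weak_deriv (R : realType) (D : set (R2 R)) (v : R2 R)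
    (w g : R2 R -> R) : Prop :=
  L2 D g /\ forall psi, testfun D psi ->
    int2 D (fun x => w x * 'D_v psi x) = - int2 D (fun x => g x * psi x).

Definition H1_space (R : realType) (D : set (R2 R)) (w : R2 R -> R) : Prop :=
  L2 D w /\ forall v, exists g, weak_deriv D v w g.

Definition wD (R : realType) (D : set (R2 R)) (v : R2 R) (w : R2 R -> R) :
    R2 R -> R :=
  xget (cst 0) [set g | weak_deriv D v w g].

Definition H2_space (R : realType) (D : set (R2 R)) (w : R2 R -> R) : Prop :=
  H1_space D w /\ forall v, H1_space D (wD D v w).

Definition wgrad (R : realType) (D : set (R2 R)) (w : R2 R -> R) (x : R2 R) :
  R2 R := (wD D (e1 R) w x, wD D (e2 R) w x).

Definition wdiv (R : realType) (D : set (R2 R)) (v : R2 R -> R2 R) (x : R2 R) :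
  R := wD D (e1 R) (c1 v) x + wD D (e2 R) (c2 v) x.

Definition wlap (R : realType) (D : set (R2 R)) (w : R2 R -> R) : R2 R -> R :=
  wdiv D (wgrad D w).

Definition cgrad (R : realType) (f : R2 R -> R) (x : R2 R) : R2 R :=
  ('D_(e1 R) f x, 'D_(e2 R) f x).

Definition cdiv (R : realType) (v : R2 R -> R2 R) (x : R2 R) : R :=
  'D_(e1 R) (c1 v) x + 'D_(e2 R) (c2 v) x.

(* [g] is an L^2 representative of the trace of [w] on the boundary: the
   restriction of smooth functions, extended by continuity from H^1 to L^2. *)
Definition is_trace (R : realType) (D : set (R2 R)) (z : seq (R2 R))
    (w g : R2 R -> R) : Prop :=
  [/\ H1_space D w,
      forall p, p \in z -> L2seg p (next z p) g &
      exists u : nat -> R2 R -> R,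
      [/\ forall k, smooth (u k),
          int2 D (fun x => (u k x - w x) ^+ 2) @[k --> \oo] --> (0 : R),
          forall v, int2 D (fun x => ('D_v (u k) x - wD D v w x) ^+ 2)
                      @[k --> \oo] --> (0 : R) &
          forall p, p \in z ->
            intseg p (next z p) (fun x => (u k x - g x) ^+ 2)
              @[k --> \oo] --> (0 : R)]].

Definition Bspace (R : realType) (m : nat) (D : set (R2 R)) (z : seq (R2 R))
    (g : R2 R -> R) : Prop :=
  {within frontier D, continuous g} /\
  forall p, p \in z -> exists2 q : {poly R}, (size q <= m.+1)%N &
    forall s : R, 0 <= s <= 1 -> g (p + s *: (next z p - p)) = q.[s].

Definition trace_in_B (R : realType) (m : nat) (D : set (R2 R))
    (z : seq (R2 R)) (w : R2 R -> R) : Prop :=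
  exists2 g, is_trace D z w g & Bspace m D z g.

(* The continuous representative of the trace, for functions that have one; it
   gives meaning to values at vertices. *)
Definition bdval (R : realType) (D : set (R2 R)) (z : seq (R2 R))
    (w : R2 R -> R) : R2 R -> R :=
  xget (cst 0)
    [set g | is_trace D z w g /\ {within frontier D, continuous g}].

Definition bdvec (R : realType) (D : set (R2 R)) (z : seq (R2 R))
    (v : R2 R -> R2 R) (x : R2 R) : R2 R :=
  (bdval D z (c1 v) x, bdval D z (c2 v) x).

Definition ae_const (R : realType) (D : set (R2 R)) (f : R2 R -> R) : Prop :=
  exists c : R, {ae @mu2 R, forall x, D x -> f x = c}.

Record SigmaK (R : realType) (D : set (R2 R)) (z : seq (R2 R))
    (v : R2 R -> R2 R) : Prop := {
  SigmaK_H1 : H1_space D (c1 v) /\ H1_space D (c2 v);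
  SigmaK_trace : trace_in_B 2 D z (c1 v) /\ trace_in_B 2 D z (c2 v);
  SigmaK_div : ae_const D (wdiv D v);
  SigmaK_stokes : exists2 s, L2 D s &
    forall psi : R2 R -> R2 R, testfun D (c1 psi) -> testfun D (c2 psi) ->
      int2 D (fun x => dot2 (wgrad D (c1 v) x) (cgrad (c1 psi) x)
                     + dot2 (wgrad D (c2 v) x) (cgrad (c2 psi) x))
      + int2 D (fun x => s x * cdiv psi x) = 0
}.

Record PhiK (R : realType) (D : set (R2 R)) (z : seq (R2 R))
    (phi : R2 R -> R) : Prop := {
  PhiK_H2 : H2_space D phi;
  PhiK_trace : trace_in_B 3 D z phi;
  PhiK_grad_trace : trace_in_B 2 D z (c1 (wgrad D phi)) /\
                    trace_in_B 2 D z (c2 (wgrad D phi));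
  PhiK_biharmonic : forall psi, testfun D psi ->
    int2 D (fun x => wlap D phi x * cdiv (cgrad psi) x) = 0
}.

(* The plane of a face is identified with [R * R] by means of an origin
   [org] and a frame [tau1], [tau2]; [dom] is the face in these coordinates,
   [cyc] the cyclic list of its vertices, and [ncn K e] its outward unit
   conormal at [e] (relevant only if [e] is an edge of [K]).  The unit tangent
   of the edge [e] points from [ea e] to [eb e], and [(eK e, eL e)] is the
   ordered pair of faces adjacent to [e]. *)
Record polysurf (R : realType) := PolySurf {
  vert : finType;
  face : finType;
  edge : finType;
  pos : vert -> R3 R;
  cyc : face -> seq vert;
  org : face -> R3 R;
  tau1 : face -> R3 R;
  tau2 : face -> R3 R;
  dom : face -> set (R2 R);
  ncn : face -> edge -> R2 R;
  ea : edge -> vert;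
  eb : edge -> vert;
  eK : edge -> face;
  eL : edge -> face
}.

Definition nuK (R : realType) (M : polysurf R) (K : face M) : R3 R :=
  cross (tau1 K) (tau2 K).

Definition tlift (R : realType) (M : polysurf R) (K : face M) (v : R2 R) :
  R3 R := v.1 *: tau1 K + v.2 *: tau2 K.

Definition coord (R : realType) (M : polysurf R) (K : face M) (x : R3 R) :
  R2 R := (dot (tau1 K) x, dot (tau2 K) x).

Definition emb (R : realType) (M : polysurf R) (K : face M) (x : R2 R) :
  R3 R := org K + tlift K x.

Definition loc (R : realType) (M : polysurf R) (K : face M) (x : R3 R) :
  R2 R := coord K (x - org K).

Definition zs (R : realType) (M : polysurf R) (K : face M) : seq (R2 R) :=
  [seq loc K (pos a) | a <- cyc K].

Definition face_set (R : realType) (M : polysurf R) (K : face M) :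
  set (R3 R) := emb K @` dom K.

Definition Gamma (R : realType) (M : polysurf R) : set (R3 R) :=
  [set x | exists K : face M, face_set K x].

Definition joins (R : realType) (M : polysurf R) (e : edge M) (a b : vert M) :
  bool := ((ea e == a) && (eb e == b)) || ((ea e == b) && (eb e == a)).

Definition onb (R : realType) (M : polysurf R) (K : face M) (e : edge M) :
  bool := has (fun a => joins e a (next (cyc K) a)) (cyc K).

Definition edge_set (R : realType) (M : polysurf R) (e : edge M) :
  set (R3 R) := segment (pos (ea e)) (pos (eb e)).

Definition elen (R : realType) (M : polysurf R) (e : edge M) : R :=
  enorm (pos (eb e) - pos (ea e)).

Definition utan (R : realType) (M : polysurf R) (e : edge M) : R3 R :=
  (elen e)^-1 *: (pos (eb e) - pos (ea e)).

Definition nK (R : realType) (M : polysurf R) (K : face M) (e : edge M) :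
  R3 R := tlift K (ncn K e).

Definition is_outward_conormal (R : realType) (D : set (R2 R)) (p q n : R2 R) :
    Prop :=
  [/\ dot2 n n = 1, dot2 n (q - p) = 0 &
      forall s : R, 0 < s < 1 -> exists2 eps : R, 0 < eps &
        forall r : R, 0 < r < eps ->
          D (p + s *: (q - p) - r *: n) /\ ~ D (p + s *: (q - p) + r *: n)].

Definition star_adj (R : realType) (M : polysurf R) (a : vert M)
    (K L : face M) : bool :=
  [exists e : edge M,
     [&& (ea e == a) || (eb e == a), onb K e & onb L e]].

Record closed_polyhedral_surface (R : realType) (M : polysurf R) : Prop := {
  ps_pos_inj : injective (@pos R M);
  ps_frame : forall K : face M,
    [/\ dot (tau1 K) (tau1 K) = 1, dot (tau2 K) (tau2 K) = 1 &
        dot (tau1 K) (tau2 K) = 0];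
  ps_planar : forall (K : face M) a, a \in cyc K ->
    emb K (loc K (pos a)) = pos a;
  ps_polygon : forall K : face M, polygon (dom K) (zs K);
  ps_edge_exists : forall (K : face M) a, a \in cyc K ->
    exists e : edge M, joins e a (next (cyc K) a);
  ps_edge_uniq : forall e e' : edge M, joins e (ea e') (eb e') -> e = e';
  ps_edge_faces : forall e : edge M,
    eK e <> eL e /\ forall K, onb K e = (K == eK e) || (K == eL e);
  ps_conforming : forall K L : face M, K <> L ->
    let I := face_set K `&` face_set L in
    [\/ I = set0,
        exists a, [/\ a \in cyc K, a \in cyc L & I = [set pos a]] |
        exists e, [/\ onb K e, onb L e & I = edge_set e]];
  (* the faces around a vertex form a single fan *)
  ps_vertex_fan : forall a (K L : face M), a \in cyc K -> a \in cyc L ->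
    connect (star_adj a) K L;
  ps_connected : connected (Gamma M);
  ps_conormal : forall (K : face M) (e : edge M), onb K e ->
    is_outward_conormal (dom K) (loc K (pos (ea e))) (loc K (pos (eb e)))
      (ncn K e);
  (* the two faces induce opposite orientations on a common edge *)
  ps_coherent : forall e : edge M,
    cross (nuK (eK e)) (nK (eK e) e) = - cross (nuK (eL e)) (nK (eL e) e)
}.

Definition hK (R : realType) (M : polysurf R) (K : face M) : R :=
  sup [set r | exists x y, [/\ face_set K x, face_set K y & r = enorm (x - y)]].

Definition hmesh (R : realType) (M : polysurf R) : R :=
  \big[Num.max/0]_(K : face M) hK K.

(* the area element of [cproj \o emb K], [emb K] being isometric *)
Definition mu_h (R : realType) (gamma W : set (R3 R)) (M : polysurf R)
    (K : face M) (x : R2 R) : R :=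
  let P y := cproj gamma W (emb K y) in
  enorm (cross ('D_(e1 R) P x) ('D_(e2 R) P x)).

(* The functions bounded in (M1) are continuous, so that their L^infinity
   bounds hold pointwise. *)
Definition meshM1 (R : realType) (gamma W : set (R3 R)) (C : R)
    (M : polysurf R) : Prop :=
  set_bij (Gamma M) gamma (cproj gamma W) /\
  forall (K : face M) (x : R2 R), dom K x ->
    [/\ `|sdist gamma W (emb K x)| <= C * hK K ^+ 2,
        enorm (nu gamma W (emb K x) - nuK K) <= C * hK K &
        `|1 - mu_h gamma W K x| <= C * hK K ^+ 2].

Definition star_shaped_disk (R : realType) (D : set (R2 R)) (c : R2 R)
    (r : R) : Prop :=
  forall x y, D x -> enorm2 (y - c) <= r -> segment x y `<=` D.

Definition meshM2 (R : realType) (rho : R) (M : polysurf R) : Prop :=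
  forall K : face M, exists c : R2 R, exists2 r : R,
    rho * hK K <= r & star_shaped_disk (dom K) c r.

Definition meshM3 (R : realType) (rho : R) (M : polysurf R) : Prop :=
  forall (K : face M) a b, a \in cyc K -> b \in cyc K -> a != b ->
    rho * hK K <= enorm (pos a - pos b).

Record admissible (R : realType) (gamma W : set (R3 R)) (delta rho C h0 : R)
    (M : polysurf R) : Prop := {
  adm_surface : closed_polyhedral_surface M;
  adm_tube : Gamma M `<=` tube gamma delta;
  adm_h : 0 < hmesh M <= h0;
  adm_M1 : meshM1 gamma W C M;
  adm_M2 : meshM2 rho M;
  adm_M3 : meshM3 rho M
}.

Definition h0_small (R : realType) (gamma W : set (R3 R)) (delta rho C h0 : R) :
    Prop :=
  0 < h0 <= 1 /\
  exists2 c : R, 0 < c &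
    forall M : polysurf R, admissible gamma W delta rho C h0 M ->
    forall a (K L : face M), a \in cyc K -> a \in cyc L ->
      c <= dot (nuK K) (nuK L).

(* Facewise functions and tangential fields are given in the coordinates of
   the faces; only their values on [dom K] matter. *)

Definition pwfun (R : realType) (M : polysurf R) := face M -> R2 R -> R.
Definition pwfield (R : realType) (M : polysurf R) := face M -> R2 R -> R2 R.

Definition int_Gamma (R : realType) (M : polysurf R) (f : pwfun M) : R :=
  \sum_(K : face M) int2 (dom K) (f K).

Definition L2_Gamma (R : realType) (M : polysurf R) (f : pwfun M) : Prop :=
  forall K, L2 (dom K) (f K).

Definition L2_field (R : realType) (M : polysurf R) (v : pwfield M) : Prop :=
  forall K, L2 (dom K) (c1 (v K)) /\ L2 (dom K) (c2 (v K)).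

(* The test functions for distributional derivatives on the Lipschitz surface
   [Gamma M]: continuous and smooth up to the boundary on every face. *)
Definition surf_testfun (R : realType) (M : polysurf R) (psi : pwfun M) :
    Prop :=
  (forall K, smooth (psi K)) /\
  forall K L x y, dom K x -> dom L y -> emb K x = emb L y ->
    psi K x = psi L y.

(* Tangential test fields need a continuous conormal component across edges,
   so that their surface divergence has no edge part. *)
Definition surf_testfield (R : realType) (M : polysurf R) (psi : pwfield M) :
    Prop :=
  (forall K, smooth (c1 (psi K)) /\ smooth (c2 (psi K))) /\
  forall e x, edge_set e x ->
    dot2 (psi (eK e) (loc (eK e) x)) (ncn (eK e) e)
    + dot2 (psi (eL e) (loc (eL e) x)) (ncn (eL e) e) = 0.

Definition Hdiv_Gamma (R : realType) (M : polysurf R) (v : pwfield M) : Prop :=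
  L2_field v /\ exists2 g : pwfun M, L2_Gamma g &
    forall psi, surf_testfun psi ->
      int_Gamma (fun K x => dot2 (v K x) (cgrad (psi K) x))
      = - int_Gamma (fun K x => g K x * psi K x).

Definition H1_Gamma (R : realType) (M : polysurf R) (phi : pwfun M) : Prop :=
  L2_Gamma phi /\ exists2 G : pwfield M, L2_field G &
    forall psi, surf_testfield psi ->
      int_Gamma (fun K x => phi K x * cdiv (psi K) x)
      = - int_Gamma (fun K x => dot2 (G K x) (psi K x)).

Definition int_edge (R : realType) (M : polysurf R) (e : edge M)
    (f : R3 R -> R) : R :=
  elen e * intseg (pos (ea e)) (pos (eb e)) f.

Definition gradh (R : realType) (M : polysurf R) (phi : pwfun M) :
  pwfield M := fun K => wgrad (dom K) (phi K).

Definition curlh (R : realType) (M : polysurf R) (phi : pwfun M) :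
  pwfield M := fun K x => coord K (cross (nuK K) (tlift K (gradh phi K x))).

Definition bval (R : realType) (M : polysurf R) (phi : pwfun M) (K : face M)
  (x : R3 R) : R := bdval (dom K) (zs K) (phi K) (loc K x).

Definition bvec (R : realType) (M : polysurf R) (v : pwfield M) (K : face M)
  (x : R3 R) : R3 R := tlift K (bdvec (dom K) (zs K) (v K) (loc K x)).

Definition dn (R : realType) (M : polysurf R) (phi : pwfun M) (K : face M)
  (e : edge M) (x : R3 R) : R := dot (nK K e) (bvec (gradh phi) K x).

Definition jump_n (R : realType) (M : polysurf R) (v : pwfield M) (e : edge M)
    (x : R3 R) : R :=
  dot (bvec v (eK e) x) (nK (eK e) e) + dot (bvec v (eL e) x) (nK (eL e) e).

Definition jump_t (R : realType) (M : polysurf R) (v : pwfield M) (e : edge M)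
    (x : R3 R) : R :=
  dot (bvec v (eK e) x - bvec v (eL e) x) (utan e).

Definition jump_dn (R : realType) (M : polysurf R) (phi : pwfun M)
    (e : edge M) (x : R3 R) : R :=
  dn phi (eK e) e x + dn phi (eL e) e x.

Definition sigma (R : realType) (M : polysurf R) (K : face M) (e : edge M) :
  R := dot (cross (nuK K) (nK K e)) (utan e).

(* [Ka a] is the reference face fixed at the vertex [a]. *)

Definition MaK (R : realType) (M : polysurf R) (Ka : vert M -> face M)
    (a : vert M) (K : face M) (x : R3 R) : R3 R :=
  dot (nuK (Ka a)) (nuK K) *: x - dot (nuK K) x *: nuK (Ka a).

Definition PK (R : realType) (M : polysurf R) (K : face M) (x : R3 R) : R3 R :=
  x - dot (nuK K) x *: nuK K.

Definition Te (R : realType) (M : polysurf R) (Ka : vert M -> face M)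
    (v : pwfield M) (e : edge M) : R :=
  2^-1 * (dot (bvec v (Ka (ea e)) (pos (ea e))) (utan e)
        + dot (bvec v (Ka (eb e)) (pos (eb e))) (utan e)).

Record Sigma_h (R : realType) (M : polysurf R) (Ka : vert M -> face M)
    (v : pwfield M) : Prop := {
  Sigma_local : forall K, SigmaK (dom K) (zs K) (v K);
  Sigma_vertex : forall a (K : face M), a \in cyc K ->
    bvec v K (pos a) = MaK Ka a K (bvec v (Ka a) (pos a));
  Sigma_normal : forall e, int_edge e (jump_n v e) = 0;
  Sigma_tangent : forall (K : face M) e, onb K e ->
    (elen e)^-1 * int_edge e (fun x => dot (bvec v K x) (utan e)) = Te Ka v e
}.

Record Phi_h (R : realType) (M : polysurf R) (Ka : vert M -> face M)
    (phi : pwfun M) : Prop := {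
  Phi_local : forall K, PhiK (dom K) (zs K) (phi K);
  Phi_vertex : forall a (K : face M), a \in cyc K ->
    bval phi K (pos a) = bval phi (Ka a) (pos a);
  Phi_grad_vertex : forall a (K : face M), a \in cyc K ->
    bvec (gradh phi) K (pos a) = PK K (bvec (gradh phi) (Ka a) (pos a));
  Phi_normal : forall (K : face M) e, onb K e ->
    (elen e)^-1 * int_edge e (dn phi K e) = sigma K e * Te Ka (curlh phi) e
}.

(* Main.v *)
(* On an edge, the normal jump of a field in Sigma_h is a quadratic polynomial with
   zero mean.  It vanishes at the end points: by Lagrange's identity the normal
   component of M_(a,K) y is (nu_(K_a) x y) . (nu_K x n_K), and nu_K x n_K
   changes sign from one face to the other.  Hence it is 0.  For a function in
   Phi_h the two traces on an edge are cubics with equal values and, since the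
   derivative of the trace along the edge is the tangential component of the
   trace of the gradient, equal derivatives at the end points; so they
   coincide.  Both inclusions then follow from Green's formula on each face.
   The zero means of the remaining jumps are read off the edge conditions.

   Green's formula on a polygon given by its frontier is obtained by slicing
   along lines: on a generic line, the conormals tell at which crossings the
   region is entered and left.  Traces are determined only through this formula,
   so their uniqueness and the derivative of the trace along an edge are
   obtained by testing with polynomials that concentrate on that edge. *)

Require Import Defs.
From HB Require Import structures.
From mathcomp Require Import all_boot all_order all_algebra.
From mathcomp Require Import all_classical all_reals all_analysis.
From mathcomp Require Import measurable_realfun.
From mathcomp Require Import ring lra.

Set Implicit Arguments.
Unset Strict Implicit.
Unset Printing Implicit Defensive.

Import Order.TTheory GRing.Theory Num.Theory.
Import numFieldNormedType.Exports.

Local Open Scope classical_set_scope.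
Local Open Scope ring_scope.

(** * Green's formula on polygons *)

(** Green's formula on a face yields only identities summed over all its sides, and other sides of a
    polygon may lie on the line of a given one, so concentrating test functions on that line is not
    enough. The second factor that isolates one side is at least 1 on it, and its powers may be
    unbounded there. No limit is therefore taken on that side: its integral is bounded below while
    those of the other sides tend to 0. This needs a nonnegative integrand on the chosen side, which
    is why squares appear in both applications. For uniqueness, the difference of two traces is
    multiplied by the traces themselves, admissible as limits of smooth functions. For the
    tangential derivative, the defect is a polynomial and is put into the test function. Uniqueness
    matters because [bdval] is a mere choice among continuous traces: without it, the piecewise
    polynomial trace provided by the local spaces could differ from the chosen one. *)

Section slice.
Context {R : realType}.
Notation mu := (@lebesgue_measure R).
Implicit Types (A : set R) (f F : R -> R).

Lemma Rintegral_FTC2 f F (a b : R) : a <= b -> continuous f ->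
  (forall x : R, is_derive x (1 : R) F (f x)) ->
  \int[mu]_(x in `[a, b]) f x = F b - F a.
Proof.
move=> ab cf dF.
have cF x : {for x, continuous F}.
  by apply: differentiable_continuous; apply/derivable1_diffP; case: (dF x).
move: ab; rewrite le_eqVlt => /predU1P[<-|ab].
  by rewrite subrr set_itv1 Rintegral_set1.
rewrite /Rintegral (@continuous_FTC2 _ f F)//.
- exact: continuous_subspaceT.
- split; first by move=> x _; case: (dF x).
  + exact/cvg_at_right_filter/cF.
  + exact/cvg_at_left_filter/cF.
- by move=> x _; rewrite derive1E; case: (dF x).
Qed.

(* [xs] lists the points where the bounded set [A] changes, each with the side
   on which [A] lies: [true] when it lies on the left. *)
Lemma Rintegral_slice_path A f F (B : R) (xs : seq (R * bool)) (a : R)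
    (l : bool) :
  (forall x, A x -> x < B) -> continuous f ->
  (forall x : R, is_derive x (1 : R) F (f x)) ->
  mu.-integrable setT (EFin \o f \_ A) ->
  path (fun u v => u.1 < v.1) (a, l) xs ->
  (forall x y, a < x -> x < y -> (forall u, u \in xs -> ~ x <= u.1 <= y) ->
     A x <-> A y) ->
  (forall u, u \in xs -> exists2 e : R, 0 < e & forall r, 0 < r < e ->
     (A (u.1 - r) <-> u.2) /\ (A (u.1 + r) <-> ~~ u.2)) ->
  (exists2 e : R, 0 < e & forall r, 0 < r < e -> A (a + r) <-> l) ->
  \int[mu]_(x in `]a, +oo[) (f \_ A) x =
    \sum_(u <- xs) (-1) ^+ (~~ u.2) * F u.1 - l%:R * F a.
Proof.
move=> AB cf dF fA; have ifA (I : interval R) :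
    mu.-integrable [set` I] (EFin \o f \_ A).
  by apply: integrableS fA.
elim: xs a l => [|[c s] xs IH] a l /=.
  (* No change point is left, so a point of [A] beyond [a] would put [B] itself into [A]. Hence [A]
     is empty there and [l] is false. *)
  move=> _ Aconst _ [e e0 Ae].
  have nA x : a < x -> ~ A x.
    move=> ax /[dup] /AB xB /(Aconst x B ax xB) AB'.
    by have /AB := AB' (fun u h => False_ind _ (notF h)); rewrite ltxx.
  rewrite big_nil sub0r.
  have /Ae : 0 < e / 2 < e by lra.
  case: l {Ae} => [[_ /(_ isT)]|_]; first by move/nA => /(_ ltac:(lra)).
  rewrite mul0r oppr0 (@eq_Rintegral _ _ _ _ _ (cst 0)); last first.
    move=> x; rewrite inE/= in_itv/= andbT => /nA nAx.
    by rewrite patchE memNset.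
  by rewrite Rintegral_cst// mul0r.
move=> /andP[ac cxs] Aconst Ajump [e e0 Ae].
have [d d0 Ad] := Ajump (c, s) (mem_head _ _); rewrite /= in Ad.
have xs_gt u : u \in xs -> c < u.1.
  have /order_path_min : transitive (fun u v : R * bool => u.1 < v.1).
    by move=> ? ? ?; exact: lt_trans.
  by move=> /(_ _ _ cxs)/allP h /h.
have Aac x y : a < x -> x < y -> y < c -> A x <-> A y.
  move=> ax xy yc; apply: Aconst => // u; rewrite inE => /predU1P[->/=|/xs_gt].
    by apply/negP; lra.
  by move=> cu; apply/negP; lra.
have Al x : a < x -> x < c -> A x <-> l.
  move=> ax xc; set r := Num.min (e / 2) ((x - a) / 2).
  have [r1 r2] : r <= e / 2 /\ r <= (x - a) / 2.
    by rewrite /r; split; rewrite ge_min lexx ?orbT.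
  have r0 : 0 < r by rewrite lt_min; apply/andP; split; lra.
  have /Ae <- : 0 < r < e by lra.
  by symmetry; apply: Aac; lra.
(* Membership is constant between [a] and the next change point [c]; it is [l] when read just after
   [a] and [s] when read just before [c]. *)
have ls : l = s.
  set r := Num.min (d / 2) ((c - a) / 2).
  have [r1 r2] : r <= d / 2 /\ r <= (c - a) / 2.
    by rewrite /r; split; rewrite ge_min lexx ?orbT.
  have r0 : 0 < r by rewrite lt_min; apply/andP; split; lra.
  have /Ad[h _] : 0 < r < d by apply/andP; split; lra.
  have acr : a < c - r by lra.
  have crc : c - r < c by lra.
  by apply/idP/idP => [/(Al _ acr crc)/h|/h/(Al _ acr crc)].
rewrite big_cons /=.
have := @Rintegral_itvB _ (f \_ A) (BRight a) +oo%O c (ifA _).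
rewrite !bnd_simp => /(_ (ltW ac) isT) /eqP; rewrite subr_eq => /eqP ->.
rewrite (IH c (~~ s)) //; last 4 first.
- by move: cxs; case: (xs).
- move=> x y cx xy h; apply: Aconst => //; first exact: lt_trans cx.
  by move=> u; rewrite inE => /predU1P[->/=|/h//]; apply/negP; lra.
- by move=> u uxs; apply: Ajump; rewrite inE uxs orbT.
- by exists d => // r /Ad[].
have -> : \int[mu]_(x in `]a, c]) (f \_ A) x = l%:R * (F c - F a).
  rewrite -Rintegral_itv_bndo_bndc//.
  transitivity (\int[mu]_(x in `]a, c[) (l%:R * f x)).
    apply: eq_Rintegral => x; rewrite inE/= in_itv/= => /andP[ax xc].
    rewrite patchE; case: l {Ae ls} Al => Al.
      by rewrite mem_set ?mul1r//; apply/Al.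
    by rewrite mul0r memNset// => /(Al _ ax xc).
  have icf : mu.-integrable `[a, c] (EFin \o f).
    by apply: continuous_compact_integrable;
      [exact: segment_compact|exact: continuous_subspaceT].
  have icf' (i j : bool) :
      mu.-integrable [set` Interval (BSide i a) (BSide j c)] (EFin \o f).
    by apply: integrableS icf => //; case: i; case: j;
      rewrite ?bnd_simp; apply: subset_itv; rewrite bnd_simp.
  rewrite RintegralZl// Rintegral_itv_bndo_bndc; last exact: (icf' false true).
  rewrite Rintegral_itv_obnd_cbnd; last exact: (icf' false false).
  by rewrite (Rintegral_FTC2 (ltW ac) cf dF).
(* The stretch ending at [c] contributes [F c] if [s] holds, and the tail subtracts [F c]
   otherwise. *)
rewrite ls; set S := \sum_(u <- xs) _.
suff -> : (-1) ^+ (~~ s) = s%:R - (~~ s)%:R :> R by ring.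
by case: (s); rewrite ?expr0 ?expr1 /= ?subr0 ?sub0r.
Qed.

(** Sorting the change points reduces this to the ordered version, started where the set is still
    empty; distinct abscissas make the sorted list strictly increasing. *)
Lemma Rintegral_slice A f F (B : R) (xs : seq (R * bool)) :
  closed A -> (forall x, A x -> `|x| < B) -> continuous f ->
  (forall x : R, is_derive x (1 : R) F (f x)) ->
  uniq (map fst xs) ->
  (forall x y, x < y -> (forall u, u \in xs -> ~ x <= u.1 <= y) ->
     A x <-> A y) ->
  (forall u, u \in xs -> exists2 e : R, 0 < e & forall r, 0 < r < e ->
     (A (u.1 - r) <-> u.2) /\ (A (u.1 + r) <-> ~~ u.2)) ->
  \int[mu]_x (f \_ A) x = \sum_(u <- xs) (-1) ^+ (~~ u.2) * F u.1.
Proof.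
move=> cA AB cf dF uxs Aconst Ajump.
have fA : mu.-integrable setT (EFin \o f \_ A).
  have kA : compact A.
    apply: (subclosed_compact cA (@segment_compact _ (- B) B)) => x /AB.
    by rewrite /= in_itv/= ltr_norml => /andP[/ltW -> /ltW ->].
  rewrite -restrict_EFin.
  have [+ _] := @integrable_mkcond _ _ _ mu _ (EFin \o f) (compact_measurable kA).
  apply; apply: continuous_compact_integrable => //.
  exact: continuous_subspaceT.
(* A point to the left of [- B] and of every change point. *)
pose a := - (`|B| + 1 + \sum_(u <- xs) `|u.1|).
have S0 : 0 <= \sum_(u <- xs) `|u.1| by apply: sumr_ge0.
have aB : a < - B by rewrite /a ltrN2 -addrA (le_lt_trans (ler_norm B))// ltrDl; lra.
pose ys := sort (fun u v => u.1 <= v.1) xs.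
have ysE : ys =i xs by exact: mem_sort.
have yperm : perm_eq ys xs by rewrite perm_sort.
have srt : path (fun u v => u.1 < v.1) (a, false) ys.
  have tr : transitive (fun u v : R * bool => u.1 < v.1).
    by move=> ? ? ?; exact: lt_trans.
  rewrite (path_sortedE tr); apply/andP; split.
    apply/allP => u; rewrite ysE => uxs'; rewrite /= /a.
    have : `|u.1| <= \sum_(u <- xs) `|u.1|.
      by rewrite (big_rem u)//= lerDl sumr_ge0.
    have := normr_ge0 B; have := ler_norm (- u.1); rewrite normrN; lra.
  have : sorted (fun u v : R * bool => u.1 <= v.1) ys.
    by apply: sort_sorted => u v; exact: le_total.
  have : uniq (map fst ys) by rewrite (perm_uniq (perm_map _ yperm)).
  move=> u1 u2; rewrite -[sorted _ _](@sorted_map _ _ fst <%R).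
  by rewrite lt_sorted_uniq_le u1 sorted_map.
have nA x : x <= - B -> ~ A x.
  by move=> xB /AB; rewrite ltr_norml => /andP[]; lra.
have := @Rintegral_slice_path A f F B ys a false _ cf dF fA srt.
rewrite mul0r subr0 (perm_big _ yperm)/= => <-; first last.
- exists (- B - a); first lra.
  by move=> r /andP[r0 ra]; split => // Aar; exfalso; apply: nA Aar; lra.
- by move=> u; rewrite ysE; exact: Ajump.
- by move=> x y _ xy h; apply: Aconst => // u; rewrite -ysE; exact: h.
- by move=> x /AB; exact: le_lt_trans (ler_norm _).
rewrite [RHS]Rintegral_mkcond; apply: eq_Rintegral => x _.
rewrite [RHS]patchE; case: ifPn => //; rewrite notin_setE/= in_itv/= andbT.
move=> /negP; rewrite -leNgt => xa.
by rewrite patchE memNset//; apply: nA; lra.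
Qed.
End slice.

Section R2.
Context {R : realType}.
Implicit Types x y : R2 R.

Lemma R2_eq x y : x.1 = y.1 -> x.2 = y.2 -> x = y.
Proof. by case: x y => [? ?] [? ?] /= -> ->. Qed.

Lemma R2D1 x y : (x + y).1 = x.1 + y.1. Proof. by []. Qed.
Lemma R2D2 x y : (x + y).2 = x.2 + y.2. Proof. by []. Qed.
Lemma R2N1 x : (- x).1 = - x.1. Proof. by []. Qed.
Lemma R2N2 x : (- x).2 = - x.2. Proof. by []. Qed.
Lemma R2Z1 (a : R) x : (a *: x).1 = a * x.1. Proof. by []. Qed.
Lemma R2Z2 (a : R) x : (a *: x).2 = a * x.2. Proof. by []. Qed.

Definition R2E := (R2D1, R2D2, R2N1, R2N2, R2Z1, R2Z2).

Lemma R2_norm x : `|x| = Num.max `|x.1| `|x.2|. Proof. by []. Qed.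

Lemma dot2Zr (a : R) x y : dot2 x (a *: y) = a * dot2 x y.
Proof. by rewrite /dot2 !R2E; ring. Qed.

End R2.

(** * Regions bounded by segments *)

Section edged_region.
Context {R : realType} {I : eqType}.
Implicit Types (D : set (R2 R)) (s : seq I) (P Q N : I -> R2 R).

(** The sides have abstract indices with separate end points and conormals, instead of a cyclic list
    of points. In this form the conditions survive the exchange of the two coordinates, which gives
    Green's formula in the second direction from the first. *)
Record edged_region D s P Q N : Prop := {
  er_compact : compact D;
  er_interior : forall x, D x ->
    (forall i, i \in s -> ~ segment (P i) (Q i) x) -> interior D x;
  er_uniq : uniq s;
  er_neq : forall i, i \in s -> P i != Q i;
  er_simple : forall i j x, i \in s -> j \in s -> i != j ->
    segment (P i) (Q i) x -> segment (P j) (Q j) x -> x = P i \/ x = Q i;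
  er_conormal : forall i, i \in s ->
    is_outward_conormal D (P i) (Q i) (N i)
}.

Lemma near_all_seq (T : topologicalType) (J : eqType) (r : seq J)
    (A : J -> set T) (x : T) :
  (forall j, j \in r -> nbhs x (A j)) ->
  nbhs x [set u | forall j, j \in r -> A j u].
Proof.
elim: r => [|j r IH] Ar; first by apply: filterE => u j.
have Aj := Ar j (mem_head _ _).
have /IH Ar' : forall k, k \in r -> nbhs x (A k).
  by move=> k kr; apply: Ar; rewrite inE kr orbT.
by apply: filterS2 Aj Ar' => u ju ru k; rewrite inE => /predU1P[->|/ru].
Qed.

Lemma line_continuous (V : normedModType R) (p v : V) :
  continuous (fun t : R => p + t *: v).
Proof.
move=> t; apply: cvgD; first exact: cvg_cst.
by apply: cvgZl; exact: cvg_id.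
Qed.

Lemma segment_closed (p q : R2 R) : closed (segment p q).
Proof.
have -> : segment p q = (fun t : R => p + t *: (q - p)) @` `[0, 1].
  apply/seteqP; split => x [t t01 tx]; exists t => //.
apply: compact_closed; first exact: norm_hausdorff.
apply: continuous_compact; last exact: segment_compact.
exact/continuous_subspaceT/line_continuous.
Qed.

(** Connectedness of the unit interval: the parameters whose points lie in [D] form a closed set
    since [D] is compact, and a relatively open one since points of [D] off the sides are
    interior. *)
Lemma er_segment D s P Q N (x y : R2 R) : edged_region D s P Q N ->
  (forall u, segment x y u -> forall i, i \in s -> ~ segment (P i) (Q i) u) ->
  D x -> D y.
Proof.
move=> DE xyE Dx; pose g (t : R) := x + t *: (y - x).
have cg : continuous g by exact: line_continuous.
suff /seteqP[_ /(_ 1)] : `[0, 1] `&` g @^-1` D = `[0, 1]%classic.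
  rewrite /= in_itv/= ler01 lexx => /(_ isT)[_].
  by rewrite /g /= scale1r addrC subrK.
apply: segment_connected.
- by exists 0; split; rewrite /= ?in_itv/= ?lexx ?ler01// /g scale0r addr0.
- exists (g @^-1` D°).
    by apply: open_comp => [? _|]; [exact: cg|exact: open_interior].
  apply/seteqP; split => t [t01 Dt]; split => //; last exact: (interior_subset Dt).
  apply: (er_interior DE) => // i; apply: xyE.
  by exists t => //; move: t01; rewrite /= in_itv.
- exists (g @^-1` D) => //; apply: closed_comp => [? _|]; first exact: cg.
  exact: (compact_closed (@norm_hausdorff _ _) (er_compact DE)).
Qed.

(** A small ball around an interior point of a side meets no other side, as two sides meet only at
    end points. Inside it, a segment between two points on the same side of the line avoids that
    line, hence all sides, and membership propagates along it. *)
Lemma er_local D s P Q N (i : I) (t : R) : edged_region D s P Q N ->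
  i \in s -> 0 < t < 1 -> let x0 := P i + t *: (Q i - P i) in
  exists2 d : R, 0 < d & forall u v : R2 R, `|u - x0| < d -> `|v - x0| < d ->
    0 < dot2 (N i) (u - x0) * dot2 (N i) (v - x0) -> D u -> D v.
Proof.
move=> DE si t01 x0.
have x0Q : x0 - Q i = (t - 1) *: (Q i - P i).
  by rewrite scalerBl scale1r opprB addrA [X in X - _]addrC.
have x0P : x0 - P i = t *: (Q i - P i) by rewrite addrC addKr.
have QP0 : Q i - P i != 0 by rewrite subr_eq0 eq_sym (er_neq DE).
have /nbhs_ballP[d d0 dE] : nbhs x0 [set u | forall j, j \in s -> j != i ->
    ~ segment (P j) (Q j) u].
  apply: near_all_seq => j sj; have [->|ji] := eqVneq j i.
    by apply: filterE => u /eqP.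
  have x0j : ~ segment (P j) (Q j) x0.
    have x0i : segment (P i) (Q i) x0 by exists t => //; lra.
    rewrite eq_sym in ji; move=> /(er_simple DE si sj ji x0i)[] /eqP.
      by rewrite -subr_eq0 x0P scaler_eq0 (negbTE QP0) orbF; lra.
    by rewrite -subr_eq0 x0Q scaler_eq0 (negbTE QP0) orbF; lra.
  have : nbhs x0 (~` segment (P j) (Q j)).
    by apply: open_nbhs_nbhs; split=> //; rewrite openC; exact: segment_closed.
  by apply: filterS => u.
exists d => // u v ud vd uv; apply: (er_segment DE) => w [r r01 wE] j sj.
have [->|ji] := eqVneq j i; last first.
  apply: dE => //; rewrite -ball_normE /= distrC.
  have -> : w - x0 = (1 - r) *: (u - x0) + r *: (v - x0).
    by apply: R2_eq; rewrite wE !R2E; ring.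
  have r1 : 0 <= 1 - r by lra.
  have [r0 _] := andP r01.
  apply: (le_lt_trans (ler_normD _ _)); rewrite !normrZ !ger0_norm//.
  set m := Num.max `|u - x0| `|v - x0|.
  apply: (le_lt_trans (y := m)); last by rewrite gt_max ud vd.
  have um : 0 <= (1 - r) * (m - `|u - x0|) by rewrite mulr_ge0// subr_ge0 le_max lexx.
  have vm : 0 <= r * (m - `|v - x0|) by rewrite mulr_ge0// subr_ge0 le_max lexx orbT.
  by lra.
move=> [a _ wa]; have [_ NQP _] := er_conormal DE si.
have : dot2 (N i) (w - x0) = 0.
  have -> : w - x0 = (a - t) *: (Q i - P i).
    by rewrite wa scalerBl opprD addrACA subrr add0r.
  by rewrite dot2Zr NQP mulr0.
have -> : dot2 (N i) (w - x0) =
    (1 - r) * dot2 (N i) (u - x0) + r * dot2 (N i) (v - x0).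
  by rewrite wE /dot2 !R2E; ring.
move: uv r01; set A := dot2 _ _; set B := dot2 _ _ => AB r01.
move=> h.
(* Multiplied by [A], the vanishing combination becomes a sum of nonnegative terms that cannot both
   be 0, since [A] and [B] have the same strict sign. *)
have h2 : (1 - r) * (A * A) + r * (A * B) = 0.
  by transitivity (A * ((1 - r) * A + r * B)); [ring|rewrite h mulr0].
have A0 : 0 < A * A.
  by rewrite -expr2 exprn_even_gt0//=; apply: contraTneq AB => ->; rewrite mul0r ltxx.
have [r0 r1] := andP r01; move: r0; rewrite le_eqVlt => /predU1P[r0|r0].
  by move: h2; rewrite -r0; lra.
have : 0 < r * (A * B) by rewrite mulr_gt0.
have : 0 <= (1 - r) * (A * A) by rewrite mulr_ge0 ?subr_ge0// ltW.
by lra.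
Qed.

(** The conormal describes [D] along the normal line; [er_local] transports this to the horizontal
    line. A horizontal shift by [c] is on the same side as a normal shift by [e1'] when
    [(N i).1 * (c * e1')] is positive. *)
Lemma er_sides D s P Q N (i : I) (t : R) : edged_region D s P Q N ->
  i \in s -> 0 < t < 1 -> (N i).1 != 0 ->
  let x0 := P i + t *: (Q i - P i) in
  exists2 e : R, 0 < e & forall r, 0 < r < e ->
    (D (x0.1 - r, x0.2) <-> 0 < (N i).1) /\
    (D (x0.1 + r, x0.2) <-> ~~ (0 < (N i).1)).
Proof.
move=> DE si t01 N1 x0.
have [d d0 dE] := er_local DE si t01.
have [NN NQP /(_ t t01)[e e0 eE]] := er_conormal DE si.
pose n := `|N i|.
have n0 : 0 < 1 + n by rewrite ltr_pwDl// normr_ge0.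
rewrite -/x0 in dE eE.
(* Below [e], for the conormal to apply, and small enough for [e' *: N i] to stay within [d]; the
   added 1 keeps the denominator positive at once. *)
pose e' := Num.min (d / 2) (Num.min (e / 2) (d / 2 / (1 + n))).
have d20 : 0 < d / 2 by rewrite divr_gt0.
have e20 : 0 < e / 2 by rewrite divr_gt0.
have e'0 : 0 < e' by rewrite !lt_min d20 e20 !divr_gt0.
have [Din Dout] : D (x0 - e' *: N i) /\ ~ D (x0 + e' *: N i).
  by apply: eE; rewrite e'0/= (le_lt_trans (y := e / 2))//;
    [rewrite !ge_min lexx orbT|lra].
have e'n : `|e' *: N i| < d.
  rewrite normrZ gtr0_norm// (le_lt_trans (y := d / 2))//; last lra.
  rewrite (le_trans (y := e' * (1 + n)))//.
    by rewrite ler_pM2l// /n lerDr.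
  by rewrite -ler_pdivlMr// !ge_min lexx !orbT.
exists d => // r /andP[r0 rd].
have side c e1' : `|c| < d -> `|e1'| = e' -> 0 < (N i).1 * (c * e1') ->
    D (x0 + e1' *: N i) <-> D (x0.1 + c, x0.2).
  move=> cd ee ce.
  have n1 : `|x0 + e1' *: N i - x0| < d.
    by rewrite addrC addKr normrZ ee; move: e'n; rewrite normrZ (gtr0_norm e'0).
  have n2 : `|((x0.1 + c, x0.2) : R2 R) - x0| < d.
    by rewrite R2_norm !R2E /= addrC addKr subrr normr0 gt_max cd.
  have dd : 0 < dot2 (N i) (x0 + e1' *: N i - x0) *
      dot2 (N i) ((x0.1 + c, x0.2) - x0).
    rewrite [x0 + _]addrC addrK dot2Zr NN mulr1 /dot2 !R2E /= subrr mulr0 addr0.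
    by rewrite [x0.1 + c]addrC addrK mulrC -mulrA.
  by split; apply: dE => //; rewrite mulrC.
have re' : 0 < r * e' by rewrite mulr_gt0.
have rn : `|r| < d by rewrite gtr0_norm.
have rn' : `|- r| < d by rewrite normrN.
have en : `|e'| = e' by rewrite gtr0_norm.
have en' : `|- e'| = e' by rewrite normrN.
move: Din; rewrite -scaleNr => Din.
move: N1; rewrite neq_lt => /orP[N0|N0].
  have p : (N i).1 * (r * e') < 0 by rewrite pmulr_llt0.
  have [|s1 s2] := side (- r) e' rn' en; first lra.
  have [|s3 s4] := side r (- e') rn en'; first lra.
  rewrite ltNge (ltW N0) /=; split; split => // h; last exact: s3.
  by case: Dout; exact: s2.
have p : 0 < (N i).1 * (r * e') by rewrite mulr_gt0.
have [|s1 s2] := side (- r) (- e') rn' en'; first lra.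
have [|s3 s4] := side r e' rn en; first lra.
rewrite N0; split; split => // h; first exact: s1.
by case: Dout; exact: s4.
Qed.

End edged_region.

Section slice_region.
Context {R : realType} {I : eqType}.
Implicit Types (D : set (R2 R)) (s : seq I) (P Q N : I -> R2 R).

(** The inequalities are strict: horizontal segments are never crossed and end points are not
    counted. Heights of end points form a null set and are excluded from the slicing. *)
Definition crosses (p q : R2 R) (y : R) : bool :=
  (p.2 < y < q.2) || (q.2 < y < p.2).

Definition cross_at (p q : R2 R) (y : R) : R :=
  p.1 + (y - p.2) / (q.2 - p.2) * (q.1 - p.1).

Lemma segment_crosses (p q : R2 R) (x y : R) : p.2 != y -> q.2 != y ->
  segment p q (x, y) -> crosses p q y /\ x = cross_at p q y.
Proof.
move=> py qy [t /andP[t0 t1] E].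
have xE : x = p.1 + t * (q.1 - p.1) by have := congr1 fst E.
have yE : y = p.2 + t * (q.2 - p.2) by have := congr1 snd E.
have qp : q.2 - p.2 != 0.
  by apply: contraNneq py => qp; rewrite yE qp mulr0 addr0.
have tE : (y - p.2) / (q.2 - p.2) = t.
  by rewrite yE addrC addKr mulfK.
split; last by rewrite /cross_at tE.
have t0' : 0 < t.
  rewrite lt_neqAle t0 andbT; apply: contraNneq py => t00.
  by rewrite yE -t00 mul0r addr0.
have t1' : t < 1.
  rewrite lt_neqAle t1 andbT; apply: contraNneq qy => t11.
  by rewrite yE t11 mul1r addrC subrK.
rewrite /crosses; apply/orP.
move: qp; rewrite neq_lt => /orP[qp|qp]; [right|left]; apply/andP; split; nra.
Qed.

Lemma crosses_segment (p q : R2 R) (y : R) : crosses p q y ->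
  exists2 t, 0 < t < 1 & (cross_at p q y, y) = p + t *: (q - p).
Proof.
move=> c; have qp : q.2 - p.2 != 0.
  by move: c; rewrite subr_eq0 neq_lt /crosses => /orP[] /andP[h1 h2];
    rewrite (lt_trans h1 h2) ?orbT.
exists ((y - p.2) / (q.2 - p.2)); last first.
  by apply: R2_eq; rewrite !R2E //=; field.
move: c; rewrite /crosses => /orP[] /andP[h1 h2]; last first.
  rewrite -mulrNN -invrN !opprB; apply/andP; split.
    by rewrite divr_gt0// subr_gt0 // (lt_trans h1 h2).
  by rewrite ltr_pdivrMr ?subr_gt0 ?(lt_trans h1 h2)// mul1r; lra.
apply/andP; split.
  by rewrite divr_gt0// subr_gt0 // (lt_trans h1 h2).
by rewrite ltr_pdivrMr ?subr_gt0 ?(lt_trans h1 h2)// mul1r; lra.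
Qed.

Lemma crosses_conormal D (p q n : R2 R) (y : R) :
  is_outward_conormal D p q n -> crosses p q y -> n.1 != 0.
Proof.
move=> [nn npq _] c; have qp : q.2 - p.2 != 0.
  by move: c; rewrite subr_eq0 neq_lt /crosses => /orP[] /andP[h1 h2];
    rewrite (lt_trans h1 h2) ?orbT.
apply: contra_eq_neq nn => n1; move: npq; rewrite /dot2 !R2E n1 !mul0r !add0r.
by move/eqP; rewrite mulf_eq0 (negbTE qp) orbF => /eqP ->; rewrite mul0r eq_sym oner_eq0.
Qed.

Lemma pair_continuous (y : R) : continuous (fun x : R => (x, y)).
Proof.
have -> : (fun x : R => (x, y)) = fun x => (0, y) + x *: ((1, 0) : R2 R).
  by apply/funext => x; apply: R2_eq; rewrite !R2E /=; ring.
exact: line_continuous.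
Qed.

(** At a height free of end points the slice can change only at crossings. Distinct sides cross at
    distinct abscissas, because a common point would be an end point; and the first component of the
    conormal is positive exactly when the region lies to the left of the crossing. *)
Lemma er_slice D s P Q N (y : R) (f F : R -> R) : edged_region D s P Q N ->
  (forall i, i \in s -> (P i).2 != y /\ (Q i).2 != y) -> continuous f ->
  (forall x : R, is_derive x (1 : R) F (f x)) ->
  \int[@lebesgue_measure R]_x (f \_ [set x | D (x, y)]) x =
  \sum_(i <- s | crosses (P i) (Q i) y)
    (-1) ^+ (~~ (0 < (N i).1)) * F (cross_at (P i) (Q i) y).
Proof.
move=> DE gy cf dF.
pose sy := [seq i <- s | crosses (P i) (Q i) y].
pose xs := [seq (cross_at (P i) (Q i) y, 0 < (N i).1) | i <- sy].
have cD : closed [set x | D (x, y)].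
  apply: (@closed_comp _ _ (fun x : R => (x, y))).
    by move=> x _; exact: pair_continuous.
  exact: (compact_closed (@norm_hausdorff _ _) (er_compact DE)).
have [B BP] : exists B, forall x, D (x, y) -> `|x| < B.
  have [B [_ BD]] := compact_bounded (er_compact DE).
  exists (B + 2) => x Dx.
  have BB : B < B + 1 by rewrite ltrDl.
  have : `|(x, y) : R2 R| <= B + 1 by exact: BD Dx.
  rewrite R2_norm ge_max => /andP[xB _].
  by rewrite (le_lt_trans xB)// ltrD2l; lra.
have segE x i : i \in s -> segment (P i) (Q i) (x, y) ->
    i \in sy /\ x = cross_at (P i) (Q i) y.
  by move=> si; have [Pi Qi] := gy _ si; move/segment_crosses => /(_ Pi Qi)[];
    rewrite mem_filter si => ->.
rewrite (@Rintegral_slice _ _ f F B xs)//.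
- by rewrite big_map big_filter.
- rewrite -map_comp map_inj_in_uniq ?filter_uniq ?(er_uniq DE)// => i j.
  rewrite !mem_filter /= => /andP[ci si] /andP[cj sj] ij; apply/eqP/negP => ji.
  have [t t01 tE] := crosses_segment ci; have [r r01 rE] := crosses_segment cj.
  move/negP in ji; have [Pi Qi] := gy _ si.
  have segi : segment (P i) (Q i) (cross_at (P i) (Q i) y, y).
    by exists t => //; lra.
  have segj : segment (P j) (Q j) (cross_at (P i) (Q i) y, y).
    by rewrite ij; exists r => //; lra.
  by have [] := er_simple DE si sj ji segi segj => /(congr1 snd)/= yP;
    rewrite yP eqxx in Pi Qi.
- move=> x x' xx' h; have : forall u, segment (x, y) (x', y) u ->
      forall i, i \in s -> ~ segment (P i) (Q i) u.
    move=> u [t t01 uE] i si.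
    have {uE} -> : u = (x + t * (x' - x), y).
      by rewrite uE; apply: R2_eq; rewrite !R2E //=; ring.
    move=> /(segE _ _ si)[iy xE].
    apply: (h (cross_at (P i) (Q i) y, 0 < (N i).1)); first exact: map_f.
    by rewrite /= -xE; apply/andP; split; nra.
  move=> avoid; split; first exact: (er_segment DE).
  apply: (er_segment DE) => u [t t01 uE]; apply: avoid.
  by exists (1 - t); [lra|rewrite uE; apply: R2_eq; rewrite !R2E /=; ring].
- move=> u /mapP[i]; rewrite mem_filter => /andP[ci si] -> /=.
  have [t t01 tE] := crosses_segment ci.
  have [e e0 eE] := er_sides DE si t01 (crosses_conormal (er_conormal DE si) ci).
  by exists e => // r /eE; rewrite -tE.
Qed.

End slice_region.

(** * Measurability and integrability in the plane *)

Section measurable_R2.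
Context {R : realType}.
Notation MR := (measurableTypeR R).
Notation mu := (@lebesgue_measure R).

(** The measure [mu2] lives on the product of two sigma-algebras while faces are given
    topologically; countably many boxes with rational corners connect the two. *)
Lemma open_measurable2 (U : set (R2 R)) : open U ->
  @measurable _ (MR * MR)%type U.
Proof.
move=> oU; pose box (k : rat * rat * (rat * rat)) : set (R2 R) :=
  `]ratr k.1.1, ratr k.1.2[%classic `*` `]ratr k.2.1, ratr k.2.2[%classic.
have -> : U = \bigcup_k (if `[< box k `<=` U >] then box k else set0).
  apply/seteqP; split => [x Ux|x [k _]]; last by case: ifPn => // /asboolP; exact.
  have /nbhs_ballP[e e0 eU] : nbhs x U by exact: open_nbhs_nbhs.
  have rat_near (c : R) : exists k : rat * rat,
      [/\ c - e < ratr k.1, ratr k.1 < c, c < ratr k.2 & ratr k.2 < c + e].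
    have [q1] := @rat_in_itvoo R (c - e) c ltac:(rewrite ltrBlDr ltrDl//).
    have [q2] := @rat_in_itvoo R c (c + e) ltac:(rewrite ltrDl//).
    rewrite !in_itv/= => /andP[? ?] /andP[? ?]; by exists (q1, q2).
  have [k1 [a1 b1 c1 d1]] := rat_near x.1; have [k2 [a2 b2 c2 d2]] := rat_near x.2.
  exists (k1, k2) => //; rewrite ifT.
    by split; rewrite /= in_itv/=; apply/andP.
  apply/asboolP => y [/=]; rewrite !in_itv/= => /andP[? ?] /andP[? ?].
  apply: eU; rewrite -ball_normE /= R2_norm !R2E gt_max.
  by rewrite !ltr_norml; apply/andP; split; apply/andP; split; lra.
apply: countable_bigcupT_measurable => [|k]; first exact: countableP.
case: ifP => // _; apply: measurableX => //=; exact: measurable_itv.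
Qed.

Lemma closed_measurable2 (D : set (R2 R)) : closed D ->
  @measurable _ (MR * MR)%type D.
Proof.
move=> cD; rewrite -(setCK D); apply: measurableC.
by apply: open_measurable2; rewrite openC.
Qed.

Lemma compact_closed2 (D : set (R2 R)) : compact D -> closed D.
Proof. exact: (compact_closed (@norm_hausdorff _ _)). Qed.

Lemma continuous_measurable2 (f : R2 R -> R) (D : set (R2 R)) :
  continuous f -> @measurable_fun _ _ (MR * MR)%type R D f.
Proof.
move=> /continuousP cf; apply: (@measurable_funS _ _ (MR * MR)%type _ setT) => //.
apply: (measurability _ (RGenOpens.measurableE R)).
move=> _ [_ [a [b ->] <-]]; rewrite setTI.
by apply: open_measurable2; apply: cf; exact: interval_open.
Qed.

Lemma compact_bounded_fun (D : set (R2 R)) (f : R2 R -> R) : compact D ->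
  continuous f -> exists2 B : R, 0 < B & forall x, D x -> `|f x| <= B.
Proof.
move=> kD cf; have /compact_bounded[B [_ fB]] : compact (f @` D).
  by apply: continuous_compact => //; exact: continuous_subspaceT.
exists (`|B| + 1) => [|x Dx]; first by rewrite ltr_wpDl.
by apply: fB; [rewrite (le_lt_trans (ler_norm B))// ltrDl|exists x].
Qed.

Lemma compact_mu2_lty (D : set (R2 R)) : compact D -> (@mu2 R D < +oo)%E.
Proof.
move=> kD; have [B [_ BD]] := compact_bounded kD.
set b := B + 1; have {}BD x : D x -> `|x| <= b.
  by apply: BD; rewrite ltrDl.
apply: (@le_lt_trans _ _ (@mu2 R (`[- b, b] `*` `[- b, b])%classic)).
  apply: le_measure.
  - by rewrite inE; apply: closed_measurable2; exact: compact_closed2.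
  - by rewrite inE; apply: measurableX; exact: measurable_itv.
  - move=> x /BD; rewrite R2_norm ge_max => /andP[].
    by rewrite !ler_norml => ? ?; split; rewrite /= in_itv.
rewrite /mu2 product_measure1E; [|exact: measurable_itv..].
rewrite -[X in (X < _)%E]/(mu `[(- b)%R, b]%classic * mu `[(- b)%R, b]%classic)%E.
rewrite !lebesgue_measure_itv/=.
by case: ifP => _; rewrite ?mul0e ?ltry// -EFinB -EFinM ltry.
Qed.

Lemma continuous_integrable2 (D : set (R2 R)) (f : R2 R -> R) : compact D ->
  continuous f -> (@mu2 R).-integrable D (EFin \o f).
Proof.
move=> kD cf; apply: measurable_bounded_integrable.
- by apply: closed_measurable2; exact: compact_closed2.
- exact: compact_mu2_lty.
- exact: continuous_measurable2.
- have [B B0 fB] := compact_bounded_fun kD cf; exists B; split => //.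
    exact: num_real.
  by move=> c Bc x /fB fx; exact: (le_trans fx (ltW Bc)).
Qed.

End measurable_R2.

Lemma Rintegral_sum_seq d (T : measurableType d) (R : realType)
    (mu : {measure set T -> \bar R}) (D : set T) (I : eqType) (s : seq I)
    (h : I -> T -> R) :
  measurable D -> (forall i, i \in s -> mu.-integrable D (EFin \o h i)) ->
  mu.-integrable D (EFin \o (fun x => \sum_(i <- s) h i x)) /\
  \int[mu]_(x in D) (\sum_(i <- s) h i x) =
  \sum_(i <- s) \int[mu]_(x in D) h i x.
Proof.
move=> mD; elim: s => [|i s IH] ih.
  under eq_fun do rewrite big_nil.
  by rewrite big_nil; split; [exact: integrable0|rewrite Rintegral_cst// mul0r].
have [|ir rE] := IH; first by move=> j js; apply: ih; rewrite inE js orbT.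
have hi := ih i (mem_head _ _).
under eq_fun do rewrite big_cons.
by rewrite big_cons -rE; split; [exact: (integrableD mD hi ir)|rewrite -RintegralD].
Qed.

Section edge_integral.
Context {R : realType}.
Notation mu := (@lebesgue_measure R).

Lemma continuous_integrable_itv (a b : R) (x y : bool) (g : R -> R) :
  {within `[a, b], continuous g} ->
  mu.-integrable [set` Interval (BSide x a) (BSide y b)] (EFin \o g).
Proof.
move=> cg; have ig : mu.-integrable `[a, b] (EFin \o g).
  by apply: continuous_compact_integrable => //; exact: segment_compact.
apply: integrableS ig => //; case: x; case: y => //=;
  apply: subset_itv; by rewrite bnd_simp.
Qed.

Lemma Rintegral_affine (a b : R) (g : R -> R) : a < b -> continuous g ->
  \int[mu]_(y in `[a, b]) g y =
  (b - a) * \int[mu]_(t in `[0, 1]) g (a + t * (b - a)).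
Proof.
move=> ab cg; pose F (t : R) := a + t * (b - a).
have dF (t : R) : is_derive t (1 : R) F (b - a).
  have -> : F = cst a + (b - a) \*: id.
    by apply/funext => u; rewrite /F fctE /= mulrC.
  by apply: is_derive_eq; rewrite add0r -[_ *: _]/(_ * _) mulr1.
have F' : F^`()%classic = cst (b - a).
  by apply/funext => t; rewrite derive1E; case: (dF t).
have cF : continuous F by exact: (@line_continuous _ R).
have := @integration_by_substitution_increasing R F g 0 1 ler01.
rewrite F' /F mul0r addr0 mul1r [a + (b - a)]addrC subrK /Rintegral => ->.
- rewrite -RintegralZl//; last first.
    apply: continuous_integrable_itv; apply: continuous_subspaceT => t.
    by apply: continuous_comp; [exact: cF|exact: cg].
  by congr fine; apply: eq_integral => t _ /=; rewrite mulrC.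
- by move=> x y _ _ xy; rewrite ltrD2l ltr_pM2r// subr_gt0.
- by move=> t _; exact: cvg_cst.
- exact: is_cvg_cst.
- exact: is_cvg_cst.
- split; first by move=> t _; case: (dF t).
  + exact/cvg_at_right_filter/cF.
  + exact/cvg_at_left_filter/cF.
- exact: continuous_subspaceT.
Qed.

Lemma intseg_sym (V : lmodType R) (p q : V) (f : V -> R) :
  {within `[0, 1], continuous (fun t : R => f (p + t *: (q - p)))} ->
  intseg p q f = intseg q p f.
Proof.
move=> cf; rewrite /intseg.
rewrite (Rintegration_by_substitution_onem (r := 1)) ?lexx ?ler01//.
rewrite unstable.onem1; apply: eq_Rintegral => t _; congr f.
by rewrite /unstable.onem scalerBl scale1r -[in RHS](opprB q p) scalerN addrA
  [p + _]addrC subrK.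
Qed.

Lemma crosses_sym (p q : R2 R) : crosses p q =1 crosses q p.
Proof. by move=> y; rewrite /crosses orbC. Qed.

Lemma cross_at_sym (p q : R2 R) : p.2 != q.2 -> cross_at p q =1 cross_at q p.
Proof.
move=> pq y; rewrite /cross_at.
have n1 : q.2 - p.2 != 0 by rewrite subr_eq0 eq_sym.
have n2 : p.2 - q.2 != 0 by rewrite subr_eq0.
by field; rewrite ?n1 ?n2.
Qed.

(** A unit normal is the direction turned by a right angle, so its first component converts arc
    length along an edge into height. *)
Lemma conormal_length (n t : R2 R) : dot2 n n = 1 -> dot2 n t = 0 ->
  `|t.2| = enorm2 t * `|n.1|.
Proof.
rewrite /dot2 => nn nt.
have t2E : t.2 ^+ 2 = dot2 t t * n.1 ^+ 2.
  have e1 : n.1 * t.1 = - (n.2 * t.2) by lra.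
  have : (n.1 * t.1) ^+ 2 = (n.2 * t.2) ^+ 2 by rewrite e1 sqrrN.
  by rewrite /dot2; nra.
by rewrite /enorm2 -!sqrtr_sqr t2E sqrtrM// /dot2 -!expr2 addr_ge0 ?sqr_ge0.
Qed.

(** As the height varies, the crossing point sweeps the edge once. Passing to the edge parameter
    produces the absolute height difference, that is length times [|n.1|], and the sign restores
    [n.1]. For a horizontal edge both sides vanish. *)
Lemma crosses_integral (G : R2 R -> R) (p q n : R2 R) : continuous G ->
  p != q -> dot2 n n = 1 -> dot2 n (q - p) = 0 ->
  let h y := if crosses p q y
    then (-1) ^+ (~~ (0 < n.1)) * G (cross_at p q y, y) else 0 in
  mu.-integrable setT (EFin \o h) /\
  \int[mu]_y h y = enorm2 (q - p) * n.1 * intseg p q G.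
Proof.
move=> cG; wlog pq2 : p q / p.2 <= q.2.
  move=> wlg pq nn npq; have [|qp2] := leP p.2 q.2; first by move=> ?; exact: wlg.
  have nqp : dot2 n (p - q) = 0.
    by rewrite -opprB -scaleN1r dot2Zr npq mulr0.
  rewrite eq_sym in pq.
  have [h1 h2] := wlg q p (ltW qp2) pq nn nqp.
  move=> h; have -> : h = fun y => if crosses q p y
      then (-1) ^+ (~~ (0 < n.1)) * G (cross_at q p y, y) else 0.
    by apply/funext => y; rewrite /h crosses_sym cross_at_sym// gt_eqF.
  split => //; rewrite h2; congr (_ * _ * _).
    by rewrite -opprB /enorm2 /dot2 !R2E !mulrNN.
  apply: intseg_sym; apply: continuous_subspaceT => t.
  by apply: continuous_comp; [exact: line_continuous|exact: cG].
move=> pq nn npq h.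
move: pq2; rewrite le_eqVlt => /predU1P[pq2|pq2].
  have h0 : h = cst 0.
    by apply/funext => y; rewrite /h /crosses pq2 orbb; case: ifP => // /andP[]; lra.
  split; first by rewrite h0; exact: integrable0.
  rewrite h0 Rintegral_cst// mul0r.
  have := conormal_length nn npq; rewrite !R2E pq2 subrr normr0.
  move=> /esym/eqP; rewrite mulf_eq0 normr_eq0 => /orP[] /eqP ->; first by rewrite !mul0r.
  by rewrite mulr0 mul0r.
pose g (y : R) := (-1) ^+ (~~ (0 < n.1)) * G (cross_at p q y, y).
have qp0 : q.2 - p.2 != 0 by rewrite subr_eq0 gt_eqF.
(* The line through [p] and [q] parametrised by height, starting from its point at height 0; this
   makes the crossing point continuous on the whole real line. *)
pose a : R2 R := (p.1 - p.2 / (q.2 - p.2) * (q.1 - p.1), 0).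
pose v : R2 R := ((q.1 - p.1) / (q.2 - p.2), 1).
have cg : continuous g.
  have -> : g = fun y => (-1) ^+ (~~ (0 < n.1)) * G (a + y *: v).
    apply/funext => y; congr (_ * G _).
    apply: R2_eq; rewrite !R2E /a /v /cross_at /=; last by ring.
    by field.
  move=> y; apply: cvgM; first exact: cvg_cst.
  by apply: continuous_comp; [exact: line_continuous|exact: cG].
have hE : h = g \_ `]p.2, q.2[.
  apply/funext => y; rewrite /h patchE /crosses -/(g y).
  rewrite (_ : (q.2 < y < p.2) = false) ?orbF; last by apply/negP; lra.
  have -> // : (y \in `]p.2, q.2[%classic) = (p.2 < y < q.2).
  by apply/idP/idP; rewrite inE /= in_itv.
have ih : mu.-integrable setT (EFin \o h).
  rewrite hE -restrict_EFin.
  have [+ _] := @integrable_mkcond _ _ _ mu `]p.2, q.2[%classic (EFin \o g) (measurable_itv _).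
  by apply; apply: continuous_integrable_itv; exact: continuous_subspaceT.
split => //; rewrite hE -Rintegral_mkcond.
rewrite Rintegral_itv_bndo_bndc; last first.
  by apply: continuous_integrable_itv; exact: continuous_subspaceT.
rewrite Rintegral_itv_obnd_cbnd; last first.
  by apply: continuous_integrable_itv; exact: continuous_subspaceT.
rewrite Rintegral_affine//.
have gE t : g (p.2 + t * (q.2 - p.2)) =
    (-1) ^+ (~~ (0 < n.1)) * G (p + t *: (q - p)).
  congr (_ * G _); apply: R2_eq; rewrite !R2E /cross_at //=.
  by field.
under eq_Rintegral do rewrite gE.
rewrite RintegralZl//; last first.
  apply: continuous_integrable_itv; apply: continuous_subspaceT => t.
  by apply: continuous_comp; [exact: line_continuous|exact: cG].
rewrite mulrA; congr (_ * _).
have := conormal_length nn npq; rewrite !R2E gtr0_norm ?subr_gt0// => ->.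
have [n0|n0] := ltrP 0 n.1; first by rewrite gtr0_norm// expr0 mulr1.
by rewrite ler0_norm// expr1 mulrN1 mulrN opprK.
Qed.

End edge_integral.

Section green.
Context {R : realType} {I : eqType}.
Notation mu := (@lebesgue_measure R).
Implicit Types (D : set (R2 R)) (s : seq I) (P Q N : I -> R2 R).

Lemma iterated_green D s P Q N (G g : R2 R -> R) : edged_region D s P Q N ->
  continuous G -> continuous g ->
  (forall x y : R, is_derive x (1 : R) (fun x => G (x, y)) (g (x, y))) ->
  (\int[mu]_y \int[mu]_x ((EFin \o g) \_ D) (x, y))%E =
  (\sum_(i <- s) enorm2 (Q i - P i) * (N i).1 * intseg (P i) (Q i) G)%:E.
Proof.
move=> DE cG cg dG; have kD := er_compact DE.
have mD := closed_measurable2 (compact_closed2 kD).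
have ig : (@mu2 R).-integrable setT ((EFin \o g) \_ D).
  apply/(@integrable_mkcond _ _ _ (@mu2 R) _ _ mD).
  exact: continuous_integrable2.
pose h i (y : R) := if crosses (P i) (Q i) y
  then (-1) ^+ (~~ (0 < (N i).1)) * G (cross_at (P i) (Q i) y, y) else 0.
pose H y := \sum_(i <- s) h i y.
have ihE i : i \in s -> mu.-integrable setT (EFin \o h i) /\
    \int[mu]_y h i y = enorm2 (Q i - P i) * (N i).1 * intseg (P i) (Q i) G.
  move=> si; have [nn npq _] := er_conormal DE si.
  exact: crosses_integral (er_neq DE si) nn npq.
have [iHs HE] := Rintegral_sum_seq measurableT (fun i si => (ihE i si).1).
have {}HE : \int[mu]_y H y =
    \sum_(i <- s) enorm2 (Q i - P i) * (N i).1 * intseg (P i) (Q i) G.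
  by rewrite HE !big_seq; apply: eq_bigr => i /ihE[].
pose G2 : R -> \bar R := fubini_G mu ((EFin \o g) \_ D).
have mG2 : measurable_fun setT G2 by exact: (measurable_fubini_G ig).
transitivity (\int[mu]_y (H y)%:E)%E; last first.
  by rewrite -HE /Rintegral fineK//; exact: integrable_fin_num.
apply: ae_eq_integral => //; first exact: (measurable_int mu).
(* Exceptional heights are those of the finitely many end points, together with the null set of
   heights whose slice is not integrable. *)
pose Y := [set` [seq (P i).2 | i <- s] ++ [seq (Q i).2 | i <- s]].
have Y0 : mu.-negligible Y.
  have cY : countable Y by apply: finite_set_countable; exact: finite_seq.
  exists Y; split => //; last exact: countable_lebesgue_measure0.
  by apply: countable_measurable => // t; exact: measurable_set1.
apply: negligibleS (negligibleU Y0 (ae_integrable2 ig)) => y.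
apply: contra_notP => /not_orP[yY /contrapT iy] _.
have gy i : i \in s -> (P i).2 != y /\ (Q i).2 != y.
  move=> si; split; apply/eqP => E; apply: yY; rewrite /Y /= mem_cat -E.
    by rewrite (map_f (fun i => (P i).2)).
  by rewrite (map_f (fun i => (Q i).2))// orbT.
have cgy : continuous (fun x => g (x, y)).
  by move=> x; apply: continuous_comp; [exact: pair_continuous|exact: cg].
have gE : (fun x => ((EFin \o g) \_ D) (x, y)) =
    EFin \o (fun x => g (x, y)) \_ [set x | D (x, y)].
  apply/funext => x; rewrite restrict_EFin /= !patchE.
  suff -> : (x \in [set x | D (x, y)]) = ((x, y) \in D) by [].
  by apply/idP/idP; rewrite !inE.
have := er_slice DE gy cgy (fun x => dG x y).
rewrite big_mkcond -[X in _ = X -> _]/(H y) => <-.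
rewrite /Rintegral fineK; last by have := integrable_fin_num measurableT iy; rewrite gE.
by congr integral; rewrite gE.
Qed.

Definition R2swap (x : R2 R) : R2 R := (x.2, x.1).

Lemma R2swap_continuous : continuous R2swap.
Proof.
move=> [x y]; apply: (cvg_pair (G := nbhs y) (H := nbhs x)).
  exact: cvg_snd.
exact: cvg_fst.
Qed.

(** Reflection in the diagonal turns vertical slices into horizontal ones, so one slicing argument
    serves both coordinate directions. *)
Lemma er_swap D s P Q N : edged_region D s P Q N ->
  edged_region (R2swap @^-1` D) s (R2swap \o P) (R2swap \o Q) (R2swap \o N).
Proof.
have swapK : involutive R2swap by case.
have segE p q x : segment (R2swap p) (R2swap q) x <-> segment p q (R2swap x).
  split=> -[t t01 E]; exists t => //; [rewrite E|apply: (inv_inj swapK); rewrite E];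
  by apply: R2_eq; rewrite /R2swap !R2E.
move=> DE; split.
- have -> : R2swap @^-1` D = R2swap @` D.
    apply/seteqP; split => [x Dx|_ [x Dx <-]]; first by exists (R2swap x).
    by rewrite /= swapK.
  apply: continuous_compact; last exact: er_compact DE.
  exact/continuous_subspaceT/R2swap_continuous.
- move=> x Dx sx; apply: R2swap_continuous; apply: (er_interior DE) => // i si.
  by move=> /segE; exact: sx.
- exact: er_uniq DE.
- by move=> i si /=; rewrite (inj_eq (inv_inj swapK)); exact: er_neq DE _ si.
- move=> i j x si sj ij /segE xi /segE xj.
  have [xE|xE] := er_simple DE si sj ij xi xj; [left|right];
  by rewrite -(swapK x) xE.
- move=> i si; have [nn nt no] := er_conormal DE si; split.
  + by move: nn; rewrite /dot2 /= addrC.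
  + by move: nt; rewrite /dot2 /= addrC.
  + by move=> t /no[e e0 eE]; exists e => // r /eE.
Qed.

Lemma green_e1 D s P Q N (G g : R2 R -> R) : edged_region D s P Q N ->
  continuous G -> continuous g ->
  (forall x y : R, is_derive x (1 : R) (fun x => G (x, y)) (g (x, y))) ->
  int2 D g = \sum_(i <- s) enorm2 (Q i - P i) * (N i).1 * intseg (P i) (Q i) G.
Proof.
move=> DE cG cg dG; apply: EFin_inj; rewrite -(iterated_green DE cG cg dG).
have kD := er_compact DE; have mD := closed_measurable2 (compact_closed2 kD).
have ig := continuous_integrable2 kD cg.
rewrite /int2 /Rintegral fineK; last exact: (integrable_fin_num mD ig).
rewrite integral_mkcond -integral21_prod_meas1//.
exact/(@integrable_mkcond _ _ _ (@mu2 R) _ _ mD).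
Qed.

Lemma green_e2 D s P Q N (G g : R2 R -> R) : edged_region D s P Q N ->
  continuous G -> continuous g ->
  (forall x y : R, is_derive y (1 : R) (fun y => G (x, y)) (g (x, y))) ->
  int2 D g = \sum_(i <- s) enorm2 (Q i - P i) * (N i).2 * intseg (P i) (Q i) G.
Proof.
move=> DE cG cg dG.
have kD := er_compact DE; have mD := closed_measurable2 (compact_closed2 kD).
have ig := continuous_integrable2 kD cg.
have cS (f : R2 R -> R) : continuous f -> continuous (f \o R2swap).
  by move=> cf x; apply: continuous_comp; [exact: R2swap_continuous|exact: cf].
have := iterated_green (er_swap DE) (cS _ cG) (cS _ cg) (fun x y => dG y x).
have -> : (\int[mu]_y \int[mu]_x
    ((EFin \o (g \o R2swap)) \_ (R2swap @^-1` D)) (x, y))%E = (int2 D g)%:E.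
  rewrite /int2 /Rintegral fineK; last exact: (integrable_fin_num mD ig).
  rewrite integral_mkcond -integral12_prod_meas1//.
  exact/(@integrable_mkcond _ _ _ (@mu2 R) _ _ mD).
case=> ->; apply: eq_bigr => i _ /=; congr (_ * _ * _).
by rewrite /enorm2 /dot2 /R2swap !R2E /= addrC.
Qed.

End green.

(** * Traces *)

Section square_integrable.
Context d (T : measurableType d) (R : realType).
Variables (mu : {measure set T -> \bar R}) (D : set T).
Hypothesis mD : measurable D.
Implicit Types f g : T -> R.

(** Stated for an arbitrary measure: [L2] on a face and [L2seg] on an edge are both instances by
    conversion. *)
Definition sqint f :=
  measurable_fun D f /\ mu.-integrable D (fun x => ((f x) ^+ 2)%:E).

Lemma le_integrable_real f g : measurable_fun D f ->
  mu.-integrable D (EFin \o g) -> (forall x, D x -> `|f x| <= g x) ->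
  mu.-integrable D (EFin \o f).
Proof.
move=> mf ig fg; apply: le_integrable ig => //; first exact/measurable_EFinP.
move=> x Dx /=; rewrite lee_fin (le_trans (fg x Dx))//.
exact: ler_norm.
Qed.

Lemma sqintM f g : sqint f -> sqint g ->
  mu.-integrable D (EFin \o (fun x => f x * g x)).
Proof.
move=> [mf if2] [mg ig2].
apply: (le_integrable_real _ (integrableD mD if2 ig2)).
  exact: measurable_funM.
move=> x _; rewrite normrM -(real_normK (num_real (f x))).
rewrite -(real_normK (num_real (g x))).
have := sqr_ge0 (`|f x| - `|g x|); have := normr_ge0 (f x).
have := normr_ge0 (g x); rewrite !expr2; nra.
Qed.

Lemma sqintD f g : sqint f -> sqint g -> sqint (fun x => f x + g x).
Proof.
move=> sf sg; have [mf if2] := sf; have [mg ig2] := sg; split.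
  exact: measurable_funD.
have i2 := integrableD mD (integrableD mD if2 ig2)
  (integrableD mD (sqintM sf sg) (sqintM sf sg)).
apply: eq_integrable i2 => // x _ /=; rewrite -!EFinD; congr EFin; ring.
Qed.

Lemma sqintZ (c : R) f : sqint f -> sqint (fun x => c * f x).
Proof.
move=> [mf if2]; split; first exact: measurable_funM.
have i2 := integrableZl mD (c ^+ 2) if2.
by apply: eq_integrable i2 => // x _ /=; rewrite -!EFinM; congr EFin; ring.
Qed.

Lemma sqintB f g : sqint f -> sqint g -> sqint (fun x => f x - g x).
Proof.
move=> sf sg; have := sqintD sf (sqintZ (-1) sg).
by congr sqint; apply/funext => x; rewrite mulN1r.
Qed.

Lemma cauchy_schwarz_sqint f g : sqint f -> sqint g ->
  (\int[mu]_(x in D) (f x * g x)) ^+ 2 <=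
  \int[mu]_(x in D) (f x ^+ 2) * \int[mu]_(x in D) (g x ^+ 2).
Proof.
move=> sf sg; have [_ if2] := sf; have [_ ig2] := sg.
have ifg := sqintM sf sg.
set A := \int[mu]_(x in D) (f x ^+ 2); set B := \int[mu]_(x in D) (g x ^+ 2).
set C := \int[mu]_(x in D) (f x * g x).
(* At [(B, - C)] this form equals [B * (A * B - C ^+ 2)]; if [B] is 0, its value at [(- C, A + 1)]
   forces [C] to be 0. *)
have quad a b : 0 <= a ^+ 2 * A + 2 * a * b * C + b ^+ 2 * B.
  have : 0 <= \int[mu]_(x in D) ((a * f x + b * g x) ^+ 2).
    by apply: Rintegral_ge0 => x _; exact: sqr_ge0.
  have -> : \int[mu]_(x in D) ((a * f x + b * g x) ^+ 2) =
      \int[mu]_(x in D) (a ^+ 2 * f x ^+ 2 +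
        (2 * a * b * (f x * g x) + b ^+ 2 * g x ^+ 2)).
    by apply: eq_Rintegral => x _; ring.
  have i1 := integrableZl mD (a ^+ 2) if2.
  have i2 := integrableZl mD (2 * a * b) ifg.
  have i3 := integrableZl mD (b ^+ 2) ig2.
  rewrite RintegralD//; last exact: (integrableD mD i2 i3).
  by rewrite RintegralD// !RintegralZl// addrA.
have A0 : 0 <= A by apply: Rintegral_ge0 => x _; exact: sqr_ge0.
have B0 : 0 <= B by apply: Rintegral_ge0 => x _; exact: sqr_ge0.
move: (B0); rewrite le_eqVlt => /predU1P[B00|B1].
  have := quad (- C) (A + 1); rewrite -B00 !mulr0.
  have : 0 <= C ^+ 2 by exact: sqr_ge0.
  by rewrite !expr2; nra.
by have := quad B (- C); rewrite !expr2; nra.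
Qed.

(** Cauchy-Schwarz bounds the error by the mean-square distance. It is the passage to the limit for
    every term of Green's formula, on the face and on its sides alike. *)
Lemma sqint_cvg (u : nat -> T -> R) f g : (forall k, sqint (u k)) -> sqint f ->
  sqint g ->
  \int[mu]_(x in D) ((u k x - f x) ^+ 2) @[k --> \oo] --> (0 : R) ->
  \int[mu]_(x in D) (u k x * g x) @[k --> \oo] -->
  \int[mu]_(x in D) (f x * g x).
Proof.
move=> su sf sg uf; apply/cvgrPdist_lt => e e0.
set B := \int[mu]_(x in D) (g x ^+ 2).
have B0 : 0 <= B by apply: Rintegral_ge0 => x _; exact: sqr_ge0.
have B1 : 0 < B + 1 by lra.
have e2 : 0 < e ^+ 2 / (B + 1) by rewrite divr_gt0// exprn_gt0.
move/cvgrPdist_lt : uf => /(_ _ e2); apply: filterS => k.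
rewrite sub0r normrN => uk.
rewrite -RintegralB//; [|exact: sqintM..].
have /(cauchy_schwarz_sqint (sqintB (su k) sf)) := sg.
rewrite -/B; set C := \int[mu]_(x in D) _; set A := \int[mu]_(x in D) _ => CS.
have -> : \int[mu]_(x in D) (f x * g x - u k x * g x) = - C.
  rewrite /C -mulN1r -RintegralZl//; last exact: (sqintM (sqintB (su k) sf) sg).
  by apply: eq_Rintegral => x _; ring.
rewrite normrN -(ltr_pXn2r (n := 2))// ?nnegrE ?ltW// real_normK ?num_real//.
apply: (le_lt_trans CS).
have A0 : 0 <= A by apply: Rintegral_ge0 => x _; exact: sqr_ge0.
move: uk; rewrite ger0_norm// ltr_pdivlMr// -/A mulrDr mulr1 => uk.
by lra.
Qed.

End square_integrable.

Section C1.
Context {R : realType}.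
Implicit Types (f g : R2 R -> R) (v : R2 R).

Definition C1 f := Ck 1 setT f.

Lemma smooth_C1 f : smooth f -> C1 f.
Proof. exact. Qed.

Lemma C1_differentiable f x : C1 f -> differentiable f x.
Proof. by case=> df _; exact: df. Qed.

Lemma C1_continuous f : C1 f -> continuous f.
Proof. by move=> cf x; exact/differentiable_continuous/C1_differentiable. Qed.

Lemma C1_derive_continuous f v : C1 f -> continuous ('D_v f).
Proof. by case=> _ cf x; exact: cf. Qed.

Lemma C1_derivable f v x : C1 f -> derivable f x v.
Proof. by move=> cf; exact/diff_derivable/C1_differentiable. Qed.

Lemma derive_mul f g v x : C1 f -> C1 g ->
  'D_v (fun x => f x * g x) x = 'D_v f x * g x + f x * 'D_v g x.
Proof.
move=> cf cg; rewrite deriveM; [|exact: C1_derivable..].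
by rewrite /= addrC -![_ *: _]/(_ * _) [g x * _]mulrC.
Qed.

Lemma C1M f g : C1 f -> C1 g -> C1 (fun x => f x * g x).
Proof.
move=> cf cg; split=> [x _|v x _].
  by apply: differentiableM; exact: C1_differentiable.
have -> : 'D_v (fun x => f x * g x) = fun x => 'D_v f x * g x + f x * 'D_v g x.
  by apply/funext => y; exact: derive_mul.
by apply: cvgD; apply: cvgM; (exact: C1_derive_continuous || exact: C1_continuous).
Qed.

Lemma is_derive_e1 f (x y : R) : C1 f ->
  is_derive x (1 : R) (fun x => f (x, y)) ('D_(e1 R) f (x, y)).
Proof.
move=> cf; have [df _] := derivableP (C1_derivable (v := e1 R) (x := (x, y)) cf).
have E : (fun h : R => h^-1 *: (f ((h *: (1 : R) + x), y) - f (x, y))) =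
    (fun h : R => h^-1 *: (f (h *: e1 R + (x, y)) - f (x, y))).
  apply/funext => h; congr (_ *: (f _ - _)); apply: R2_eq; rewrite !R2E //=.
  by rewrite mulr0 add0r.
by split; rewrite /derivable /derive /shift /= E.
Qed.

Lemma is_derive_e2 f (x y : R) : C1 f ->
  is_derive y (1 : R) (fun y => f (x, y)) ('D_(e2 R) f (x, y)).
Proof.
move=> cf; have [df _] := derivableP (C1_derivable (v := e2 R) (x := (x, y)) cf).
have E : (fun h : R => h^-1 *: (f (x, (h *: (1 : R) + y)) - f (x, y))) =
    (fun h : R => h^-1 *: (f (h *: e2 R + (x, y)) - f (x, y))).
  apply/funext => h; congr (_ *: (f _ - _)); apply: R2_eq; rewrite !R2E //=.
  by rewrite mulr0 add0r.
by split; rewrite /derivable /derive /shift /= E.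
Qed.

Lemma green (I : eqType) (D : set (R2 R)) (s : seq I) (P Q N : I -> R2 R) f v :
  edged_region D s P Q N -> C1 f -> v = e1 R \/ v = e2 R ->
  int2 D ('D_v f) =
  \sum_(i <- s) enorm2 (Q i - P i) * dot2 (N i) v * intseg (P i) (Q i) f.
Proof.
move=> DE cf [] ->.
  rewrite (green_e1 DE (C1_continuous cf) (C1_derive_continuous (v := e1 R) cf)
    (fun x y => is_derive_e1 x y cf)).
    by apply: eq_bigr => i _; rewrite /dot2 /= mulr1 mulr0 addr0.
rewrite (green_e2 DE (C1_continuous cf) (C1_derive_continuous (v := e2 R) cf)
    (fun x y => is_derive_e2 x y cf)).
by apply: eq_bigr => i _; rewrite /dot2 /= mulr1 mulr0 add0r.
Qed.

End C1.

Section polygon.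
Context {R : realType}.
Implicit Types (D : set (R2 R)) (z : seq (R2 R)) (nn : R2 R -> R2 R).

Lemma next_neq (T : eqType) (z : seq T) (p : T) :
  uniq z -> (1 < size z)%N -> p \in z -> next z p != p.
Proof.
move=> uz sz /rot_to[i z' E]; rewrite -(next_rot i uz) E.
have : uniq (p :: z') by rewrite -E rot_uniq.
have : (1 < size (p :: z'))%N by rewrite -E size_rot.
case: z' {E} => //= q z' _; rewrite inE negb_or eq_sym eqxx.
by case: eqP.
Qed.

Lemma polygon_edged D z nn : polygon D z ->
  (forall p, p \in z -> is_outward_conormal D p (next z p) (nn p)) ->
  edged_region D z id (next z) nn.
Proof.
move=> Dz nnP; split => //.
- exact: polygon_compact Dz.
- move=> x Dx xz; apply: contrapT => xD.
  have : frontier D x by split=> //; exact: subset_closure.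
  by rewrite (polygon_frontier Dz) => -[p pz]; exact: xz.
- exact: polygon_uniq Dz.
- move=> p pz; rewrite eq_sym next_neq ?(polygon_uniq Dz)//.
  exact: ltnW (polygon_size Dz).
- move=> p q x pz qz pq xp xq.
  by have [[-> ->]|[->]] := polygon_simple Dz pz qz pq xp xq; [right|left].
Qed.

Lemma polygon_segment D z p : polygon D z -> p \in z ->
  segment p (next z p) `<=` D.
Proof.
move=> Dz pz x px; have : frontier D x by rewrite (polygon_frontier Dz); exists p.
have /closure_id cD := compact_closed2 (polygon_compact Dz).
by case=> + _; rewrite -cD.
Qed.

End polygon.

Section trace.
Context {R : realType}.
Notation MR := (measurableTypeR R).
Notation mu := (@lebesgue_measure R).
Implicit Types (D : set (R2 R)) (z : seq (R2 R)) (nn : R2 R -> R2 R).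

Lemma L2_continuous D (f : R2 R -> R) : compact D -> continuous f -> L2 D f.
Proof.
move=> kD cf; split; first exact: continuous_measurable2.
apply: (continuous_integrable2 kD) => x.
by apply: cvgM; exact: cf.
Qed.

Lemma sqint_line (p q : R2 R) (f : R2 R -> R) : continuous f ->
  sqint mu `[0, 1] (fun t : R => f (p + t *: (q - p))).
Proof.
move=> cf; have cg : continuous (fun t : R => f (p + t *: (q - p))).
  by move=> t; apply: continuous_comp; [exact: line_continuous|exact: cf].
split; first by apply: measurable_funTS; exact: continuous_measurable_fun.
apply: (@continuous_integrable_itv _ 0 1 true false
  (fun t => f (p + t *: (q - p)) ^+ 2)).
by apply: continuous_subspaceT => t; apply: cvgM; exact: cg.
Qed.

Lemma wD_L2 D (w : R2 R -> R) (v : R2 R) : H1_space D w -> L2 D (wD D v w).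
Proof.
move=> [_ /(_ v) H]; rewrite /wD.
by have [] := @xgetPex _ (cst 0) _ H.
Qed.

Lemma cvg_sum_seq (J : eqType) (s : seq J) (u : J -> nat -> R) (l : J -> R) :
  (forall i, i \in s -> u i k @[k --> \oo] --> l i) ->
  \sum_(i <- s) u i k @[k --> \oo] --> \sum_(i <- s) l i.
Proof.
elim: s => [_|i s IH ul].
  by under eq_fun do rewrite big_nil; rewrite big_nil; exact: cvg_cst.
under eq_fun do rewrite big_cons; rewrite big_cons.
apply: cvgD; first exact/ul/mem_head.
by apply: IH => j js; apply: ul; rewrite inE js orbT.
Qed.

(** Green's formula is applied to the product of [psi] with the smooth approximations from the
    definition of a trace; each term pairs a convergent sequence with a fixed square-integrable
    function. *)
Lemma trace_green D z nn (w g psi : R2 R -> R) (v : R2 R) :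
  polygon D z ->
  (forall p, p \in z -> is_outward_conormal D p (next z p) (nn p)) ->
  is_trace D z w g -> C1 psi -> v = e1 R \/ v = e2 R ->
  int2 D (fun x => w x * 'D_v psi x) + int2 D (fun x => wD D v w x * psi x) =
  \sum_(p <- z) enorm2 (next z p - p) * dot2 (nn p) v *
    intseg p (next z p) (fun x => g x * psi x).
Proof.
move=> Dz nnP [H1w Lg [u [su uw uDw ug]]] cpsi vE.
have DE := polygon_edged Dz nnP; have kD := polygon_compact Dz.
have mD := closed_measurable2 (compact_closed2 kD).
have cu k : C1 (u k) by exact: smooth_C1.
have Lu k : L2 D (u k) by apply: L2_continuous => //; exact: C1_continuous.
have LDu k : L2 D ('D_v (u k)).
  by apply: L2_continuous => //; exact: C1_derive_continuous.
have Lp : L2 D psi by apply: L2_continuous => //; exact: C1_continuous.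
have LDp : L2 D ('D_v psi).
  by apply: L2_continuous => //; exact: C1_derive_continuous.
pose L k := int2 D (fun x => u k x * 'D_v psi x) +
  int2 D (fun x => 'D_v (u k) x * psi x).
have LE k : L k = \sum_(p <- z) enorm2 (next z p - p) * dot2 (nn p) v *
    intseg p (next z p) (fun x => u k x * psi x).
  rewrite -(green DE (C1M (cu k) cpsi) vE) /L /int2 -RintegralD//; last 2 first.
    - exact: (sqintM mD (Lu k) LDp).
    - exact: (sqintM mD (LDu k) Lp).
  by apply: eq_Rintegral => x _; rewrite derive_mul// addrC.
have L1 : L k @[k --> \oo] --> int2 D (fun x => w x * 'D_v psi x) +
    int2 D (fun x => wD D v w x * psi x).
  apply: cvgD.
    exact: (sqint_cvg mD Lu (H1w.1) LDp uw).
  exact: (sqint_cvg mD LDu (wD_L2 v H1w) Lp (uDw v)).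
have L2' : L k @[k --> \oo] --> \sum_(p <- z)
    enorm2 (next z p - p) * dot2 (nn p) v *
    intseg p (next z p) (fun x => g x * psi x).
  rewrite (funext LE); apply: cvg_sum_seq => p pz.
  apply: cvgM; first exact: cvg_cst.
  pose q (t : R) := p + t *: (next z p - p).
  apply: (@sqint_cvg _ _ R mu `[0, 1]%classic (measurable_itv _)
    (fun k => u k \o q) (g \o q) (psi \o q)) (ug p pz).
  - by move=> k; apply: sqint_line; exact: C1_continuous.
  - exact: Lg.
  - by apply: sqint_line; exact: C1_continuous.
exact: (cvg_unique _ L1 L2').
Qed.

End trace.

(** * Localisation of boundary identities on one edge *)

Section power_limit.
Context d (T : measurableType d) (R : realType).
Variables (mu : {measure set T -> \bar R}) (D : set T).
Hypothesis mD : measurable D.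

Lemma bounded_mul_integrable (f h : T -> R) (B : R) :
  mu.-integrable D (EFin \o f) -> measurable_fun D h ->
  (forall x, D x -> `|h x| <= B) ->
  mu.-integrable D (EFin \o (fun x => f x * h x)).
Proof.
move=> iF mh hB; have mF : measurable_fun D f.
  by apply/measurable_EFinP; exact: (measurable_int mu).
apply: (le_integrable_real mD _ (integrableZl mD B (integrable_norm iF))).
  exact: measurable_funM.
by move=> x Dx; rewrite normrM mulrC ler_wpM2r// hB.
Qed.

Lemma cvg_expr_indic (c : R) : 0 <= c <= 1 ->
  c ^+ n @[n --> \oo] --> ((c == 1)%:R : R).
Proof.
move=> /andP[c0]; rewrite le_eqVlt => /predU1P[->|c1].
  by rewrite eqxx; under eq_fun do rewrite expr1n; exact: cvg_cst.
by rewrite lt_eqF//; apply: cvg_expr; rewrite ger0_norm.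
Qed.

(** Powers of a function with values in the unit interval tend to the indicator of the set where it
    is 1, and [|f|] dominates. This is how test functions are made to concentrate. *)
Lemma Rintegral_power_limit (f c : T -> R) :
  mu.-integrable D (EFin \o f) -> measurable_fun D c ->
  (forall x, D x -> 0 <= c x <= 1) ->
  mu.-integrable D (EFin \o (fun x => f x * (c x == 1)%:R)) /\
  \int[mu]_(x in D) (f x * c x ^+ n) @[n --> \oo] -->
    \int[mu]_(x in D) (f x * (c x == 1)%:R).
Proof.
move=> iF mc c01; have mF : measurable_fun D f.
  by apply/measurable_EFinP; exact: (measurable_int mu).
have fc x : D x -> (f x * c x ^+ n)%:E @[n --> \oo] -->
    (f x * (c x == 1)%:R)%:E.
  move=> Dx; apply/cvg_EFin; first by apply: nearW.
  by apply: cvgM; [exact: cvg_cst|exact: cvg_expr_indic (c01 _ Dx)].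
have mfc n : measurable_fun D (fun x => (f x * c x ^+ n)%:E).
  apply/measurable_EFinP; apply: measurable_funM => //.
  exact: measurable_funX.
have mlim := @emeasurable_fun_cvg _ _ _ D _ _ mfc fc.
have [] := @dominated_convergence _ T R mu D mD
  (fun n x => (f x * c x ^+ n)%:E) (fun x => (f x * (c x == 1)%:R)%:E)
  (fun x => `|f x|%:E) mfc mlim.
- exact: aeW.
- exact: integrable_norm.
- apply: aeW => x n Dx; rewrite lee_fin normrM ler_piMr// normrX.
  by have /andP[c0 c1] := c01 _ Dx; rewrite ger0_norm// exprn_ile1.
move=> iL _ cL; split=> //; apply: fine_cvg.
by rewrite /Rintegral fineK//; exact: (integrable_fin_num mD iL).
Qed.

End power_limit.

Lemma Rintegral_negligible0 d (T : measurableType d) (R : realType)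
    (mu : {measure set T -> \bar R}) (D N : set T) (f : T -> R) :
  measurable D -> mu.-integrable D (EFin \o f) -> mu.-negligible N ->
  (forall x, D x -> ~ N x -> f x = 0) -> \int[mu]_(x in D) f x = 0.
Proof.
move=> mD iF N0 f0; rewrite /Rintegral (@ae_eq_integral _ _ _ mu D (cst 0%E)) //.
- by rewrite integral0.
- exact: (measurable_int mu).
apply: negligibleS N0 => x; apply: contra_notP => Nx Dx /=.
by rewrite f0.
Qed.

Section coordinates.
Context {R : realType}.
Implicit Types (p q n v x : R2 R).

Lemma fst_continuous2 : continuous (fun x : R2 R => x.1).
Proof. by move=> [a b]; exact: cvg_fst. Qed.

Lemma snd_continuous2 : continuous (fun x : R2 R => x.2).
Proof. by move=> [a b]; exact: cvg_snd. Qed.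

Lemma dot2_continuous v p : continuous (fun x => dot2 v (x - p)).
Proof.
move=> x; rewrite /dot2; apply: cvgD; (apply: cvgM; first exact: cvg_cst);
  under eq_fun do rewrite R2E; (apply: cvgB; last exact: cvg_cst).
  exact: fst_continuous2.
exact: snd_continuous2.
Qed.

(** Affine coordinate of the orthogonal projection onto the line through [p] and [q]: 0 at [p], 1 at
    [q]. *)
Definition along p q x : R := dot2 (q - p) (x - p) / dot2 (q - p) (q - p).

(** For a unit [n], the signed distance to the line through [p] orthogonal to [n]. *)
Definition across n p x : R := dot2 n (x - p).

Lemma along_continuous p q : continuous (along p q).
Proof.
by move=> x; apply: cvgM; [exact: dot2_continuous|exact: cvg_cst].
Qed.

Lemma across_continuous n p : continuous (across n p).
Proof. exact: dot2_continuous. Qed.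

Lemma dot2_gt0 v : v != 0 -> 0 < dot2 v v.
Proof.
move=> v0; rewrite lt_neqAle /dot2 -!expr2 addr_ge0 ?sqr_ge0// andbT.
apply: contra_neq v0 => /esym/eqP; rewrite paddr_eq0 ?sqr_ge0//.
by rewrite !sqrf_eq0 => /andP[/eqP v1 /eqP v2]; exact: R2_eq.
Qed.

Lemma along_line p q (t : R) : p != q -> along p q (p + t *: (q - p)) = t.
Proof.
move=> pq; rewrite /along [p + _]addrC addrK dot2Zr mulfK// gt_eqF// dot2_gt0//.
by rewrite subr_eq0 eq_sym.
Qed.

Lemma along_start p q : along p q p = 0.
Proof. by rewrite /along subrr /dot2 /= !mulr0 addr0 mul0r. Qed.

Lemma along_end p q : p != q -> along p q q = 1.
Proof.
by move=> pq; rewrite -[RHS](along_line 1 pq) scale1r addrC subrK.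
Qed.

Lemma across_line n p q (t : R) : dot2 n (q - p) = 0 ->
  across n p (p + t *: (q - p)) = 0.
Proof. by move=> npq; rewrite /across [p + _]addrC addrK dot2Zr npq mulr0. Qed.

Lemma across_eq0 n p q x : p != q -> dot2 n n = 1 -> dot2 n (q - p) = 0 ->
  across n p x = 0 -> x = p + along p q x *: (q - p).
Proof.
move=> pq nn npq; rewrite /across /along.
have tt : dot2 (q - p) (q - p) != 0.
  by rewrite gt_eqF// dot2_gt0// subr_eq0 eq_sym.
move: tt npq nn; rewrite /dot2 !R2E.
set a := q.1 - p.1; set b := q.2 - p.2.
set u := x.1 - p.1; set w := x.2 - p.2 => tt npq nn nx.
(* The determinant of [x - p] and [q - p], two vectors orthogonal to [n]; it is expanded after
   multiplication by [dot2 n n], which is 1. *)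
have uw : u * b - w * a = 0.
  transitivity (n.1 * ((n.1 * u + n.2 * w) * b - w * (n.1 * a + n.2 * b)) +
    n.2 * (u * (n.1 * a + n.2 * b) - a * (n.1 * u + n.2 * w))).
    by rewrite -[LHS]mulr1 -nn; ring.
  by rewrite nx npq !(mulr0, mul0r, subr0, addr0).
have uwb : b * (u * b - w * a) = 0 by rewrite uw mulr0.
have uwa : a * (u * b - w * a) = 0 by rewrite uw mulr0.
apply: R2_eq; rewrite !R2E -/a -/b.
  have -> : x.1 = p.1 + u by rewrite /u addrC subrK.
  congr (_ + _); apply: (mulIf tt); rewrite mulrAC mulfVK//; lra.
have -> : x.2 = p.2 + w by rewrite /w addrC subrK.
congr (_ + _); apply: (mulIf tt); rewrite mulrAC mulfVK//; lra.
Qed.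

End coordinates.

Section localisation.
Context {R : realType}.
Notation mu := (@lebesgue_measure R).
Notation MR := (measurableTypeR R).

Lemma negligible_point (x : R) : mu.-negligible [set x].
Proof.
by exists [set x]; split => //; exact: lebesgue_measure_set1.
Qed.

(** Either the line is vertical, a product with a null first factor, or every vertical line meets it
    in at most one point. *)
Lemma negligible_line (n p : R2 R) : dot2 n n = 1 ->
  (@mu2 R).-negligible [set x | across n p x = 0].
Proof.
move=> nn; set L := [set x | _].
have mL : @measurable _ (MR * MR)%type L.
  apply: closed_measurable2.
  rewrite (_ : L = across n p @^-1` [set 0]); last by [].
  apply: closed_comp; last exact: closed_eq.
  by move=> x _; exact: across_continuous.
exists L; split => //; have [n20|n20] := eqVneq n.2 0.
  have n10 : n.1 != 0.
    by apply: contra_eq_neq nn => n10; rewrite /dot2 n10 n20 !mul0r addr0 eq_sym oner_eq0.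
  have -> : L = [set p.1] `*` setT.
    apply/seteqP; split => x; rewrite /L /= /across /dot2 !R2E n20 mul0r addr0.
      by move=> /eqP; rewrite mulf_eq0 (negbTE n10) subr_eq0 => /eqP.
    by case=> -> _; rewrite subrr mulr0.
  rewrite /mu2 product_measure1E//.
  by rewrite [X in (X * _)%E](_ : _ = 0%E) ?mul0e//; exact: lebesgue_measure_set1.
rewrite /mu2 /product_measure1.
apply: integral0_eq => x _ /=.
have sub : xsection L x `<=` [set p.2 - n.1 * (x - p.1) / n.2].
  move=> y /xsectionP; rewrite /L /= /across /dot2 !R2E /= => h.
  have -> : n.1 * (x - p.1) = - (n.2 * (y - p.2)) by lra.
  by field.
apply: (@subset_measure0 _ _ _ mu _ _ _ _ sub) => //.
- exact: measurable_xsection.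
- exact: lebesgue_measure_set1.
Qed.

(* [(1 - l^2 / M)^N] localises the identity [H] on the line of the edge, where
   [l = 0]; then [((M - (s - 1/2)^2) / (M - 1/4))^N], which is at least 1 on the
   edge and tends to 0 on the rest of the line, localises it on the edge. *)
Lemma edge_localisation (D : set (R2 R)) (z : seq (R2 R)) (p0 n : R2 R)
    (A : R2 R -> R) (f : R2 R -> R -> R) (a : {poly R}) :
  polygon D z -> p0 \in z -> let q0 := next z p0 in
  dot2 n n = 1 -> dot2 n (q0 - p0) = 0 ->
  (@mu2 R).-integrable D (EFin \o A) ->
  (forall p, p \in z -> mu.-integrable `[0, 1] (EFin \o f p)) ->
  (forall b c : {poly R},
    int2 D (fun x => A x * ((a * c).[along p0 q0 x] * b.[across n p0 x])) =
    \sum_(p <- z) \int[mu]_(t in `[0, 1]) (f p t *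
      ((a * c).[along p0 q0 (p + t *: (next z p - p))] *
       b.[across n p0 (p + t *: (next z p - p))]))) ->
  (forall t : R, 0 <= t <= 1 -> 0 <= f p0 t * a.[t]) ->
  \int[mu]_(t in `[0, 1]) (f p0 t * a.[t]) = 0.
Proof.
move=> Dz p0z q0 nn npq iA iF H pos.
have kD := polygon_compact Dz.
have mD := closed_measurable2 (compact_closed2 kD).
have m01 : @measurable _ MR `[0, 1] := measurable_itv _.
have uz := polygon_uniq Dz.
have pq : p0 != q0.
  by rewrite eq_sym next_neq// (leq_trans _ (polygon_size Dz)).
pose s := along p0 q0; pose l := across n p0.
pose g p (t : R) := p + t *: (next z p - p).
have cs : continuous s := @along_continuous _ p0 q0.
have cl : continuous l := @across_continuous _ n p0.
have cg p : continuous (g p) by exact: line_continuous.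
have gD p t : p \in z -> 0 <= t <= 1 -> D (g p t).
  by move=> pz t01; apply: (polygon_segment Dz pz); exists t.
have [M M0 lM] := compact_bounded_fun kD (f := fun x => l x ^+ 2)
  (fun x => cvgM (cl x) (cl x)).
have [M' M'0 sM] := compact_bounded_fun kD (f := fun x => (s x - 2^-1) ^+ 2)
  (fun x => cvgM (cvgB (cs x) (cvg_cst _)) (cvgB (cs x) (cvg_cst _))).
pose b : {poly R} := 1%:P - M^-1 *: 'X^2.
have bE x : b.[x] = 1 - x ^+ 2 / M.
  by rewrite /b hornerD hornerN hornerZ hornerXn hornerC; ring.
have b01 x : D x -> 0 <= b.[l x] <= 1.
  move=> Dx; rewrite bE subr_ge0 ler_pdivrMr// mul1r lerBlDr lerDl.
  by rewrite divr_ge0 ?sqr_ge0 ?(ltW M0)// (le_trans (ler_norm _) (lM _ Dx)).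
have b1 x : (b.[x] == 1) = (x == 0).
  rewrite bE -subr_eq0 [1 - _]addrC addrK oppr_eq0 mulf_eq0 invr_eq0.
  by rewrite (gt_eqF M0) orbF sqrf_eq0.
have hc (c : {poly R}) (h : R2 R -> R) : continuous h ->
    continuous (fun x => c.[h x]).
  by move=> ch x; apply: continuous_comp; [exact: ch|exact: continuous_horner].
have cgh p (h : R2 R -> R) : continuous h -> continuous (h \o g p).
  by move=> ch t; apply: continuous_comp; [exact: cg|exact: ch].
have bnd (h : R2 R -> R) : continuous h ->
    exists B, forall x, D x -> `|h x| <= B.
  by move=> ch; have [B _ hB] := compact_bounded_fun kD ch; exists B.
have if_mul p (h : R2 R -> R) : continuous h -> p \in z ->
    mu.-integrable `[0, 1] (EFin \o (fun t => f p t * h (g p t))).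
  move=> ch pz; have [B hB] := bnd _ ch.
  apply: (bounded_mul_integrable m01 (h := h \o g p) (B := B) (iF p pz)).
    by apply: measurable_funTS; exact: continuous_measurable_fun (cgh p h ch).
  by move=> t; rewrite /= in_itv/= => t01; exact/hB/gD.
have mg p (h : R2 R -> R) : continuous h -> @measurable_fun _ _ MR R `[0, 1] (h \o g p).
  by move=> ch; apply: measurable_funTS; exact: continuous_measurable_fun (cgh p h ch).
have lim_edge p (c : {poly R}) : p \in z ->
   mu.-integrable `[0, 1]
     (EFin \o (fun t => f p t * (a * c).[s (g p t)] * (l (g p t) == 0)%:R)) /\
   \int[mu]_(t in `[0, 1]) (f p t * (a * c).[s (g p t)] * b.[l (g p t)] ^+ N)
     @[N --> \oo] -->
   \int[mu]_(t in `[0, 1]) (f p t * (a * c).[s (g p t)] * (l (g p t) == 0)%:R).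
  move=> pz; under [fun t => _ * _]eq_fun do rewrite -b1.
  apply: (Rintegral_power_limit m01
    (f := fun t => f p t * (a * c).[s (g p t)]) (c := fun t => b.[l (g p t)])).
  - by apply: (if_mul p (fun x => (a * c).[s x])) => //; exact: hc.
  - by apply: (mg p (fun x => b.[l x])); exact: hc.
  - by move=> t; rewrite /= in_itv/= => t01; exact/b01/gD.
(* The limit of [H] with [b ^+ N] as second factor. The area term tends to an integral over a line,
   which is null, so only the parts of sides lying on the line [l = 0] remain, possibly from several
   sides. *)
have step1 (c : {poly R}) : \sum_(p <- z) \int[mu]_(t in `[0, 1])
    (f p t * (a * c).[s (g p t)] * (l (g p t) == 0)%:R) = 0.
  have L1 := @cvg_sum_seq R _ z _ _ (fun p pz => (lim_edge p c pz).2).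
  have [|B hB] := bnd (fun x => (a * c).[s x]); first exact: hc.
  have iAc : (@mu2 R).-integrable D (EFin \o (fun x => A x * (a * c).[s x])).
    apply: (bounded_mul_integrable mD (h := fun x => (a * c).[s x]) (B := B) iA) => //.
    by apply: continuous_measurable2; exact: hc.
  have [iL L2] := Rintegral_power_limit mD iAc
    (continuous_measurable2 (hc b l cl)) b01.
  apply: (cvg_unique _ L1); first exact: norm_hausdorff.
  have Z : \int[@mu2 R]_(x in D) (A x * (a * c).[s x] * (b.[l x] == 1)%:R) = 0.
    rewrite (Rintegral_negligible0 mD iL (negligible_line p0 nn))// => x Dx lx.
    by rewrite b1; case: eqP => // _; rewrite mulr0.
  rewrite Z in L2.
  have HN N : \sum_(p <- z) \int[mu]_(t in `[0, 1])
      (f p t * (a * c).[s (g p t)] * b.[l (g p t)] ^+ N) =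
      \int[@mu2 R]_(x in D) (A x * (a * c).[s x] * b.[l x] ^+ N).
    transitivity (int2 D (fun x => A x * ((a * c).[s x] * (b ^+ N).[l x]))).
      rewrite H; apply: eq_bigr => p _; apply: eq_Rintegral => t _.
      by rewrite horner_exp mulrA.
    by apply: eq_Rintegral => x _; rewrite horner_exp mulrA.
  by rewrite (funext HN).
(* [4^-1] is the value of [(s - 1/2)^2] at both ends of the edge, so that [k] is 1 there. The choice
   of [m] above the bound [M'] makes [k] nonnegative on [D] and its denominator positive. *)
pose m := M' + 1; have m1 : 0 < m - 4^-1 by rewrite /m; lra.
pose k : {poly R} := (m - 4^-1)^-1 *: (m%:P - ('X - 2^-1%:P) ^+ 2).
have kE x : k.[x] = (m - (x - 2^-1) ^+ 2) / (m - 4^-1).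
  by rewrite /k hornerZ hornerD hornerN horner_exp hornerD hornerN !hornerC hornerX mulrC.
have k0 x : D x -> 0 <= k.[s x].
  move=> Dx; rewrite kE divr_ge0 ?(ltW m1)// subr_ge0.
  by rewrite (le_trans (le_trans (ler_norm _) (sM _ Dx)))// /m lerDl.
have k_ge1 x : 0 <= x <= 1 -> 1 <= k.[x].
  by move=> x01; rewrite kE ler_pdivlMr// mul1r lerD2l lerN2 expr2; nra.
have k_lt1 x : ~ 0 <= x <= 1 -> k.[x] < 1.
  move=> x01; rewrite kE ltr_pdivrMr// mul1r ltrD2l ltrN2 expr2.
  have /orP[x0|x1] : (x < 0) || (1 < x).
    by move/negP: x01; rewrite negb_and -!ltNge.
    by nra.
  by nra.
have k01 : k.[0] = 1 /\ k.[1] = 1.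
  by split; rewrite kE; [rewrite sub0r sqrrN|rewrite (_ : 1 - 2^-1 = 2^-1); last lra];
   rewrite (_ : 2^-1 ^+ 2 = 4^-1 :> R) ?divff ?gt_eqF// expr2; lra.
pose h p (t : R) := f p t * a.[s (g p t)] * (l (g p t) == 0)%:R.
have ih p : p \in z -> mu.-integrable `[0, 1] (EFin \o h p).
  by move=> pz; have [+ _] := lim_edge p 1 pz; rewrite mulr1.
have hN N : \sum_(p <- z) \int[mu]_(t in `[0, 1]) (h p t * k.[s (g p t)] ^+ N) = 0.
  rewrite -[RHS](step1 (k ^+ N)); apply: eq_bigr => p _; apply: eq_Rintegral => t _.
  by rewrite hornerM horner_exp /h mulrAC mulrA.
(* the other edges meet the edge of [p0] at most at their end points *)
have other p t : p \in z -> p != p0 -> 0 <= t <= 1 -> l (g p t) = 0 ->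
    0 <= s (g p t) <= 1 -> k.[s (g p t)] = 1 /\ (t = 0 \/ t = 1).
  move=> pz pp t01 lt st.
  have gE := across_eq0 pq nn npq lt.
  have segp0 : segment p0 q0 (g p t) by exists (s (g p t)).
  have segp : segment p (next z p) (g p t) by exists t.
  have pn : p != next z p.
    by rewrite eq_sym next_neq// (leq_trans _ (polygon_size Dz)).
  have tE : along p (next z p) (g p t) = t by exact: along_line.
  have [k00 k11] := k01.
  have [[gp0 p0E]|[gp q0E]] := polygon_simple Dz pz p0z pp segp segp0.
    rewrite gp0 /s along_start; split => //; right.
    by rewrite -tE gp0 p0E along_end.
  rewrite gp {1}q0E /s along_end//; split => //; left.
  by rewrite -tE gp along_start.
have lim0 p : p \in z -> p != p0 ->
    \int[mu]_(t in `[0, 1]) (h p t * k.[s (g p t)] ^+ N) @[N --> \oo] --> (0 : R).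
  (* With the indicator of the line included, the factor is at most 1 on this side: [k] is 1 where
     the side touches the edge and smaller than 1 elsewhere on the line. *)
  move=> pz pp; pose c (t : R) := (l (g p t) == 0)%:R * k.[s (g p t)].
  have mc : @measurable_fun _ _ MR R `[0, 1] c.
    apply: measurable_funM; last by apply: (mg p (fun x => k.[s x])); exact: hc.
    have -> : (fun t => (l (g p t) == 0)%:R) = \1_[set t | l (g p t) = 0] :> (R -> R).
      apply/funext => t; rewrite indicE; congr ((nat_of_bool _)%:R).
      by apply/idP/idP; rewrite inE => /eqP.
    apply: measurable_indic; apply: closed_measurable.
    by apply: (@closed_comp _ _ (l \o g p) [set 0]) => [t _|]; [exact: cgh|exact: closed_eq].
  have c01 t : `[0, 1]%classic t -> 0 <= c t <= 1.
    rewrite /= in_itv/= => t01; rewrite /c; have [lt|lt] := eqVneq (l (g p t)) 0; last first.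
      by rewrite mul0r lexx ler01.
    rewrite mul1r k0 /=; last exact: gD.
    have [st|/negP st] := boolP (0 <= s (g p t) <= 1).
      by have [-> _] := other p t pz pp t01 lt st.
    exact/ltW/k_lt1.
  have [iL L] := Rintegral_power_limit m01 (ih p pz) mc c01.
  have Z : \int[mu]_(t in `[0, 1]) (h p t * (c t == 1)%:R) = 0.
    have /(_ ([set 0] `|` [set 1])) := fun N => Rintegral_negligible0 m01 iL (N := N).
    apply.
      by apply: negligibleU; exact: negligible_point.
    move=> t; rewrite /= in_itv/= => t01 tN; rewrite /h /c.
    have [lt|lt] := eqVneq (l (g p t)) 0; last by rewrite mulr0 mul0r.
    rewrite mul1r; have [st|/negP st] := boolP (0 <= s (g p t) <= 1).
      by have [_] := other p t pz pp t01 lt st; move/tN.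
    by rewrite (lt_eqF (k_lt1 _ st)) mulr0.
  have E N : \int[mu]_(t in `[0, 1]) (h p t * k.[s (g p t)] ^+ N) =
      \int[mu]_(t in `[0, 1]) (h p t * c t ^+ N).
    apply: eq_Rintegral => t _; rewrite /h /c.
    by case: eqP => _; rewrite ?mul1r// mulr0 !mul0r.
  by rewrite (funext E); rewrite Z in L; exact: L.
have hp0 t : h p0 t = f p0 t * a.[t].
  by rewrite /h /s /l /g along_line// across_line// eqxx mulr1.
apply/eqP; rewrite eq_le; apply/andP; split; last first.
  by apply: Rintegral_ge0 => t; rewrite /= in_itv/=; exact: pos.
(* If [J] were positive, for some [N] the other sides would contribute less than [J] in absolute
   value. The edge itself contributes at least [J], as [k] is at least 1 on it and the integrand
   nonnegative, so the total could not be 0. *)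
rewrite leNgt; apply/negP => J0; set J := Rintegral _ _ _ in J0.
have /cvgrPdist_lt/(_ _ J0) : \sum_(p <- [seq p <- z | p != p0])
    \int[mu]_(t in `[0, 1]) (h p t * k.[s (g p t)] ^+ N) @[N --> \oo] -->
    \sum_(p <- [seq p <- z | p != p0]) (0 : R).
  apply: cvg_sum_seq => p; rewrite mem_filter => /andP[pp pz].
  exact: lim0.
rewrite big1// => /filter_ex[N].
rewrite big_filter; have := hN N; rewrite (bigD1_seq p0)//= => /eqP.
rewrite addr_eq0 => /eqP XE; rewrite sub0r -XE.
apply/negP; rewrite -leNgt; apply: (le_trans _ (ler_norm _)).
have ks : continuous (fun x => k.[s x]) by exact: hc.
have [B hB] := bnd (fun x => k.[s x] ^+ N)
  (fun x => continuous_comp (ks x) (@exprn_continuous _ N _)).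
have ihk : mu.-integrable `[0, 1] (EFin \o (fun t => h p0 t * k.[s (g p0 t)] ^+ N)).
  apply: (bounded_mul_integrable m01 (h := fun t => k.[s (g p0 t)] ^+ N) (B := B) (ih _ p0z)).
    by apply: measurable_funX; exact: (mg p0 (fun x => k.[s x])).
  by move=> t; rewrite /= in_itv/= => t01; exact/hB/gD.
have ihp0 : mu.-integrable `[0, 1] (EFin \o (fun t => f p0 t * a.[t])).
  by rewrite -(funext hp0); exact: ih.
apply: (le_Rintegral m01 ihp0 ihk) => t; rewrite /= in_itv/= => t01.
rewrite hp0 {1}/s /g along_line// ler_peMr ?pos//.
by rewrite exprn_ege1// k_ge1.
Qed.

End localisation.

Section C1_polynomials.
Context {R : realType}.
Implicit Types (f h : R2 R -> R) (v w p : R2 R).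

Lemma diff_fst2 (x : R2 R) : differentiable (fst : R2 R -> R) x /\
  forall w, 'D_w (fst : R2 R -> R) x = w.1.
Proof.
have df : differentiable (fst : R2 R -> R) x.
  by apply: linear_differentiable; exact: fst_continuous2.
split => // w; rewrite deriveE// diff_lin//; exact: fst_continuous2.
Qed.

Lemma diff_snd2 (x : R2 R) : differentiable (snd : R2 R -> R) x /\
  forall w, 'D_w (snd : R2 R -> R) x = w.2.
Proof.
have df : differentiable (snd : R2 R -> R) x.
  by apply: linear_differentiable; exact: snd_continuous2.
split => // w; rewrite deriveE// diff_lin//; exact: snd_continuous2.
Qed.

Lemma C1_cst (c : R) : C1 (fun _ : R2 R => c) /\
  forall w x, 'D_w (fun _ : R2 R => c) x = 0.
Proof.
have D0 w x : 'D_w (fun _ : R2 R => c) x = 0 by exact: derive_cst.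
split; last exact: D0.
split=> [x _|w x _]; first exact: differentiable_cst.
by rewrite (funext (D0 w)); exact: cvg_cst.
Qed.

Lemma C1D f h : C1 f -> C1 h -> C1 (fun x => f x + h x) /\
  forall w x, 'D_w (fun x => f x + h x) x = 'D_w f x + 'D_w h x.
Proof.
move=> cf ch; have D0 w x : 'D_w (fun x => f x + h x) x = 'D_w f x + 'D_w h x.
  by rewrite deriveD//; exact: C1_derivable.
split; last exact: D0.
split=> [x _|w x _].
  by apply: differentiableD; exact: C1_differentiable.
by rewrite (funext (D0 w)); apply: cvgD; exact: C1_derive_continuous.
Qed.

Lemma C1_fst : C1 (fst : R2 R -> R).
Proof.
split=> [x _|w x _]; first by have [] := diff_fst2 x.
by rewrite (funext (fun x => (diff_fst2 x).2 w)); exact: cvg_cst.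
Qed.

Lemma C1_snd : C1 (snd : R2 R -> R).
Proof.
split=> [x _|w x _]; first by have [] := diff_snd2 x.
by rewrite (funext (fun x => (diff_snd2 x).2 w)); exact: cvg_cst.
Qed.

Lemma C1_affine v p (k : R) : C1 (fun x => dot2 v (x - p) * k) /\
  forall w x, 'D_w (fun x => dot2 v (x - p) * k) x = dot2 v w * k.
Proof.
have cE c : C1 (fun _ : R2 R => c) by have [] := C1_cst c.
have DE (c : R) (w x : R2 R) : 'D_w (fun _ : R2 R => c) x = 0 by have [_ ->] := C1_cst c.
have c1 := C1M (cE (v.1 * k)) C1_fst; have c2 := C1M (cE (v.2 * k)) C1_snd.
have [c12 D12] := C1D c1 c2.
have [c123 D123] := C1D c12 (cE (- dot2 v p * k)).
have -> : (fun x => dot2 v (x - p) * k) =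
    fun x => v.1 * k * x.1 + v.2 * k * x.2 + - dot2 v p * k.
  by apply/funext => x; rewrite /dot2 !R2E; ring.
split; first exact: c123.
move=> w x; rewrite D123 D12 (@derive_mul _ (fun=> v.1 * k) _ w x (cE _) C1_fst).
rewrite (@derive_mul _ (fun=> v.2 * k) _ w x (cE _) C1_snd).
by rewrite (diff_fst2 x).2 (diff_snd2 x).2 !DE /dot2; ring.
Qed.

Lemma C1_horner (a : {poly R}) h : C1 h -> C1 (fun x => a.[h x]) /\
  forall w x, 'D_w (fun x => a.[h x]) x = a^`().[h x] * 'D_w h x.
Proof.
move=> ch; elim/poly_ind: a => [|a c [ca Da]].
  have -> : (fun x => (0 : {poly R}).[h x]) = fun=> 0.
    by apply/funext => x; rewrite horner0.
  have [c0 D0] := C1_cst 0; split; first exact: c0.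
  by move=> w x; rewrite D0 derivC horner0 mul0r.
have cM := C1M ca ch; have [cc Dc] := C1_cst c.
have [cD DD] := C1D cM cc.
have -> : (fun x => (a * 'X + c%:P).[h x]) = fun x => a.[h x] * h x + c.
  by apply/funext => x; rewrite !hornerE.
split; first exact: cD.
move=> w x; rewrite DD Dc (@derive_mul _ (fun x => a.[h x]) _ w x ca ch) Da.
rewrite derivD derivM derivX derivC !hornerE; ring.
Qed.

End C1_polynomials.

(** * Uniqueness and tangential derivative of traces *)

Section trace_uniqueness.
Context {R : realType}.
Notation MR := (measurableTypeR R).
Notation mu := (@lebesgue_measure R).
Implicit Types (D : set (R2 R)) (z : seq (R2 R)) (nn : R2 R -> R2 R).

Lemma C1_along (a : {poly R}) (p q : R2 R) :
  C1 (fun x => a.[along p q x]) /\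
  forall v x, 'D_v (fun x => a.[along p q x]) x =
    a^`().[along p q x] * (dot2 (q - p) v / dot2 (q - p) (q - p)).
Proof.
have [c1 D1] := C1_affine (q - p) p (dot2 (q - p) (q - p))^-1.
have [c2 D2] := C1_horner a c1; split; first exact: c2.
by move=> v x; rewrite D2 D1.
Qed.

Lemma C1_across (b : {poly R}) (n p : R2 R) :
  C1 (fun x => b.[across n p x]) /\
  forall v x, 'D_v (fun x => b.[across n p x]) x =
    b^`().[across n p x] * dot2 n v.
Proof.
have [c1 D1] := C1_affine n p 1.
have E : (fun x => dot2 n (x - p) * 1) = across n p.
  by apply/funext => x; rewrite mulr1.
rewrite E in c1 D1.
have [c2 D2] := C1_horner b c1; split; first exact: c2.
by move=> v x; rewrite D2 D1 mulr1.
Qed.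

Lemma sqint_mul_bounded d (T : measurableType d) (m : {measure set T -> \bar R})
    (A : set T) (f h : T -> R) (B : R) : measurable A -> sqint m A f ->
  measurable_fun A h -> (forall x, A x -> `|h x| <= B) ->
  sqint m A (fun x => f x * h x).
Proof.
move=> mA [mf if2] mh hB; split; first exact: measurable_funM.
have := @bounded_mul_integrable _ _ R m A mA (fun x => f x ^+ 2)
  (fun x => h x ^+ 2) (B ^+ 2) if2.
have -> : (fun x => ((f x * h x) ^+ 2)%:E) = EFin \o (fun x => f x ^+ 2 * h x ^+ 2).
  by apply/funext => x; rewrite /= exprMn.
apply; first exact: measurable_funX.
move=> x /hB hx; rewrite normrX lerXn2r ?nnegrE//.
exact: le_trans hx.
Qed.

Lemma line_bounded (p q : R2 R) (f : R2 R -> R) : continuous f ->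
  exists B, forall t, `[0, 1]%classic t -> `|f (p + t *: (q - p))| <= B.
Proof.
move=> cf; have cg : continuous (fun t : R => f (p + t *: (q - p))).
  by move=> t; apply: continuous_comp; [exact: line_continuous|exact: cf].
have /compact_bounded[B [_ fB]] :
    compact ((fun t : R => f (p + t *: (q - p))) @` `[0, 1]).
  by apply: continuous_compact; [exact: continuous_subspaceT|exact: segment_compact].
exists (`|B| + 1) => t t01.
by apply: fB; [rewrite (le_lt_trans (ler_norm B))// ltrDl|exists t].
Qed.

(** The area terms in Green's formula do not involve the trace, so they cancel in the difference for
    [g] and [g']. The remaining boundary identity is turned into one for the square of the
    difference, and then localised. *)
Lemma trace_unique_int D z nn (w g g' : R2 R -> R) (p0 : R2 R) :
  polygon D z ->
  (forall p, p \in z -> is_outward_conormal D p (next z p) (nn p)) ->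
  is_trace D z w g -> is_trace D z w g' -> p0 \in z ->
  intseg p0 (next z p0) (fun x => (g x - g' x) ^+ 2) = 0.
Proof.
move=> Dz nnP tg tg' p0z.
pose c p v := enorm2 (next z p - p) * dot2 (nn p) v.
pose q p (t : R) := p + t *: (next z p - p).
have m01 : @measurable _ MR `[0, 1] := measurable_itv _.
have sg p : p \in z -> sqint mu `[0, 1] (g \o q p) by case: tg => _ + _; apply.
have sg' p : p \in z -> sqint mu `[0, 1] (g' \o q p) by case: tg' => _ + _; apply.
have sh p : p \in z -> sqint mu `[0, 1] (fun t => g (q p t) - g' (q p t)).
  by move=> pz; exact: (sqintB m01 (sg p pz) (sg' p pz)).
have st1 psi v : C1 psi -> v = e1 R \/ v = e2 R ->
    \sum_(p <- z) c p v * \int[mu]_(t in `[0, 1])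
      (psi (q p t) * (g (q p t) - g' (q p t))) = 0.
  move=> cpsi vE; have sp p : sqint mu `[0, 1] (psi \o q p).
    by apply: sqint_line; exact: C1_continuous.
  transitivity (\sum_(p <- z) (c p v * intseg p (next z p) (fun x => g x * psi x)
      - c p v * intseg p (next z p) (fun x => g' x * psi x))).
    rewrite !big_seq; apply: eq_bigr => p pz; rewrite -mulrBr; congr (_ * _).
    rewrite -RintegralB//; [|exact: (sqintM m01 (sg p pz) (sp p))
      |exact: (sqintM m01 (sg' p pz) (sp p))].
    by apply: eq_Rintegral => t _; rewrite -/(q p t); ring.
  rewrite sumrB -(trace_green Dz nnP tg cpsi vE) -(trace_green Dz nnP tg' cpsi vE).
  exact: subrr.
have spsi p psi : p \in z -> C1 psi ->
    sqint mu `[0, 1] (fun t => psi (q p t) * (g (q p t) - g' (q p t))).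
  move=> pz cpsi; have [B pB] := line_bounded p (next z p) (C1_continuous cpsi).
  have [mp _] := sqint_line p (next z p) (C1_continuous cpsi).
  have := sqint_mul_bounded m01 (sh p pz) mp pB.
  by congr (sqint _ _ _); apply/funext => t; exact: mulrC.
(* The smooth functions converging to a trace [G] are allowed as factors of the test function; in
   the limit [G] itself is allowed. Taking [g] and [g'] for [G] and subtracting yields the
   square. *)
have st2 G psi v : is_trace D z w G -> C1 psi -> v = e1 R \/ v = e2 R ->
    \sum_(p <- z) c p v * \int[mu]_(t in `[0, 1])
      (G (q p t) * (psi (q p t) * (g (q p t) - g' (q p t)))) = 0.
  case=> _ LG [u [su _ _ uG]] cpsi vE.
  have cu k : C1 (u k) by exact: smooth_C1.
  have L : \sum_(p <- z) c p v * \int[mu]_(t in `[0, 1])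
      (u k (q p t) * (psi (q p t) * (g (q p t) - g' (q p t)))) @[k --> \oo] -->
    \sum_(p <- z) c p v * \int[mu]_(t in `[0, 1])
      (G (q p t) * (psi (q p t) * (g (q p t) - g' (q p t)))).
    apply: cvg_sum_seq => p pz; apply: cvgM; first exact: cvg_cst.
    apply: (@sqint_cvg _ _ R mu `[0, 1]%classic m01 (fun k => u k \o q p) (G \o q p)
      (fun t => psi (q p t) * (g (q p t) - g' (q p t)))) (uG p pz).
    - by move=> k; apply: sqint_line; exact: C1_continuous.
    - exact: LG.
    - exact: spsi.
  have E k : \sum_(p <- z) c p v * \int[mu]_(t in `[0, 1])
      (u k (q p t) * (psi (q p t) * (g (q p t) - g' (q p t)))) = 0.
    rewrite -[RHS](st1 _ _ (C1M (cu k) cpsi) vE); apply: eq_bigr => p _.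
    by congr (_ * _); apply: eq_Rintegral => t _; rewrite mulrA.
  rewrite (funext E) in L; apply/esym.
  by apply: (cvg_unique _ (cvg_cst _) L); exact: norm_hausdorff.
have st3 psi v : C1 psi -> v = e1 R \/ v = e2 R ->
    \sum_(p <- z) c p v * \int[mu]_(t in `[0, 1])
      ((g (q p t) - g' (q p t)) ^+ 2 * psi (q p t)) = 0.
  move=> cpsi vE; transitivity (\sum_(p <- z) (c p v * \int[mu]_(t in `[0, 1])
      (g (q p t) * (psi (q p t) * (g (q p t) - g' (q p t)))) -
    c p v * \int[mu]_(t in `[0, 1])
      (g' (q p t) * (psi (q p t) * (g (q p t) - g' (q p t)))))); last first.
    by rewrite sumrB (st2 g)// (st2 g')// subrr.
  rewrite !big_seq; apply: eq_bigr => p pz.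
  rewrite -mulrBr; congr (_ * _); rewrite -RintegralB//.
  - by apply: eq_Rintegral => t _; ring.
  - exact: (sqintM m01 (sg p pz) (spsi p psi pz cpsi)).
  - exact: (sqintM m01 (sg' p pz) (spsi p psi pz cpsi)).
have [n1 ntau _] := nnP p0 p0z; set n := nn p0 in n1 ntau.
(* The identities for the two coordinate directions are combined with the components of [n]. The
   weight of the chosen side becomes its length; elsewhere the sign of the weight is arbitrary. *)
pose f p (t : R) := c p n * (g (q p t) - g' (q p t)) ^+ 2.
have pq : p0 != next z p0.
  rewrite eq_sym next_neq ?(polygon_uniq Dz)//.
  exact: (leq_trans _ (polygon_size Dz)).
have h0 : \int[mu]_(t in `[0, 1]) (f p0 t * (1 : {poly R}).[t]) = 0.
  apply: (@edge_localisation R D z p0 n (cst 0) f 1 Dz p0z n1 ntau).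
  - exact: integrable0.
  - by move=> p pz; exact: (integrableZl m01 _ (sh p pz).2).
  - move=> b a; rewrite mul1r.
    transitivity (0 : R).
      rewrite /int2; under eq_Rintegral do rewrite mul0r.
      rewrite Rintegral_cst ?mul0r//; apply: closed_measurable2.
      exact: (compact_closed2 (polygon_compact Dz)).
    have [ca _] := C1_along a p0 (next z p0); have [cb _] := C1_across b n p0.
    have cpsi := C1M ca cb.
    set psi := fun x => _ in cpsi.
    have S1 := st3 psi (e1 R) cpsi (or_introl erefl).
    have S2 := st3 psi (e2 R) cpsi (or_intror erefl).
    transitivity (n.1 * (\sum_(p <- z) c p (e1 R) * \int[mu]_(t in `[0, 1])
        ((g (q p t) - g' (q p t)) ^+ 2 * psi (q p t))) +
      n.2 * (\sum_(p <- z) c p (e2 R) * \int[mu]_(t in `[0, 1])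
        ((g (q p t) - g' (q p t)) ^+ 2 * psi (q p t)))).
      by rewrite S1 S2 !mulr0 addr0.
    rewrite !mulr_sumr -big_split /= !big_seq; apply: eq_bigr => p pz.
    rewrite [n.1 * (_ * _)]mulrA [n.2 * (_ * _)]mulrA -mulrDl.
    have -> : n.1 * c p (e1 R) + n.2 * c p (e2 R) = c p n.
      by rewrite /c /dot2 /=; ring.
    rewrite -RintegralZl//; last first.
      have [B pB] := line_bounded p (next z p) (C1_continuous cpsi).
      have [mp _] := sqint_line p (next z p) (C1_continuous cpsi).
      exact: (bounded_mul_integrable m01 (h := psi \o q p) (sh p pz).2 mp pB).
    by apply: eq_Rintegral => t _; rewrite /f mulrA.
  - move=> t _; rewrite hornerC mulr1 /f mulr_ge0 ?sqr_ge0//.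
    by rewrite /c n1 mulr1 sqrtr_ge0.
rewrite /intseg.
have ih := (sh p0 p0z).2.
have : c p0 n * \int[mu]_(t in `[0, 1]) ((g (q p0 t) - g' (q p0 t)) ^+ 2) = 0.
  rewrite -RintegralZl// -[RHS]h0; apply: eq_Rintegral => t _.
  by rewrite hornerC mulr1.
move=> /eqP; rewrite mulf_eq0 => /orP[|/eqP //].
rewrite /c n1 mulr1 sqrtr_eq0 leNgt dot2_gt0//.
by rewrite subr_eq0 eq_sym.
Qed.

End trace_uniqueness.

Section boundary_values.
Context {R : realType}.
Notation MR := (measurableTypeR R).
Notation mu := (@lebesgue_measure R).
Implicit Types (D : set (R2 R)) (z : seq (R2 R)) (nn : R2 R -> R2 R).

Lemma within_line_continuous (A : set (R2 R)) (p q : R2 R) (g : R2 R -> R) :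
  segment p q `<=` A -> {within A, continuous g} ->
  {within `[0, 1], continuous (fun t : R => g (p + t *: (q - p)))}.
Proof.
move=> sA cg; apply/subspace_continuousP => t t01.
move/subspace_continuousP : cg => cg.
have At s : `[0, 1]%classic s -> A (p + s *: (q - p)).
  by rewrite /= in_itv/= => s01; apply: sA; exists s.
apply/cvgrPdist_lt => e e0.
move/cvgrPdist_lt : (cg _ (At _ t01)) => /(_ _ e0).
rewrite !near_withinE => /(@line_continuous R _ p (q - p) t).
move=> h; have h' : \forall s \near t, A (p + s *: (q - p)) ->
    `|g (p + t *: (q - p)) - g (p + s *: (q - p))| < e by exact: h.
by apply: filterS h' => s h' /At; exact: h'.
Qed.

(** A nonzero value at some point keeps the square above half of its value there on an interval of
    positive length, clipped to the unit interval, and the integral would be positive. *)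
Lemma Rintegral_sqr_eq0 (h : R -> R) : {within `[0, 1], continuous h} ->
  \int[mu]_(t in `[0, 1]) (h t ^+ 2) = 0 -> forall t, 0 <= t <= 1 -> h t = 0.
Proof.
move=> ch h0 t0 t001; apply/eqP; apply: contraT => ht0.
have e0 : 0 < h t0 ^+ 2 / 2 by rewrite divr_gt0// exprn_even_gt0.
have ch2 : {within `[0, 1], continuous (fun t => h t ^+ 2)}.
  by move=> t; apply: continuousM; exact: ch.
have i2 : mu.-integrable `[0, 1] (EFin \o (fun t => h t ^+ 2)).
  exact: (continuous_integrable_itv true false ch2).
move/subspace_continuousP : (ch2) => /(_ t0).
rewrite /= in_itv/= => /(_ t001)/cvgrPdist_lt/(_ _ e0).
rewrite near_withinE => /nbhs_ballP[d d0 dE].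
pose c := Num.max 0 (t0 - d / 2); pose e := Num.min 1 (t0 + d / 2).
rewrite /= in d0.
have ce : [/\ 0 <= c, e <= 1, c < e, t0 - d / 2 <= c & e <= t0 + d / 2].
  rewrite /c /e; split; rewrite ?le_max ?ge_min ?lexx ?orbT//.
  by rewrite lt_min !gt_max; apply/andP; split; apply/andP; split; lra.
have [c0 e1 ce0 cd ed] := ce.
have hE t : c <= t <= e -> h t0 ^+ 2 / 2 <= h t ^+ 2.
  move=> /andP[ct te]; have : ball t0 d t.
    by rewrite -ball_normE /= ltr_norml; apply/andP; split; lra.
  move=> /dE; rewrite /= in_itv/= => /(_ _)/= h1.
  have /h1 t01 : 0 <= t <= 1 by apply/andP; split; lra.
  have : `|h t0 ^+ 2 - h t ^+ 2| < h t0 ^+ 2 / 2 by exact: t01.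
  by rewrite ltr_norml => /andP[]; lra.
have m01 : @measurable _ MR `[0, 1] := measurable_itv _.
have mce : @measurable _ MR `[c, e] := measurable_itv _.
have iI : mu.-integrable `[0, 1]
    (EFin \o (fun t : R => \1_(`[c, e]%classic : set R) t)).
  apply: (le_integrable_real m01 (g := cst 1)); first exact: measurable_indic.
    by apply: (@continuous_integrable_itv _ 0 1 true false (cst 1));
      apply: continuous_subspaceT => t; exact: cvg_cst.
  by move=> t _; rewrite indicE; case: (_ \in _); rewrite ?normr1 ?normr0.
have : \int[mu]_(t in `[0, 1]) (h t0 ^+ 2 / 2 * \1_(`[c, e]%classic) t) <= 0.
  rewrite -[leRHS]h0; apply: (le_Rintegral m01 (integrableZl m01 _ iI) i2).
  move=> t _; rewrite indicE; case: (boolP (t \in _)) => tce.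
    by rewrite mulr1; apply: hE; move: tce; rewrite inE /= in_itv.
  by rewrite mulr0 sqr_ge0.
rewrite RintegralZl// pmulr_rle0//.
rewrite leNgt => /negP; case.
rewrite /Rintegral (integral_indic _ m01 mce) setIidl; last first.
  by apply: subset_itv; rewrite bnd_simp.
rewrite [X in fine X](_ : _ = (e - c)%:E) ?subr_gt0//.
by rewrite -[LHS]/(mu `[c, e]%classic) lebesgue_measure_itv/= lte_fin ce0 EFinB.
Qed.

Lemma trace_unique D z nn (w g g' : R2 R -> R) (p : R2 R) :
  polygon D z ->
  (forall p, p \in z -> is_outward_conormal D p (next z p) (nn p)) ->
  is_trace D z w g -> is_trace D z w g' -> p \in z ->
  {within frontier D, continuous g} -> {within frontier D, continuous g'} ->
  {in segment p (next z p), g =1 g'}.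
Proof.
move=> Dz nnP tg tg' pz cg cg' x; rewrite inE => -[t t01 ->].
have sD : segment p (next z p) `<=` frontier D.
  by move=> y py; rewrite (polygon_frontier Dz); exists p.
have c1 := within_line_continuous sD cg; have c2 := within_line_continuous sD cg'.
apply/eqP; rewrite -subr_eq0; apply/eqP; move: t t01.
apply: Rintegral_sqr_eq0 (trace_unique_int Dz nnP tg tg' pz).
by move=> t; apply: continuousB; [exact: c1|exact: c2].
Qed.

(** [bdval] is picked among the continuous traces. Uniqueness on every side identifies it with the
    trace known to be piecewise polynomial. *)
Lemma bdvalP (m : nat) D z nn (w : R2 R -> R) :
  polygon D z ->
  (forall p, p \in z -> is_outward_conormal D p (next z p) (nn p)) ->
  trace_in_B m D z w ->
  is_trace D z w (bdval D z w) /\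
  forall p, p \in z -> exists2 q : {poly R}, (size q <= m.+1)%N &
    forall t : R, 0 <= t <= 1 -> bdval D z w (p + t *: (next z p - p)) = q.[t].
Proof.
move=> Dz nnP [g tg [cg gq]].
have [tb cb] : [set g | is_trace D z w g /\ {within frontier D, continuous g}]
    (bdval D z w).
  by apply: xgetPex; exists g.
split => // p pz; have [q sq qE] := gq p pz; exists q => // t t01.
rewrite -qE//; apply: (trace_unique Dz nnP tb tg pz cb cg).
by rewrite inE; exists t.
Qed.

End boundary_values.

Section trace_gradient.
Context {R : realType}.
Notation MR := (measurableTypeR R).
Notation mu := (@lebesgue_measure R).
Implicit Types (D : set (R2 R)) (z : seq (R2 R)) (nn : R2 R -> R2 R).

Lemma horner_integrable (a : {poly R}) :
  mu.-integrable `[0, 1] (EFin \o horner a).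
Proof.
apply: (@continuous_integrable_itv _ 0 1 true false (horner a)).
exact/continuous_subspaceT/continuous_horner.
Qed.

Lemma Rintegral_deriv (a : {poly R}) :
  \int[mu]_(t in `[0, 1]) a^`().[t] = a.[1] - a.[0].
Proof.
have ca : continuous (horner a^`()) by exact: continuous_horner.
have da (x : R) : is_derive x (1 : R) (horner a) a^`().[x].
  have := derivableP (@derivable_horner R a x).
  by rewrite -derive1E -derivE.
exact: (Rintegral_FTC2 ler01 ca da).
Qed.

Lemma poly_eq0_unit (a : {poly R}) :
  (forall t, 0 <= t <= 1 -> a.[t] = 0) -> a = 0.
Proof.
move=> a0; apply/eqP; apply: contraT => an0.
(* The reciprocals of 1, 2, 3 and so on: one root more than the degree of a nonzero [a] allows. *)
pose rs := [seq (i.+1%:R : R)^-1 | i <- iota 0 (size a)].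
have : (size rs < size a)%N.
  apply: max_poly_roots => //.
    apply/allP => _ /mapP[i _ ->]; apply/eqP/a0.
    by rewrite invr_ge0 ler0n invf_le1 ?ler1n ?ltr0n.
  rewrite map_inj_uniq ?iota_uniq// => i j /invr_inj/eqP.
  by rewrite eqr_nat eqSS => /eqP.
by rewrite size_map size_iota ltnn.
Qed.

Definition line_poly (c d : R) : {poly R} := c%:P + d *: 'X.

Lemma horner_line_poly c d t : (line_poly c d).[t] = c + d * t.
Proof. by rewrite /line_poly !hornerE. Qed.

Lemma deriv_line_poly c d : (line_poly c d)^`() = d%:P.
Proof. by rewrite /line_poly derivD derivC add0r derivZ derivX alg_polyC. Qed.

Lemma along_on_line (p q x y : R2 R) (t : R) : along p q (x + t *: (y - x)) =
  along p q x + dot2 (q - p) (y - x) / dot2 (q - p) (q - p) * t.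
Proof. by rewrite /along /dot2 !R2E; ring. Qed.

Lemma across_on_line (n p x y : R2 R) (t : R) :
  across n p (x + t *: (y - x)) = across n p x + dot2 n (y - x) * t.
Proof. by rewrite /across /dot2 !R2E; ring. Qed.

(** A unit vector orthogonal to [v] is [v] normalised and turned by a right angle; [sg] is 1 or -1
    according to the direction. It lets the two coordinate boundary terms combine into a derivative
    along the side. *)
Lemma conormal_rotation (n v : R2 R) : dot2 n n = 1 -> dot2 n v = 0 -> v != 0 ->
  exists2 sg : R, sg != 0 &
    enorm2 v * n.1 = sg * v.2 /\ enorm2 v * n.2 = - sg * v.1.
Proof.
move=> nn nv v0; have vv := dot2_gt0 v0.
have ev : enorm2 v != 0 by rewrite sqrtr_eq0 -ltNge.
have ev2 : enorm2 v * enorm2 v = dot2 v v by rewrite -expr2 sqr_sqrtr// ltW.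
set k := n.1 * v.2 - n.2 * v.1.
have h1 : dot2 v v * n.1 = k * v.2.
  transitivity (k * v.2 + v.1 * dot2 n v); last by rewrite nv mulr0 addr0.
  by rewrite /k /dot2; ring.
have h2 : dot2 v v * n.2 = - k * v.1.
  transitivity (- k * v.1 + v.2 * dot2 n v); last by rewrite nv mulr0 addr0.
  by rewrite /k /dot2; ring.
exists (k / enorm2 v).
  rewrite mulf_neq0 ?invr_eq0//; apply: contraTneq vv => k0.
  move: h1 h2; rewrite k0 oppr0 !mul0r => /eqP + /eqP.
  rewrite !mulf_eq0; have [->|vv0] := eqVneq (dot2 v v) 0; first by rewrite ltxx.
  by move=> /eqP n10 /eqP n20; move: nn; rewrite /dot2 n10 n20 !mul0r addr0 => /esym/eqP; rewrite oner_eq0.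
split; apply: (mulfI ev); rewrite !mulrA ev2.
  by rewrite h1; field.
by rewrite h2; field.
Qed.

End trace_gradient.

Section gradient_identity.
Context {R : realType}.
Notation MR := (measurableTypeR R).
Notation mu := (@lebesgue_measure R).
Implicit Types (D : set (R2 R)) (z : seq (R2 R)) (nn : R2 R -> R2 R).

Definition Ipoly (P : {poly R}) : R := \int[mu]_(t in `[0, 1]) P.[t].

Lemma IpolyD P Q : Ipoly (P + Q) = Ipoly P + Ipoly Q.
Proof.
rewrite /Ipoly -RintegralD//; [|exact: horner_integrable..].
by apply: eq_Rintegral => t _; rewrite hornerD.
Qed.

Lemma IpolyZ (c : R) P : Ipoly (c *: P) = c * Ipoly P.
Proof.
rewrite /Ipoly -RintegralZl//; last exact: horner_integrable.
by apply: eq_Rintegral => t _; rewrite hornerZ.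
Qed.

Lemma Ipoly_comb (P X Y Q : {poly R}) (t1 t2 : R) :
  Ipoly ((P - t1 *: X - t2 *: Y) * Q) =
  Ipoly (P * Q) - t1 * Ipoly (X * Q) - t2 * Ipoly (Y * Q).
Proof.
by rewrite -(scaleNr t1 X) -(scaleNr t2 Y) !mulrDl !IpolyD -!scalerAl !IpolyZ !mulNr.
Qed.

Lemma int2B D (f g : R2 R -> R) :
  @measurable _ (MR * MR)%type D ->
  (@mu2 R).-integrable D (EFin \o f) -> (@mu2 R).-integrable D (EFin \o g) ->
  int2 D (fun x => f x - g x) = int2 D f - int2 D g.
Proof. by move=> mD intf intg; rewrite /int2 -(RintegralB mD intf intg). Qed.

(* Green's formula for [phi] against the derivatives of [psi] and for the weak
   gradient of [phi] against [psi]; the second derivatives of [psi] cancel, and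
   the integrations by parts along the edges leave no vertex values because
   [psi] vanishes at the vertices. *)
Lemma trace_gradient_identity D z nn (phi g G1 G2 : R2 R -> R)
    (pg q1 q2 : R2 R -> {poly R}) (sg : R2 R -> R) (p0 q0 n : R2 R)
    (a b : {poly R}) :
  let w1 := wD D (e1 R) phi in let w2 := wD D (e2 R) phi in
  let gam p (t : R) := p + t *: (next z p - p) in
  polygon D z ->
  (forall p, p \in z -> is_outward_conormal D p (next z p) (nn p)) ->
  is_trace D z phi g -> is_trace D z w1 G1 -> is_trace D z w2 G2 ->
  (forall p t, p \in z -> 0 <= t <= 1 -> g (gam p t) = (pg p).[t]) ->
  (forall p t, p \in z -> 0 <= t <= 1 -> G1 (gam p t) = (q1 p).[t]) ->
  (forall p t, p \in z -> 0 <= t <= 1 -> G2 (gam p t) = (q2 p).[t]) ->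
  (forall p, p \in z ->
    enorm2 (next z p - p) * (nn p).1 = sg p * (next z p - p).2 /\
    enorm2 (next z p - p) * (nn p).2 = - sg p * (next z p - p).1) ->
  (forall v, v \in z -> a.[along p0 q0 v] = 0) ->
  int2 D (fun x => (wD D (e1 R) w2 x - wD D (e2 R) w1 x) *
    (a.[along p0 q0 x] * b.[across n p0 x])) =
  \sum_(p <- z) \int[mu]_(t in `[0, 1]) (- sg p *
    ((pg p)^`() - (next z p - p).1 *: q1 p - (next z p - p).2 *: q2 p).[t] *
    (a.[along p0 q0 (gam p t)] * b.[across n p0 (gam p t)])).
Proof.
move=> w1 w2 gam Dz nnP tg tG1 tG2 gE G1E G2E sgE a0.
have kD := polygon_compact Dz; have mD := closed_measurable2 (compact_closed2 kD).
pose s := along p0 q0; pose l := across n p0.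
pose ds v := dot2 (q0 - p0) v / dot2 (q0 - p0) (q0 - p0).
pose psi x := a.[s x] * b.[l x].
pose dpsi v x := a^`().[s x] * ds v * b.[l x] + a.[s x] * (b^`().[l x] * dot2 n v).
have [ca Da] := C1_along a p0 q0; have [cb Db] := C1_across b n p0.
have [ca' Da'] := C1_along a^`() p0 q0; have [cb' Db'] := C1_across b^`() n p0.
have cpsi : C1 psi := C1M ca cb.
have Dpsi v x : 'D_v psi x = dpsi v x.
  by rewrite (@derive_mul _ (fun x => a.[s x]) (fun x => b.[l x]) v x ca cb) Da Db.
have cc (c : R) : C1 (fun _ : R2 R => c) by have [] := C1_cst c.
have cDpsi v : C1 (dpsi v).
  exact: (C1D (C1M (C1M ca' (cc (ds v))) cb) (C1M ca (C1M cb' (cc (dot2 n v))))).1.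
have D2psi u v x : 'D_u (dpsi v) x =
    a^`()^`().[s x] * ds u * ds v * b.[l x] +
    a^`().[s x] * b^`().[l x] * (ds v * dot2 n u + ds u * dot2 n v) +
    a.[s x] * b^`()^`().[l x] * dot2 n u * dot2 n v.
  have D0 (c : R) (w y : R2 R) : 'D_w (fun _ : R2 R => c) y = 0.
    by have [_] := C1_cst c; exact.
  rewrite (C1D (C1M (C1M ca' (cc (ds v))) cb) (C1M ca (C1M cb' (cc (dot2 n v))))).2.
  rewrite (@derive_mul _ (fun x => a^`().[s x] * ds v) _ u x (C1M ca' (cc (ds v))) cb).
  rewrite (@derive_mul _ (fun x => a^`().[s x]) (fun=> ds v) u x ca' (cc (ds v))).
  rewrite (@derive_mul _ (fun x => a.[s x]) _ u x ca (C1M cb' (cc (dot2 n v)))).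
  rewrite (@derive_mul _ (fun x => b^`().[l x]) (fun=> dot2 n v) u x cb' (cc (dot2 n v))).
  rewrite !D0 Da Da' Db Db' -/(ds u); ring.
(* Read off the explicit second derivatives; this makes the two area terms containing [phi]
   cancel. *)
have D2sym x : 'D_(e1 R) (dpsi (e2 R)) x = 'D_(e2 R) (dpsi (e1 R)) x.
  by rewrite !D2psi; ring.
have L2c (f : R2 R -> R) : C1 f -> L2 D f.
  by move=> cf; apply: L2_continuous => //; exact: C1_continuous.
have E1 := trace_green Dz nnP tg (cDpsi (e2 R)) (or_introl erefl).
have E2 := trace_green Dz nnP tg (cDpsi (e1 R)) (or_intror erefl).
have E3 := trace_green Dz nnP tG1 cpsi (or_intror erefl).
have E4 := trace_green Dz nnP tG2 cpsi (or_introl erefl).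
have S12 : int2 D (fun x => phi x * 'D_(e1 R) (dpsi (e2 R)) x) =
    int2 D (fun x => phi x * 'D_(e2 R) (dpsi (e1 R)) x).
  by apply: eq_Rintegral => x _; rewrite D2sym.
have S1 : int2 D (fun x => w1 x * 'D_(e2 R) psi x) =
    int2 D (fun x => w1 x * dpsi (e2 R) x).
  by apply: eq_Rintegral => x _; congr (_ * _); exact: Dpsi.
have S2 : int2 D (fun x => w2 x * 'D_(e1 R) psi x) =
    int2 D (fun x => w2 x * dpsi (e1 R) x).
  by apply: eq_Rintegral => x _; congr (_ * _); exact: Dpsi.
have Lw12 : L2 D (wD D (e1 R) w2) by apply: wD_L2; case: tG2.
have Lw21 : L2 D (wD D (e2 R) w1) by apply: wD_L2; case: tG1.
rewrite -/w1 in E1; rewrite -/w2 in E2.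
have -> : int2 D (fun x => (wD D (e1 R) w2 x - wD D (e2 R) w1 x) *
    (a.[along p0 q0 x] * b.[across n p0 x])) =
  int2 D (fun x => wD D (e1 R) w2 x * psi x) -
  int2 D (fun x => wD D (e2 R) w1 x * psi x).
  rewrite -(int2B mD (sqintM mD Lw12 (L2c _ cpsi)) (sqintM mD Lw21 (L2c _ cpsi))).
  by apply: eq_Rintegral => x _; rewrite mulrBl.
(* Adding the four Green formulas with signs +, -, -, + cancels all area terms except the weak curl
   of the weak gradient. Its vanishing is not claimed: being integrable, it disappears in the
   localisation. *)
have comb (X X' a1 a1' a2 a2' c d s1 s2 s3 s4 : R) : X = X' -> a1' = a1 ->
    a2' = a2 -> X + a1 = s1 -> X' + a2 = s2 -> a1' + c = s3 -> a2' + d = s4 ->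
    d - c = s1 - s2 - s3 + s4.
  by move=> -> -> -> <- <- <- <-; ring.
transitivity (\sum_(p <- z) (
  enorm2 (next z p - p) * dot2 (nn p) (e1 R) *
    intseg p (next z p) (fun x => g x * dpsi (e2 R) x) -
  enorm2 (next z p - p) * dot2 (nn p) (e2 R) *
    intseg p (next z p) (fun x => g x * dpsi (e1 R) x) -
  enorm2 (next z p - p) * dot2 (nn p) (e2 R) *
    intseg p (next z p) (fun x => G1 x * psi x) +
  enorm2 (next z p - p) * dot2 (nn p) (e1 R) *
    intseg p (next z p) (fun x => G2 x * psi x))).
  rewrite big_split /= !sumrB; exact: (comb _ _ _ _ _ _ _ _ _ _ _ _ S12 S1 S2 E1 E2 E3 E4).
rewrite !big_seq; apply: eq_bigr => p pz.
have [n1 n2] := sgE p pz.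
have -> : dot2 (nn p) (e1 R) = (nn p).1 by rewrite /dot2 /=; ring.
have -> : dot2 (nn p) (e2 R) = (nn p).2 by rewrite /dot2 /=; ring.
rewrite n1 n2; set tau := next z p - p.
(* Both coordinates are affine in the parameter of a side, so [psi] and its gradient restrict to
   polynomials there and every boundary integral becomes an [Ipoly]. *)
pose sp := line_poly (s p) (dot2 (q0 - p0) tau / dot2 (q0 - p0) (q0 - p0)).
pose lp := line_poly (l p) (dot2 n tau).
have spE t : sp.[t] = s (gam p t) by rewrite horner_line_poly -along_on_line.
have lpE t : lp.[t] = l (gam p t) by rewrite horner_line_poly -across_on_line.
pose ap := a \Po sp; pose bp := b \Po lp; pose Psi := ap * bp.
pose dP v := (a^`() \Po sp) * (ds v)%:P * bp + ap * ((b^`() \Po lp) * (dot2 n v)%:P).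
have PsiE t : Psi.[t] = psi (gam p t).
  by rewrite hornerM !horner_comp spE lpE.
have dPE v t : (dP v).[t] = dpsi v (gam p t).
  by rewrite hornerD !hornerM !hornerC !horner_comp spE lpE.
have dPsi : Psi^`() = tau.1 *: dP (e1 R) + tau.2 *: dP (e2 R).
  rewrite derivM !deriv_comp !deriv_line_poly -!mul_polyC.
  have -> : dot2 (q0 - p0) tau / dot2 (q0 - p0) (q0 - p0) =
      tau.1 * ds (e1 R) + tau.2 * ds (e2 R).
    by rewrite /ds /dot2 /=; ring.
  have -> : dot2 n tau = tau.1 * dot2 n (e1 R) + tau.2 * dot2 n (e2 R).
    by rewrite /dot2 /=; ring.
  have comb2 (A B A' B' : {poly R}) (t1 t2 x1 x2 y1 y2 : R) :
      A' * (t1 * x1 + t2 * x2)%:P * B + A * (B' * (t1 * y1 + t2 * y2)%:P) =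
      t1%:P * (A' * x1%:P * B + A * (B' * y1%:P)) +
      t2%:P * (A' * x2%:P * B + A * (B' * y2%:P)).
    by rewrite !polyCD !polyCM; ring.
  exact: comb2.
have gI v : intseg p (next z p) (fun x => g x * dpsi v x) = Ipoly (pg p * dP v).
  apply: eq_Rintegral => t; rewrite inE /= in_itv/= => t01.
  by rewrite hornerM dPE -gE.
have GI1 : intseg p (next z p) (fun x => G1 x * psi x) = Ipoly (q1 p * Psi).
  apply: eq_Rintegral => t; rewrite inE /= in_itv/= => t01.
  by rewrite hornerM PsiE -G1E.
have GI2 : intseg p (next z p) (fun x => G2 x * psi x) = Ipoly (q2 p * Psi).
  apply: eq_Rintegral => t; rewrite inE /= in_itv/= => t01.
  by rewrite hornerM PsiE -G2E.
have gam0 : gam p 0 = p by rewrite /gam scale0r addr0.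
have gam1 : gam p 1 = next z p by rewrite /gam scale1r addrC subrK.
have nz : next z p \in z by rewrite mem_next.
have Psi0 : Psi.[0] = 0.
  by rewrite PsiE gam0 /psi (a0 p pz) mul0r.
have Psi1 : Psi.[1] = 0.
  by rewrite PsiE gam1 /psi (a0 _ nz) mul0r.
have comb3 (P X Y : {poly R}) t1 t2 :
    P * (t1 *: X + t2 *: Y) = t1 *: (P * X) + t2 *: (P * Y).
  by rewrite mulrDr -!scalerAr.
have parts : Ipoly ((pg p)^`() * Psi) + (tau.1 * Ipoly (pg p * dP (e1 R)) +
    tau.2 * Ipoly (pg p * dP (e2 R))) = 0.
  transitivity (Ipoly (pg p * Psi)^`()).
    by rewrite -!IpolyZ -!IpolyD; congr Ipoly; rewrite derivM dPsi comb3.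
  by rewrite /Ipoly Rintegral_deriv !(hornerM (pg p)) Psi0 Psi1 !mulr0 subrr.
rewrite !gI GI1 GI2.
have IB : Ipoly (((pg p)^`() - tau.1 *: q1 p - tau.2 *: q2 p) * Psi) =
    Ipoly ((pg p)^`() * Psi) - tau.1 * Ipoly (q1 p * Psi)
      - tau.2 * Ipoly (q2 p * Psi).
  exact: Ipoly_comb.
have comb4 (k t1 t2 I I1 I2 J1 J2 : R) : I + (t1 * I1 + t2 * I2) = 0 ->
    k * t2 * I2 - - k * t1 * I1 - - k * t1 * J1 + k * t2 * J2 =
    - k * (I - t1 * J1 - t2 * J2).
  by move=> /eqP; rewrite addr_eq0 => /eqP ->; ring.
rewrite (comb4 _ _ _ _ _ _ _ _ parts) -IB -IpolyZ.
by apply: eq_Rintegral => t _; rewrite hornerZ (hornerM _ Psi) PsiE mulrA.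
Qed.

End gradient_identity.

Section gradient_compatibility.
Context {R : realType}.
Notation mu := (@lebesgue_measure R).
Implicit Types (D : set (R2 R)) (z : seq (R2 R)) (nn : R2 R -> R2 R).

(* With [h] the defect of the identity on the edge of [p0] and [Pi] a polynomial
   along that edge vanishing at the projections of all vertices, the localised
   test function [h * Pi^2] yields that the integral of [(h * Pi)^2] is 0. *)
Lemma trace_gradient_compatible D z nn (phi g G1 G2 : R2 R -> R)
    (pg q1 q2 : R2 R -> {poly R}) (p0 : R2 R) :
  let w1 := wD D (e1 R) phi in let w2 := wD D (e2 R) phi in
  let gam p (t : R) := p + t *: (next z p - p) in
  polygon D z ->
  (forall p, p \in z -> is_outward_conormal D p (next z p) (nn p)) ->
  is_trace D z phi g -> is_trace D z w1 G1 -> is_trace D z w2 G2 ->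
  (forall p t, p \in z -> 0 <= t <= 1 -> g (gam p t) = (pg p).[t]) ->
  (forall p t, p \in z -> 0 <= t <= 1 -> G1 (gam p t) = (q1 p).[t]) ->
  (forall p t, p \in z -> 0 <= t <= 1 -> G2 (gam p t) = (q2 p).[t]) ->
  p0 \in z ->
  (pg p0)^`() = (next z p0 - p0).1 *: q1 p0 + (next z p0 - p0).2 *: q2 p0.
Proof.
move=> w1 w2 gam Dz nnP tg tG1 tG2 gE G1E G2E p0z.
have kD := polygon_compact Dz; have mD := closed_measurable2 (compact_closed2 kD).
have DE := polygon_edged Dz nnP.
have neq0 p : p \in z -> next z p - p != 0.
  by move=> pz; rewrite subr_eq0 next_neq ?(polygon_uniq Dz)// ltnW// (polygon_size Dz).
have /boolp.choice[sg sgP] : forall p, exists s : R, p \in z -> s != 0 /\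
    (enorm2 (next z p - p) * (nn p).1 = s * (next z p - p).2 /\
     enorm2 (next z p - p) * (nn p).2 = - s * (next z p - p).1).
  move=> p; have [pz|/negP pz] := boolP (p \in z); last by exists 0.
  have [n1 n2 _] := nnP p pz.
  by have [s s0 sE] := conormal_rotation n1 n2 (neq0 p pz); exists s.
have [n1 n2 _] := nnP p0 p0z; have [s0 _] := sgP p0 p0z.
pose h p := (pg p)^`() - (next z p - p).1 *: q1 p - (next z p - p).2 *: q2 p.
pose Pi : {poly R} := \prod_(v <- z) ('X - (along p0 (next z p0) v)%:P).
have Pi0 v : v \in z -> Pi.[along p0 (next z p0) v] = 0.
  move=> vz; rewrite horner_prod; apply/eqP; rewrite prodf_seq_eq0.
  by apply/hasP; exists v => //=; rewrite hornerXsubC subrr.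
have Pin0 : Pi != 0.
  by rewrite monic_neq0//; apply: monic_prod => v _; exact: monicXsubC.
(* The factor [- sg p0] makes the integrand on the chosen side the square of [sg p0 * h p0 * Pi], as
   the localisation requires a nonnegative one. *)
pose a := - sg p0 *: (h p0 * (Pi * Pi)).
have Lw12 : L2 D (wD D (e1 R) w2) by apply: wD_L2; case: tG2.
have Lw21 : L2 D (wD D (e2 R) w1) by apply: wD_L2; case: tG1.
have L1 : L2 D (fun=> 1) by apply: L2_continuous => // x; exact: cvg_cst.
have iA : (@mu2 R).-integrable D
    (EFin \o (fun x => wD D (e1 R) w2 x - wD D (e2 R) w1 x)).
  have iB := sqintM mD (sqintB mD Lw12 Lw21) L1.
  apply: eq_integrable iB => // x _ /=.
  by rewrite mulr1.
have key : \int[mu]_(t in `[0, 1]) ((- sg p0 * (h p0).[t]) * a.[t]) = 0.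
  apply: (edge_localisation (A := fun x => wD D (e1 R) w2 x - wD D (e2 R) w1 x)
    (f := fun p t => - sg p * (h p).[t]) (n := nn p0) Dz p0z n1 n2 iA).
  - move=> p pz; have := horner_integrable (- sg p *: h p).
    by congr (_.-integrable _ _); apply/funext => t /=; rewrite hornerZ.
  - move=> b c.
    apply: (trace_gradient_identity _ _ Dz nnP tg tG1 tG2 gE G1E G2E).
      by move=> p pz; have [_] := sgP p pz.
    by move=> v vz; rewrite /a !(hornerM, hornerZ) Pi0// !(mulr0, mul0r).
  - move=> t _; rewrite /a hornerZ !(hornerM (h p0)) (hornerM Pi).
    have -> (s x y : R) : s * x * (s * (x * (y * y))) = (s * x * y) ^+ 2 by ring.
    exact: sqr_ge0.
pose F := - sg p0 *: (h p0 * Pi).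
have F0 : F = 0.
  apply: poly_eq0_unit; apply: Rintegral_sqr_eq0.
    by apply: continuous_subspaceT; exact: continuous_horner.
  rewrite -[RHS]key; apply: eq_Rintegral => t _.
  rewrite /F /a !(hornerM, hornerZ) expr2; ring.
move/eqP : F0; rewrite scaler_eq0 oppr_eq0 (negbTE s0) mulf_eq0 (negbTE Pin0) orbF /=.
by rewrite /h -addrA -opprD subr_eq0 => /eqP.
Qed.

End gradient_compatibility.

(** * Faces and edges of a polyhedral surface *)

Section euclidean_space.
Context {R : realType}.
Implicit Types x y u w : R3 R.

Lemma dotE x y : dot x y = x 0 0 * y 0 0 + x 0 1 * y 0 1 + x 0 2%:R * y 0 2%:R.
Proof.
rewrite /dot !big_ord_recl big_ord0 addr0 addrA.
by congr (_ * _ + _ * _ + _ * _); congr (_ _ _); apply/val_inj.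
Qed.

Lemma cross0 x y : cross x y 0 0 = x 0 1 * y 0 2%:R - x 0 2%:R * y 0 1.
Proof. by rewrite mxE; congr (_ * _ - _ * _); congr (_ _ _); apply/val_inj. Qed.

Lemma cross1 x y : cross x y 0 1 = x 0 2%:R * y 0 0 - x 0 0 * y 0 2%:R.
Proof. by rewrite mxE; congr (_ * _ - _ * _); congr (_ _ _); apply/val_inj. Qed.

Lemma cross2 x y : cross x y 0 2%:R = x 0 0 * y 0 1 - x 0 1 * y 0 0.
Proof. by rewrite mxE; congr (_ * _ - _ * _); congr (_ _ _); apply/val_inj. Qed.

Lemma dotC x y : dot x y = dot y x.
Proof. by rewrite !dotE; ring. Qed.

Lemma dotDl x y u : dot (x + y) u = dot x u + dot y u.
Proof. by rewrite !dotE !mxE; ring. Qed.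

Lemma dotZl (k : R) x u : dot (k *: x) u = k * dot x u.
Proof. by rewrite !dotE !mxE; ring. Qed.

Lemma dotBl x y u : dot (x - y) u = dot x u - dot y u.
Proof. by rewrite !dotE !mxE; ring. Qed.

Lemma dotBr x y u : dot u (x - y) = dot u x - dot u y.
Proof. by rewrite !dotE !mxE; ring. Qed.

Lemma dotDr x y u : dot u (x + y) = dot u x + dot u y.
Proof. by rewrite !dotE !mxE; ring. Qed.

Lemma dotZr (k : R) x u : dot u (k *: x) = k * dot u x.
Proof. by rewrite !dotE !mxE; ring. Qed.

Lemma dotNr x u : dot u (- x) = - dot u x.
Proof. by rewrite !dotE !mxE; ring. Qed.

Lemma dot_cross_cross x y u w :
  dot (cross x y) (cross u w) = dot x u * dot y w - dot x w * dot y u.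
Proof. by rewrite !dotE !cross0 !cross1 !cross2; ring. Qed.

Lemma dot_cross_l x y : dot (cross x y) x = 0.
Proof. by rewrite !dotE !cross0 !cross1 !cross2; ring. Qed.

Lemma dot_cross_r x y : dot (cross x y) y = 0.
Proof. by rewrite !dotE !cross0 !cross1 !cross2; ring. Qed.

End euclidean_space.

Section frames.
Context {R : realType} (M : polysurf R) (PS : closed_polyhedral_surface M).
Implicit Types (K : face M) (u w : R2 R) (x y : R3 R) (e : edge M) (a : vert M).

Lemma tlift_dot K u w : dot (tlift K u) (tlift K w) = dot2 u w.
Proof.
have [t11 t22 t12] := ps_frame PS K.
rewrite /tlift !dotDl !dotDr !dotZl !dotZr t11 t22 (dotC (tau2 K)) t12 /dot2; ring.
Qed.

Lemma tlift_enorm K u : enorm (tlift K u) = enorm2 u.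
Proof. by rewrite /enorm tlift_dot. Qed.

Lemma nuK_tlift K u : dot (nuK K) (tlift K u) = 0.
Proof.
by rewrite /tlift dotDr !dotZr dot_cross_l dot_cross_r !mulr0 addr0.
Qed.

Lemma loc_affine K x y (t : R) :
  loc K (x + t *: (y - x)) = loc K x + t *: (loc K y - loc K x).
Proof.
by apply/R2_eq; rewrite !R2E /= !(dotBr, dotDr, dotZr); ring.
Qed.

Lemma emb_affine K u w (t : R) :
  emb K (u + t *: (w - u)) = emb K u + t *: (emb K w - emb K u).
Proof.
rewrite /emb /tlift !R2E; apply/rowP => i; rewrite !mxE; ring.
Qed.

Lemma emb_tlift K u w : emb K w - emb K u = tlift K (w - u).
Proof.
rewrite /emb /tlift !R2E; apply/rowP => i; rewrite !mxE; ring.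
Qed.

Definition edge_pt e (t : R) := pos (ea e) + t *: (pos (eb e) - pos (ea e)).

Lemma onb_cyc K e : onb K e -> ea e \in cyc K /\ eb e \in cyc K.
Proof.
move=> /hasP[a aK] /orP[]/andP[/eqP -> /eqP ->]; by rewrite mem_next aK.
Qed.

Lemma emb_loc_edge K e t : onb K e -> emb K (loc K (edge_pt e t)) = edge_pt e t.
Proof.
move=> /onb_cyc[aK bK]; rewrite loc_affine emb_affine.
by rewrite !(ps_planar PS).
Qed.

Lemma edge_tlift K e : onb K e ->
  pos (eb e) - pos (ea e) = tlift K (loc K (pos (eb e)) - loc K (pos (ea e))).
Proof. by move=> /onb_cyc[aK bK]; rewrite -emb_tlift !(ps_planar PS). Qed.

Lemma elenE K e : onb K e ->
  elen e = enorm2 (loc K (pos (eb e)) - loc K (pos (ea e))).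
Proof. by move=> Ke; rewrite /elen (edge_tlift Ke) tlift_enorm. Qed.

Lemma edge_pt0 e : edge_pt e 0 = pos (ea e).
Proof. by rewrite /edge_pt scale0r addr0. Qed.

Lemma edge_pt1 e : edge_pt e 1 = pos (eb e).
Proof. by rewrite /edge_pt scale1r addrC subrK. Qed.

End frames.

(** * Cyclic lists of vertices *)

Section cycles.

Lemma next_map_in (T T' : eqType) (f : T -> T') (s : seq T) (x : T) :
  {in s &, injective f} -> x \in s -> next (map f s) (f x) = f (next s x).
Proof.
case: s => // y s fI xs; have idx : index (f x) (map f (y :: s)) = index x (y :: s).
  elim: (y :: s) fI xs => // b r IH fI; rewrite /= in_cons.
  have [-> _|bx] := eqVneq b x; first by rewrite !eqxx.
  rewrite /= => xr.
  have -> : (f b == f x) = false.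
    by apply: contraNF bx => /eqP/fI -> //; rewrite in_cons ?eqxx ?xr ?orbT.
  rewrite IH// => u v ur vr; apply: fI; by rewrite in_cons ?ur ?vr orbT.
rewrite !next_nth xs map_f// idx /=.
have [lt|ge] := ltnP (index x (y :: s)) (size s); first by rewrite (nth_map y).
by rewrite !nth_default// size_map.
Qed.

(** A cycle of at least three vertices does not return after two steps. Hence no edge of a face
    joins two different vertices to their successors. *)
Lemma next_next_neq (T : eqType) (s : seq T) (x : T) :
  uniq s -> (2 < size s)%N -> x \in s -> next s (next s x) != x.
Proof.
move=> us ss xs; have [i s' sE] := rot_to xs.
have : uniq (rot i s) by rewrite rot_uniq.
have : (2 < size (rot i s))%N by rewrite size_rot.
rewrite -!(next_rot i us) sE; case: s' {sE} => [|b [|c s']] //= _.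
rewrite eqxx !inE !negb_or => /andP[/and3P[xb xc xs'] _].
by rewrite (eq_sym b) (negbTE xb)/= eqxx eq_sym.
Qed.

End cycles.

Section edges.
Context {R : realType} (M : polysurf R) (PS : closed_polyhedral_surface M).
Implicit Types (K : face M) (e : edge M) (a b : vert M).

Lemma cyc_uniq K : uniq (cyc K).
Proof. exact: map_uniq (polygon_uniq (ps_polygon PS K)). Qed.

Lemma cyc_size K : (2 < size (cyc K))%N.
Proof. by have := polygon_size (ps_polygon PS K); rewrite size_map. Qed.

Lemma loc_pos_inj K : {in cyc K &, injective (fun a => loc K (pos a))}.
Proof.
move=> a b aK bK ab; apply: (ps_pos_inj PS).
by rewrite -(ps_planar PS aK) ab (ps_planar PS bK).
Qed.

Lemma next_zs K a : a \in cyc K ->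
  next (zs K) (loc K (pos a)) = loc K (pos (next (cyc K) a)).
Proof. by move=> aK; rewrite /zs (next_map_in (@loc_pos_inj K) aK). Qed.

Lemma joins_ends e a b :
  reflect ((ea e = a /\ eb e = b) \/ (ea e = b /\ eb e = a)) (joins e a b).
Proof.
apply: (iffP orP) => [[/andP[/eqP -> /eqP ->]|/andP[/eqP -> /eqP ->]]|]; auto.
by move=> [[-> ->]|[-> ->]]; rewrite !eqxx; auto.
Qed.

Lemma joins_uniq e e' a b : joins e a b -> joins e' a b -> e = e'.
Proof.
move=> ee ee'; apply: (ps_edge_uniq PS); apply/joins_ends.
by move/joins_ends: ee => [[-> ->]|[-> ->]]; move/joins_ends: ee' => [[-> ->]|[-> ->]]; auto.
Qed.

Lemma joins_start K e a b : a \in cyc K -> b \in cyc K ->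
  joins e a (next (cyc K) a) -> joins e b (next (cyc K) b) -> a = b.
Proof.
move=> aK bK /joins_ends ha /joins_ends hb.
have [//|] : a = b \/ (b = next (cyc K) a /\ a = next (cyc K) b).
  by case: ha => [[<- <-]|[<- <-]]; case: hb => [[<- <-]|[<- <-]]; auto.
move=> [-> /esym/eqP].
by rewrite (negbTE (next_next_neq (cyc_uniq K) (cyc_size K) aK)).
Qed.

(** Green's formula sums over starting vertices in the coordinates of the face. Exactly one edge
    joins a vertex to its successor, and an edge of the face has exactly one such starting
    vertex. *)
Lemma sum_zs_edges K (T : R2 R -> R) (E : edge M -> R) :
  (forall a e, a \in cyc K -> joins e a (next (cyc K) a) ->
    T (loc K (pos a)) = E e) ->
  \sum_(p <- zs K) T p = \sum_(e | onb K e) E e.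
Proof.
move=> TE; rewrite big_map.
transitivity (\sum_(a <- cyc K) \sum_(e | joins e a (next (cyc K) a)) E e).
  rewrite !big_seq; apply: eq_bigr => a aK.
  have [e je] := ps_edge_exists PS aK; rewrite (TE _ _ aK je).
  rewrite (big_pred1 e)// => e'; apply/idP/eqP => [je'|-> //].
  exact: joins_uniq je' je.
rewrite (exchange_big_dep xpredT)//= [RHS]big_mkcond /=; apply: eq_bigr => e _.
rewrite big_const_seq /onb; case: hasP => [[a aK ja]|nh].
  have -> : count (fun b => joins e b (next (cyc K) b)) (cyc K) = 1%N.
    transitivity (count_mem a (cyc K)); last by rewrite count_uniq_mem ?cyc_uniq ?aK.
    apply: eq_in_count => b bK /=; apply/idP/eqP => [jb|-> //].
    exact: joins_start bK aK jb ja.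
  by rewrite /= addr0.
have -> : count (fun b => joins e b (next (cyc K) b)) (cyc K) = 0%N.
  apply/eqP; rewrite -leqn0 leqNgt -has_count; apply/hasP => -[b bK jb].
  by apply: nh; exists b.
by [].
Qed.

Lemma sum_face_edges (E : face M -> edge M -> R) :
  \sum_(K : face M) \sum_(e | onb K e) E K e =
  \sum_(e : edge M) (E (eK e) e + E (eL e) e).
Proof.
rewrite (exchange_big_dep xpredT)//=; apply: eq_bigr => e _.
have [KL onbE] := ps_edge_faces PS e.
rewrite (bigD1 (eK e))/= ?onbE ?eqxx//; congr (_ + _).
rewrite (big_pred1 (eL e))// => K; rewrite onbE /=.
have [->|] := eqVneq K (eK e); last by rewrite andbT.
by rewrite /=; apply/esym/eqP.
Qed.

Lemma onb_eK e : onb (eK e) e.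
Proof. by have [_ ->] := ps_edge_faces PS e; rewrite eqxx. Qed.

Lemma onb_eL e : onb (eL e) e.
Proof. by have [_ ->] := ps_edge_faces PS e; rewrite eqxx orbT. Qed.

Lemma conormal_sym (D : set (R2 R)) (p q n : R2 R) :
  is_outward_conormal D p q n -> is_outward_conormal D q p n.
Proof.
move=> [n1 n2 nD]; split => //.
  by rewrite -(opprB q p) -scaleN1r dot2Zr n2 mulr0.
move=> s s01; have s01' : 0 < 1 - s < 1 by case/andP: s01 => ? ?; apply/andP; split; lra.
have [eps e0 eE] := nD _ s01'; exists eps => // r rE.
have -> : q + s *: (p - q) = p + (1 - s) *: (q - p); last exact: eE.
by apply/R2_eq; rewrite !R2E; ring.
Qed.

(** The mesh attaches conormals to edges, the results on polygons to starting vertices of sides.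
    This looks up the edge that leaves the vertex at [p]; the value is 0 away from vertices. *)
Definition zs_conormal K (p : R2 R) : R2 R :=
  if [pick e | has (fun a => (loc K (pos a) == p) &&
                             joins e a (next (cyc K) a)) (cyc K)]
  is Some e then ncn K e else 0.

Lemma zs_conormalE K a e : a \in cyc K -> joins e a (next (cyc K) a) ->
  zs_conormal K (loc K (pos a)) = ncn K e.
Proof.
move=> aK je; rewrite /zs_conormal; case: pickP => [e'|/(_ e)/hasPn/(_ a aK)].
  move=> /hasP[b bK /andP[/eqP/(loc_pos_inj bK aK) -> je']].
  by rewrite (joins_uniq je' je).
by rewrite eqxx je.
Qed.

Lemma zs_conormalP K p : p \in zs K ->
  is_outward_conormal (dom K) p (next (zs K) p) (zs_conormal K p).
Proof.
move=> /mapP[a aK ->]; have [e je] := ps_edge_exists PS aK.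
rewrite (zs_conormalE aK je) (next_zs aK).
have Ke : onb K e by apply/hasP; exists a.
have := ps_conormal PS Ke.
by case/joins_ends : je => -[-> ->] // /conormal_sym.
Qed.

End edges.

Section face_traces.
Context {R : realType} (M : polysurf R) (PS : closed_polyhedral_surface M).
Notation mu := (@lebesgue_measure R).
Implicit Types (K : face M) (e : edge M) (w phi psi : R2 R -> R).

Lemma edge_side K e : onb K e -> exists p, [/\ p \in zs K,
  zs_conormal K p = ncn K e &
  (loc K (pos (ea e)) = p /\ loc K (pos (eb e)) = next (zs K) p) \/
  (loc K (pos (ea e)) = next (zs K) p /\ loc K (pos (eb e)) = p)].
Proof.
move=> /hasP[a aK je]; exists (loc K (pos a)); split.
- by apply: map_f.
- exact: zs_conormalE.
- by rewrite (next_zs PS aK); case/joins_ends : je => -[-> ->]; auto.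
Qed.

Lemma line_flip (p q : R2 R) (t : R) : q + t *: (p - q) = p + (1 - t) *: (q - p).
Proof. by apply/R2_eq; rewrite !R2E; ring. Qed.

Lemma unit_flip (t : R) : 0 <= t <= 1 -> 0 <= 1 - t <= 1.
Proof. by case/andP=> t0 t1; apply/andP; split; lra. Qed.

(** Reverses the parameter, as the fixed direction of an edge may run against the cyclic order of a
    face. *)
Definition flip_poly (q : {poly R}) : {poly R} := q \Po (1 - 'X).

Lemma horner_flip q t : (flip_poly q).[t] = q.[1 - t].
Proof. by rewrite horner_comp !hornerE. Qed.

Lemma size_flip q : (size (flip_poly q) <= size q)%N.
Proof.
have -> : flip_poly q = q \Po (- ('X - 1%:P)) by rewrite /flip_poly opprB.
by rewrite size_comp_poly2// size_polyN size_XsubC.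
Qed.

Lemma deriv_flip q : (flip_poly q)^`() = - flip_poly q^`().
Proof. by rewrite deriv_comp derivB derivX -polyC1 derivC sub0r mulrN1. Qed.

Lemma edge_trace_poly K e m w : onb K e -> trace_in_B m (dom K) (zs K) w ->
  exists2 q : {poly R}, (size q <= m.+1)%N &
    forall t, 0 <= t <= 1 -> bdval (dom K) (zs K) w (loc K (edge_pt e t)) = q.[t].
Proof.
move=> Ke /(bdvalP (ps_polygon PS K) (zs_conormalP PS (K := K)))[_ wq].
have [p [pz _ pE]] := edge_side Ke; have [q sq qE] := wq p pz.
case: pE => -[pa pb]; last first.
  exists (flip_poly q); first exact: leq_trans (size_flip q) sq.
  move=> t t01; rewrite horner_flip -qE ?unit_flip//.
  by rewrite loc_affine pa pb line_flip.
by exists q => // t t01; rewrite loc_affine pa pb qE.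
Qed.

Lemma edge_gradient K e phi : onb K e -> PhiK (dom K) (zs K) phi ->
  let tau := loc K (pos (eb e)) - loc K (pos (ea e)) in
  exists pg q1 q2 : {poly R}, [/\ (size pg <= 4)%N,
    forall t, 0 <= t <= 1 ->
      bdval (dom K) (zs K) phi (loc K (edge_pt e t)) = pg.[t],
    forall t, 0 <= t <= 1 ->
      bdvec (dom K) (zs K) (wgrad (dom K) phi) (loc K (edge_pt e t)) =
        (q1.[t], q2.[t]) &
    pg^`() = tau.1 *: q1 + tau.2 *: q2].
Proof.
move=> Ke [_ tphi [tw1 tw2] _] tau.
have bE := bdvalP (ps_polygon PS K) (zs_conormalP PS (K := K)).
(* The compatibility of trace and gradient is proved from the polynomials on all sides at once,
   hence the choice of a family. *)
have polys m w : trace_in_B m (dom K) (zs K) w -> exists q : R2 R -> {poly R},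
    forall p, p \in zs K -> (size (q p) <= m.+1)%N /\ forall t, 0 <= t <= 1 ->
    bdval (dom K) (zs K) w (p + t *: (next (zs K) p - p)) = (q p).[t].
  move=> /bE[_ wq].
  have /boolp.choice[q qP] : forall p, exists q : {poly R}, p \in zs K ->
      (size q <= m.+1)%N /\ forall t, 0 <= t <= 1 ->
      bdval (dom K) (zs K) w (p + t *: (next (zs K) p - p)) = q.[t].
    move=> p; have [pz|/negP pz] := boolP (p \in zs K); last by exists 0.
    by have [q sq qE] := wq p pz; exists q.
  by exists q.
have [pg pgP] := polys _ _ tphi.
have [q1 q1P] := polys _ _ tw1; have [q2 q2P] := polys _ _ tw2.
have [p [pz _ pE]] := edge_side Ke.
have comp : (pg p)^`() = (next (zs K) p - p).1 *: q1 p +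
    (next (zs K) p - p).2 *: q2 p.
  apply: (trace_gradient_compatible (ps_polygon PS K) (zs_conormalP PS (K := K))
    (bE _ _ tphi).1 (bE _ _ tw1).1 (bE _ _ tw2).1 _ _ _ pz) => r t rz t01.
  - exact: (pgP r rz).2.
  - exact: (q1P r rz).2.
  - exact: (q2P r rz).2.
have [spg pgE] := pgP p pz; have [_ q1E] := q1P p pz; have [_ q2E] := q2P p pz.
case: pE => -[pa pb].
  exists (pg p), (q1 p), (q2 p); split=> [//|t t01|t t01|].
  - by rewrite loc_affine pa pb pgE.
  - by rewrite loc_affine pa pb; exact: (f_equal2 pair (q1E t t01) (q2E t t01)).
  - by rewrite /tau pa pb.
exists (flip_poly (pg p)), (flip_poly (q1 p)), (flip_poly (q2 p)); split.
- exact: leq_trans (size_flip _) spg.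
- by move=> t t01; rewrite horner_flip -pgE ?unit_flip// loc_affine pa pb line_flip.
- move=> t t01; rewrite !horner_flip loc_affine pa pb line_flip.
  exact: (f_equal2 pair (q1E _ (unit_flip t01)) (q2E _ (unit_flip t01))).
- rewrite deriv_flip comp /tau pa pb -(opprB (next (zs K) p) p) !R2E.
  by rewrite /flip_poly comp_polyD !comp_polyZ !scaleNr opprD.
Qed.

Lemma line_mul_continuous (g psi : R2 R -> R) (q : {poly R}) (p r : R2 R) :
  (forall t, 0 <= t <= 1 -> g (p + t *: (r - p)) = q.[t]) -> continuous psi ->
  {within `[0, 1], continuous
    (fun t => g (p + t *: (r - p)) * psi (p + t *: (r - p)))}.
Proof.
move=> gq cpsi.
apply: (@subspace_eq_continuous _ _ _ (fun t => q.[t] * psi (p + t *: (r - p)))).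
  move=> t; rewrite inE /= in_itv/= => t01.
  exact: (congr1 ( *%R^~ _) (esym (gq t t01))).
apply: continuous_subspaceT => t; apply: continuousM.
  exact: continuous_horner.
by apply: continuous_comp; [exact: line_continuous|exact: cpsi].
Qed.

Lemma face_green K m w psi (v : R2 R) :
  trace_in_B m (dom K) (zs K) w -> C1 psi -> v = e1 R \/ v = e2 R ->
  int2 (dom K) (fun x => w x * 'D_v psi x) +
  int2 (dom K) (fun x => wD (dom K) v w x * psi x) =
  \sum_(e | onb K e) elen e * dot2 (ncn K e) v *
    \int[mu]_(t in `[0, 1]) (bdval (dom K) (zs K) w (loc K (edge_pt e t)) *
                              psi (loc K (edge_pt e t))).
Proof.
move=> tw cpsi vE.
have [bt bq] := bdvalP (ps_polygon PS K) (zs_conormalP PS (K := K)) tw.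
rewrite (trace_green (ps_polygon PS K) (zs_conormalP PS (K := K)) bt cpsi vE).
apply: (sum_zs_edges PS) => a e aK je.
have Ke : onb K e by apply/hasP; exists a.
rewrite (zs_conormalE PS aK je) (elenE PS Ke) (next_zs PS aK).
have int_edgeE : intseg (loc K (pos (ea e))) (loc K (pos (eb e)))
    (fun x => bdval (dom K) (zs K) w x * psi x) =
    \int[mu]_(t in `[0, 1]) (bdval (dom K) (zs K) w (loc K (edge_pt e t)) *
                              psi (loc K (edge_pt e t))).
  by apply: eq_Rintegral => t _; rewrite loc_affine.
rewrite -int_edgeE; case/joins_ends : je => -[eaE ebE]; first by rewrite eaE ebE.
rewrite eaE ebE; congr (_ * _ * _).
  by rewrite /enorm2 -opprB /dot2 !R2E !mulrNN.
apply: intseg_sym; rewrite -(next_zs PS aK).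
have aZ : loc K (pos a) \in zs K by apply: map_f.
have [q _ qE] := bq _ aZ.
apply: line_mul_continuous qE _; exact: C1_continuous.
Qed.

End face_traces.

(** * Edge jumps *)

Section hermite.
Context {R : realType}.
Implicit Types (J W d : {poly R}).

(** The data at 0 remove the two lowest coefficients; those at 1 then read [d2 + d3 = 0] and
    [2 d2 + 3 d3 = 0]. *)
Lemma hermite_eq0 d : (size d <= 4)%N -> d.[0] = 0 -> d.[1] = 0 ->
  d^`().[0] = 0 -> d^`().[1] = 0 -> d = 0.
Proof.
move=> sd; have dE : d = \poly_(i < 4) d`_i.
  apply/polyP => i; rewrite coef_poly; case: ltnP => // i4.
  by rewrite nth_default// (leq_trans sd).
rewrite !horner_coef0 coef_deriv mulr1n => d0 d1 d'0 d'1.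
have s1 : d`_0 + d`_1 + d`_2 + d`_3 = 0.
  rewrite -[RHS]d1 dE horner_poly !big_ord_recl big_ord0 /= !expr1n !mulr1 -dE.
  by rewrite addr0 !addrA.
have s2 : d`_1 + d`_2 *+ 2 + d`_3 *+ 3 = 0.
  have sd' : (size d^`() <= 3)%N.
    by apply/leq_sizeP => i i3; rewrite coef_deriv nth_default ?mul0rn ?(leq_trans sd).
  rewrite -[RHS]d'1 (horner_coef_wide 1 sd') !big_ord_recl big_ord0 /=.
  by rewrite !expr1n !mulr1 !coef_deriv addr0 mulr1n !addrA.
have d2 : d`_2 = 0 by lra.
have d3 : d`_3 = 0 by lra.
apply/polyP => -[|[|[|[|i]]]]; rewrite ?coef0//.
by rewrite nth_default// (leq_trans sd).
Qed.

Definition primitive J : {poly R} :=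
  \poly_(i < (size J).+1) (if i is j.+1 then J`_j / j.+1%:R else 0).

Lemma deriv_primitive J : (primitive J)^`() = J.
Proof.
apply/polyP => i; rewrite coef_deriv coef_poly ltnS.
have [iJ|Ji] := ltnP i (size J); last by rewrite mul0rn nth_default.
by rewrite -[LHS]mulr_natr divfK// pnatr_eq0.
Qed.

(** The primitive of [J] vanishing at 0 is a cubic that also vanishes at 1, by the zero mean, and
    whose derivatives at the ends are the values of [J]: all its Hermite data are 0. *)
Lemma quadratic_eq0 J : (size J <= 3)%N -> J.[0] = 0 -> J.[1] = 0 ->
  Ipoly J = 0 -> J = 0.
Proof.
move=> sJ J0 J1 IJ; have P0 : (primitive J).[0] = 0.
  by rewrite horner_coef0 coef_poly.
rewrite -(deriv_primitive J) (@hermite_eq0 (primitive J)) ?deriv0 ?deriv_primitive//.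
  by rewrite (leq_trans (size_poly _ _)).
by have := Rintegral_deriv (primitive J); rewrite P0 subr0 deriv_primitive => <-.
Qed.

End hermite.

Section edge_values.
Context {R : realType} (M : polysurf R) (PS : closed_polyhedral_surface M).
Implicit Types (K : face M) (e : edge M) (Ka : vert M -> face M).

Lemma elen_neq0 e : elen e != 0.
Proof.
have Ke := onb_eK PS e; have [aK bK] := onb_cyc Ke.
have ab : ea e != eb e.
  have nn a : a \in cyc (eK e) -> next (cyc (eK e)) a != a.
    by move=> aC; apply: next_neq (cyc_uniq PS _) (ltnW (cyc_size PS _)) aC.
  case/hasP: Ke => a aC /joins_ends[[-> ->]|[-> ->]]; last exact: nn.
  by rewrite eq_sym nn.
rewrite (elenE PS Ke) sqrtr_eq0 -ltNge; apply: dot2_gt0.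
rewrite subr_eq0; apply: contra ab => /eqP/(loc_pos_inj PS bK aK) ->.
exact: eqxx.
Qed.

Lemma loc_edge_dom K e t : onb K e -> 0 <= t <= 1 -> dom K (loc K (edge_pt e t)).
Proof.
move=> Ke t01; have [p [pz _ pE]] := edge_side PS Ke.
apply: (polygon_segment (ps_polygon PS K) pz); rewrite loc_affine.
case: pE => -[-> ->]; first by exists t.
by exists (1 - t); [exact: unit_flip|exact: line_flip].
Qed.

Lemma int_edge_poly e (f : R3 R -> R) (q : {poly R}) :
  (forall t, 0 <= t <= 1 -> f (edge_pt e t) = q.[t]) ->
  int_edge e f = elen e * Ipoly q.
Proof.
move=> fq; congr (_ * _); apply: eq_Rintegral => t.
by rewrite inE /= in_itv /= => /fq.
Qed.

Lemma bvec_poly K e m (v : pwfield M) (y : R3 R) : onb K e ->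
  trace_in_B m (dom K) (zs K) (c1 (v K)) ->
  trace_in_B m (dom K) (zs K) (c2 (v K)) ->
  exists2 q : {poly R}, (size q <= m.+1)%N &
    forall t, 0 <= t <= 1 -> dot (bvec v K (edge_pt e t)) y = q.[t].
Proof.
move=> Ke /(edge_trace_poly PS Ke)[q1 s1 q1E] /(edge_trace_poly PS Ke)[q2 s2 q2E].
exists (dot (tau1 K) y *: q1 + dot (tau2 K) y *: q2).
  rewrite (leq_trans (size_polyD _ _))// geq_max.
  by rewrite !(leq_trans (size_scale_leq _ _)).
move=> t t01; rewrite hornerD !hornerZ -q1E// -q2E// /bvec /tlift dotDl !dotZl /=.
exact: (f_equal2 +%R (mulrC _ _) (mulrC _ _)).
Qed.

(* The component of [M_(a,K) y] along [n_K] depends on [K] only through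
   [nu_K x n_K], which takes opposite values on the two faces of an edge. *)
Lemma dot_MaK Ka a K x u :
  dot (MaK Ka a K x) u = dot (cross (nuK (Ka a)) x) (cross (nuK K) u) +
    0 * dot (nuK K) u.
Proof.
rewrite /MaK dotBl !dotZl dot_cross_cross (dotC x (nuK K)); ring.
Qed.

Lemma jump_n_vertex Ka v e a : Sigma_h Ka v -> a \in cyc (eK e) ->
  a \in cyc (eL e) -> jump_n v e (pos a) = 0.
Proof.
move=> Sv aK aL; rewrite /jump_n (Sigma_vertex Sv aK) (Sigma_vertex Sv aL).
by rewrite !dot_MaK !mul0r !addr0 (ps_coherent PS) dotNr addNr.
Qed.

Lemma jump_n_eq0 Ka v e t : Sigma_h Ka v -> 0 <= t <= 1 ->
  jump_n v e (edge_pt e t) = 0.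
Proof.
move=> Sv t01.
have [aK bK] := onb_cyc (onb_eK PS e); have [aL bL] := onb_cyc (onb_eL PS e).
have [tK1 tK2] := SigmaK_trace (Sigma_local Sv (eK e)).
have [tL1 tL2] := SigmaK_trace (Sigma_local Sv (eL e)).
have [qK sK qKE] := bvec_poly (nK (eK e) e) (onb_eK PS e) tK1 tK2.
have [qL sL qLE] := bvec_poly (nK (eL e) e) (onb_eL PS e) tL1 tL2.
have JE s : 0 <= s <= 1 -> jump_n v e (edge_pt e s) = (qK + qL).[s].
  by move=> s01; rewrite hornerD -qKE// -qLE.
rewrite JE// (@quadratic_eq0 _ (qK + qL)) ?horner0//.
- by rewrite (leq_trans (size_polyD _ _))// geq_max sK.
- by rewrite -JE ?lexx ?ler01// edge_pt0; exact: jump_n_vertex Sv _ _.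
- by rewrite -JE ?lexx ?ler01// edge_pt1; exact: jump_n_vertex Sv _ _.
- have := Sigma_normal Sv e; rewrite (int_edge_poly JE) => /eqP.
  by rewrite mulf_eq0 (negbTE (elen_neq0 e)) => /eqP.
Qed.

(* The traces are cubic; at the end points of the edge they agree, and so do
   their tangential derivatives, as [P_K] leaves the edge direction fixed. *)
Lemma bval_edge_eq Ka phi e t : Phi_h Ka phi -> 0 <= t <= 1 ->
  bval phi (eK e) (edge_pt e t) = bval phi (eL e) (edge_pt e t).
Proof.
move=> Pp t01.
have [aK bK] := onb_cyc (onb_eK PS e); have [aL bL] := onb_cyc (onb_eL PS e).
(* Lifting to space is isometric, so the planar derivative along the edge becomes a product with the
   spatial edge vector, which is the same for both faces. *)
have grad K : onb K e -> exists2 q : {poly R}, (size q <= 4)%N &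
    (forall s, 0 <= s <= 1 -> bval phi K (edge_pt e s) = q.[s]) /\
    (forall s, 0 <= s <= 1 -> q^`().[s] =
      dot (pos (eb e) - pos (ea e)) (bvec (gradh phi) K (edge_pt e s))).
  move=> Ke; have [q [q1 [q2 [sq qE dqE q'E]]]] :=
    edge_gradient PS Ke (Phi_local Pp K).
  exists q => //; split => // s s01; rewrite q'E hornerD !hornerZ.
  by rewrite (edge_tlift PS Ke) /bvec (tlift_dot PS) /gradh dqE.
have tangent K a : onb K e -> a \in cyc K ->
    dot (pos (eb e) - pos (ea e)) (bvec (gradh phi) K (pos a)) =
    dot (pos (eb e) - pos (ea e)) (bvec (gradh phi) (Ka a) (pos a)).
  move=> Ke aC; rewrite (Phi_grad_vertex Pp aC) /PK dotBr dotZr.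
  by rewrite (edge_tlift PS Ke) (dotC _ (nuK K)) nuK_tlift mulr0 subr0.
have [qK sK [qKE dqK]] := grad _ (onb_eK PS e).
have [qL sL [qLE dqL]] := grad _ (onb_eL PS e).
have i0 : 0 <= (0 : R) <= 1 by rewrite lexx ler01.
have i1 : 0 <= (1 : R) <= 1 by rewrite lexx ler01.
have d0 : qK - qL = 0.
  apply: hermite_eq0; rewrite ?derivB ?hornerD ?hornerN.
  - by rewrite (leq_trans (size_polyD _ _))// size_polyN geq_max sK.
  - rewrite -(qKE _ i0) -(qLE _ i0) edge_pt0.
    by rewrite (Phi_vertex Pp aK) (Phi_vertex Pp aL) subrr.
  - rewrite -(qKE _ i1) -(qLE _ i1) edge_pt1.
    by rewrite (Phi_vertex Pp bK) (Phi_vertex Pp bL) subrr.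
  - by rewrite (dqK _ i0) (dqL _ i0) edge_pt0 !tangent ?onb_eK ?onb_eL// subrr.
  - by rewrite (dqK _ i1) (dqL _ i1) edge_pt1 !tangent ?onb_eK ?onb_eL// subrr.
by rewrite (qKE _ t01) (qLE _ t01); move/eqP: d0; rewrite subr_eq0 => /eqP ->.
Qed.

Lemma int_jump_t_eq0 Ka v e : Sigma_h Ka v -> int_edge e (jump_t v e) = 0.
Proof.
move=> Sv.
have [tK1 tK2] := SigmaK_trace (Sigma_local Sv (eK e)).
have [tL1 tL2] := SigmaK_trace (Sigma_local Sv (eL e)).
have [qK sK qKE] := bvec_poly (utan e) (onb_eK PS e) tK1 tK2.
have [qL sL qLE] := bvec_poly (utan e) (onb_eL PS e) tL1 tL2.
(* [Te] depends on the edge only, so both faces have the same tangential mean. *)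
have := Sigma_tangent Sv (onb_eK PS e); rewrite -(Sigma_tangent Sv (onb_eL PS e)).
rewrite (int_edge_poly qKE) (int_edge_poly qLE) !mulKf ?elen_neq0// => KL.
rewrite (@int_edge_poly _ _ (qK + (-1) *: qL)) => [|t t01].
  by rewrite IpolyD IpolyZ KL mulN1r subrr mulr0.
by rewrite hornerD hornerZ mulN1r -qKE// -qLE// /jump_t dotBl.
Qed.

Lemma sigma_opp e : sigma (eK e) e + sigma (eL e) e = 0.
Proof.
rewrite /sigma (ps_coherent PS) -scaleN1r dotZl; ring.
Qed.

Lemma int_jump_dn_eq0 Ka phi e : Phi_h Ka phi -> int_edge e (jump_dn phi e) = 0.
Proof.
move=> Pp.
have [tK1 tK2] := PhiK_grad_trace (Phi_local Pp (eK e)).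
have [tL1 tL2] := PhiK_grad_trace (Phi_local Pp (eL e)).
have [qK sK qKE'] := bvec_poly (v := gradh phi) (nK (eK e) e) (onb_eK PS e) tK1 tK2.
have [qL sL qLE'] := bvec_poly (v := gradh phi) (nK (eL e) e) (onb_eL PS e) tL1 tL2.
have qKE t : 0 <= t <= 1 -> dn phi (eK e) e (edge_pt e t) = qK.[t].
  by move=> t01; rewrite -qKE'// /dn dotC.
have qLE t : 0 <= t <= 1 -> dn phi (eL e) e (edge_pt e t) = qL.[t].
  by move=> t01; rewrite -qLE'// /dn dotC.
have := Phi_normal Pp (onb_eK PS e); have := Phi_normal Pp (onb_eL PS e).
rewrite (int_edge_poly qKE) (int_edge_poly qLE) !mulKf ?elen_neq0// => IL IK.
rewrite (@int_edge_poly _ _ (qK + qL)) => [|t t01].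
  by rewrite IpolyD IL IK -mulrDl sigma_opp mul0r mulr0.
by rewrite hornerD -qKE// -qLE.
Qed.

End edge_values.

(** * Green's formula summed over the surface *)

Section surface_green.
Context {R : realType} (M : polysurf R) (PS : closed_polyhedral_surface M).
Notation MR := (measurableTypeR R).
Notation mu := (@lebesgue_measure R).
Implicit Types (K : face M) (e : edge M) (Ka : vert M -> face M).

Lemma int2D (D : set (R2 R)) (f g : R2 R -> R) :
  @measurable _ (MR * MR)%type D ->
  (@mu2 R).-integrable D (EFin \o f) -> (@mu2 R).-integrable D (EFin \o g) ->
  int2 D (fun x => f x + g x) = int2 D f + int2 D g.
Proof. by move=> mD intf intg; rewrite /int2 -(RintegralD mD intf intg). Qed.

Lemma integrable_linear (a b : R) (f g : R -> R) :
  mu.-integrable `[0, 1] (EFin \o f) -> mu.-integrable `[0, 1] (EFin \o g) ->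
  mu.-integrable `[0, 1] (EFin \o (fun t => a * f t + b * g t)).
Proof.
move=> iF iG; have m01 : @measurable _ MR `[0, 1] := measurable_itv _.
exact: (integrableD m01 (integrableZl m01 a iF) (integrableZl m01 b iG)).
Qed.

Lemma Rintegral_linear (a b : R) (f g : R -> R) :
  mu.-integrable `[0, 1] (EFin \o f) -> mu.-integrable `[0, 1] (EFin \o g) ->
  a * \int[mu]_(t in `[0, 1]) f t + b * \int[mu]_(t in `[0, 1]) g t =
  \int[mu]_(t in `[0, 1]) (a * f t + b * g t).
Proof.
move=> iF iG; have m01 : @measurable _ MR `[0, 1] := measurable_itv _.
rewrite RintegralD//; first by rewrite !RintegralZl.
  exact: (integrableZl m01 a iF).
exact: (integrableZl m01 b iG).
Qed.

(** Integrability of one function suffices, as the other is its negative on the unit interval. *)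
Lemma Rintegral_cancel (f g : R -> R) : mu.-integrable `[0, 1] (EFin \o f) ->
  (forall t, 0 <= t <= 1 -> f t + g t = 0) ->
  \int[mu]_(t in `[0, 1]) f t + \int[mu]_(t in `[0, 1]) g t = 0.
Proof.
move=> iF fg.
have -> : \int[mu]_(t in `[0, 1]) g t = \int[mu]_(t in `[0, 1]) (-1 * f t + 0 * f t).
  apply: eq_Rintegral => t; rewrite inE /= in_itv /= => t01.
  by rewrite mul0r addr0 mulN1r; apply/eqP; rewrite -addr_eq0 addrC fg.
by rewrite -(Rintegral_linear _ _ iF iF); ring.
Qed.

Lemma trace_H1 m K w : trace_in_B m (dom K) (zs K) w -> H1_space (dom K) w.
Proof. by case=> g [] . Qed.

Lemma edge_mul_integrable m K e w (psi : R2 R -> R) : onb K e ->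
  trace_in_B m (dom K) (zs K) w -> C1 psi ->
  mu.-integrable `[0, 1] (EFin \o (fun t =>
    bdval (dom K) (zs K) w (loc K (edge_pt e t)) * psi (loc K (edge_pt e t)))).
Proof.
move=> Ke /(edge_trace_poly PS Ke)[q _ qE] cpsi.
apply: (@continuous_integrable_itv _ 0 1 true false (fun t =>
    bdval (dom K) (zs K) w (loc K (edge_pt e t)) * psi (loc K (edge_pt e t)))).
have -> : (fun t => bdval (dom K) (zs K) w (loc K (edge_pt e t)) *
      psi (loc K (edge_pt e t))) =
    (fun t => (fun x => bdval (dom K) (zs K) w x)
      (loc K (pos (ea e)) + t *: (loc K (pos (eb e)) - loc K (pos (ea e)))) *
      psi (loc K (pos (ea e)) + t *: (loc K (pos (eb e)) - loc K (pos (ea e))))).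
  by apply/funext => t; rewrite loc_affine.
apply: line_mul_continuous (C1_continuous cpsi) => t t01.
by rewrite -loc_affine; exact: qE.
Qed.

Lemma face_green_pair m K (w1 w2 psi1 psi2 : R2 R -> R) :
  trace_in_B m (dom K) (zs K) w1 -> trace_in_B m (dom K) (zs K) w2 ->
  C1 psi1 -> C1 psi2 ->
  int2 (dom K) (fun x => w1 x * 'D_(e1 R) psi1 x + w2 x * 'D_(e2 R) psi2 x) +
  int2 (dom K) (fun x => wD (dom K) (e1 R) w1 x * psi1 x +
                         wD (dom K) (e2 R) w2 x * psi2 x) =
  \sum_(e | onb K e) elen e * \int[mu]_(t in `[0, 1])
    ((ncn K e).1 * (bdval (dom K) (zs K) w1 (loc K (edge_pt e t)) *
                    psi1 (loc K (edge_pt e t))) +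
     (ncn K e).2 * (bdval (dom K) (zs K) w2 (loc K (edge_pt e t)) *
                    psi2 (loc K (edge_pt e t)))).
Proof.
move=> t1 t2 c1 c2.
have kD := polygon_compact (ps_polygon PS K).
have mD := closed_measurable2 (compact_closed2 kD).
have LC f : C1 f -> L2 (dom K) f.
  by move=> cf; apply: L2_continuous => //; exact: C1_continuous.
have LD f v : C1 f -> L2 (dom K) ('D_v f).
  by move=> cf; apply: L2_continuous => //; exact: C1_derive_continuous.
have H1 := trace_H1 t1; have H2 := trace_H1 t2.
rewrite (int2D mD (sqintM mD H1.1 (LD _ _ c1)) (sqintM mD H2.1 (LD _ _ c2))).
rewrite (int2D mD (sqintM mD (wD_L2 _ H1) (LC _ c1)) (sqintM mD (wD_L2 _ H2) (LC _ c2))).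
apply: etrans (addrACA _ _ _ _) _.
apply: etrans (f_equal2 +%R (face_green PS t1 c1 (or_introl erefl))
                            (face_green PS t2 c2 (or_intror erefl))) _.
rewrite -big_split /=.
apply: eq_bigr => e Ke.
have i1 := edge_mul_integrable Ke t1 c1; have i2 := edge_mul_integrable Ke t2 c2.
have -> : dot2 (ncn K e) (e1 R) = (ncn K e).1 by rewrite /dot2 /=; ring.
have -> : dot2 (ncn K e) (e2 R) = (ncn K e).2 by rewrite /dot2 /=; ring.
rewrite -!mulrA -mulrDr; congr (_ * _).
exact: Rintegral_linear.
Qed.

(** The facewise weak divergence is the candidate. After summation over the faces each edge carries
    the normal jump times the common value of the test function, and the jump is 0 at every
    point. *)
Lemma Sigma_Hdiv Ka v : Sigma_h Ka v -> Hdiv_Gamma v.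
Proof.
move=> Sv; have H1v K := SigmaK_H1 (Sigma_local Sv K).
have kD K := polygon_compact (ps_polygon PS K).
have mD K := closed_measurable2 (compact_closed2 (kD K)).
split=> [K|]; first by have [h1 h2] := H1v K; split; [exact: h1.1|exact: h2.1].
exists (fun K => wdiv (dom K) (v K)) => [K|psi [spsi psiE]].
  by have [h1 h2] := H1v K; exact: (sqintD (mD K) (wD_L2 _ h1) (wD_L2 _ h2)).
have cpsi K : C1 (psi K) by exact: smooth_C1 (spsi K).
have tv K := SigmaK_trace (Sigma_local Sv K).
apply/eqP; rewrite -addr_eq0; apply/eqP; rewrite /int_Gamma -big_split /=.
pose A K e t := (ncn K e).1 * (bdval (dom K) (zs K) (c1 (v K)) (loc K (edge_pt e t)) *
                    psi K (loc K (edge_pt e t))) +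
     (ncn K e).2 * (bdval (dom K) (zs K) (c2 (v K)) (loc K (edge_pt e t)) *
                    psi K (loc K (edge_pt e t))).
transitivity (\sum_(K : face M) \sum_(e | onb K e)
    elen e * \int[mu]_(t in `[0, 1]) A K e t).
  apply: eq_bigr => K _; have [t1 t2] := tv K.
  apply: etrans (face_green_pair t1 t2 (cpsi K) (cpsi K)); congr (_ + _).
  by apply: eq_Rintegral => x _; exact: mulrDl.
rewrite (sum_face_edges PS); apply: big1 => e _; rewrite -mulrDr.
rewrite Rintegral_cancel ?mulr0// => [|t t01].
  have [t1 t2] := tv (eK e).
  exact: (integrable_linear _ _ (edge_mul_integrable (onb_eK PS e) t1 (cpsi _))
    (edge_mul_integrable (onb_eK PS e) t2 (cpsi _))).
have KL : psi (eL e) (loc (eL e) (edge_pt e t)) = psi (eK e) (loc (eK e) (edge_pt e t)).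
  apply: psiE; rewrite ?(emb_loc_edge PS) ?onb_eK ?onb_eL//.
    exact: (loc_edge_dom PS (onb_eL PS e)).
  exact: (loc_edge_dom PS (onb_eK PS e)).
have := jump_n_eq0 PS e Sv t01; rewrite /jump_n !(tlift_dot PS) /A KL.
set P := psi _ _; rewrite /dot2 /= => J.
have comb (a1 a2 b1 b2 n1 n2 m1 m2 p : R) :
    a1 * n1 + a2 * n2 + (b1 * m1 + b2 * m2) = 0 ->
    n1 * (a1 * p) + n2 * (a2 * p) + (m1 * (b1 * p) + m2 * (b2 * p)) = 0.
  by move=> h; rewrite -[RHS](mul0r p) -h; ring.
exact: comb J.
Qed.

(** The roles are exchanged here: the function has one value on each edge, while the conormal
    components of the test field cancel. The facewise weak gradient is the candidate. *)
Lemma Phi_H1 Ka phi : Phi_h Ka phi -> H1_Gamma phi.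
Proof.
move=> Pp; have H2p K := PhiK_H2 (Phi_local Pp K).
have kD K := polygon_compact (ps_polygon PS K).
have mD K := closed_measurable2 (compact_closed2 (kD K)).
split=> [K|]; first by have [h1 _] := H2p K; exact: h1.1.
exists (gradh phi) => [K|psi [spsi psiE]].
  by have [h1 _] := H2p K; split; exact: wD_L2.
have cpsi1 K : C1 (c1 (psi K)) by exact: smooth_C1 (spsi K).1.
have cpsi2 K : C1 (c2 (psi K)) by exact: smooth_C1 (spsi K).2.
have tp K := PhiK_trace (Phi_local Pp K).
apply/eqP; rewrite -addr_eq0; apply/eqP; rewrite /int_Gamma -big_split /=.
pose A K e t :=
  (ncn K e).1 * (bdval (dom K) (zs K) (phi K) (loc K (edge_pt e t)) *
                 c1 (psi K) (loc K (edge_pt e t))) +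
  (ncn K e).2 * (bdval (dom K) (zs K) (phi K) (loc K (edge_pt e t)) *
                 c2 (psi K) (loc K (edge_pt e t))).
transitivity (\sum_(K : face M) \sum_(e | onb K e)
    elen e * \int[mu]_(t in `[0, 1]) A K e t).
  apply: eq_bigr => K _.
  apply: etrans (face_green_pair (tp K) (tp K) (cpsi1 K) (cpsi2 K)); congr (_ + _).
  by apply: eq_Rintegral => x _; exact: mulrDr.
rewrite (sum_face_edges PS); apply: big1 => e _; rewrite -mulrDr.
rewrite Rintegral_cancel ?mulr0// => [|t t01].
  exact: (integrable_linear _ _ (edge_mul_integrable (onb_eK PS e) (tp _) (cpsi1 _))
    (edge_mul_integrable (onb_eK PS e) (tp _) (cpsi2 _))).
have := bval_edge_eq PS e Pp t01; rewrite /bval /A => ->.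
have := psiE e (edge_pt e t); rewrite /dot2.
have comb (a n1 n2 m1 m2 p1 p2 q1 q2 : R) :
    p1 * n1 + p2 * n2 + (q1 * m1 + q2 * m2) = 0 ->
    n1 * (a * p1) + n2 * (a * p2) + (m1 * (a * q1) + m2 * (a * q2)) = 0.
  by move=> h; rewrite -[RHS](mulr0 a) -h; ring.
by move=> J; apply: comb; apply: J; exists t.
Qed.

End surface_green.

Theorem lemma3p1 (R : realType) (gamma W : set 'rV[R]_3) (delta rho C h0 : R)
    (surface_gamma : closed_C4_surface gamma) (side_W : is_side gamma W)
    (thin_delta : thin_tube gamma W delta) (rho_gt0 : 0 < rho)
    (small_h0 : h0_small gamma W delta rho C h0)
    (M : polysurf R) (adm_M : admissible gamma W delta rho C h0 M)
    (Ka : vert M -> face M) (KaP : forall a, a \in cyc (Ka a)) :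
  [/\ forall v, Sigma_h Ka v -> Hdiv_Gamma v,
      forall phi, Phi_h Ka phi -> H1_Gamma phi &
      forall v phi e, Sigma_h Ka v -> Phi_h Ka phi ->
        int_edge e (jump_t v e) = 0 /\ int_edge e (jump_dn phi e) = 0].
Proof.
have PS := adm_surface adm_M.
split=> [v|phi|v phi e Sv Pp].
- exact: Sigma_Hdiv.
- exact: Phi_H1.
- by split; [exact: int_jump_t_eq0 Sv|exact: int_jump_dn_eq0 Pp].
Qed.
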